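(* Let $T>0$, $q>0$, $\alpha\in(0,1)$, $\beta>0$, let $\Omega\subset\mathbb R^d$ ($d\ge1$) be a bounded domain with smooth boundary, $\omega\subset\Omega$ a nonempty subdomain, and let $\mathcal A$ be the elliptic operator specified in the context. Let $a\in H_0^1(\Omega)$, $\rho\in L^2(0,T)$ and $u_d\in L^2(\omega\times(0,T))$. For $g\in L^2(\Omega)$ let $u(\cdot,\cdot;g)$ denote the solution to $$\begin{cases}\partial_t u+q\,\partial_t^\alpha u+\mathcal A u=\rho(t)g(\boldsymbol x) & \text{in }\Omega\times(0,T),\\ u=a & \text{in }\Omega\times\{0\},\\ u=0 & \text{on }\partial\Omega\times(0,T),\end{cases}$$ and define $$\mathcal J(g):=\frac12\int_0^T\!\!\int_\omega\bigl(u(\boldsymbol x,t;g)-u_d(\boldsymbol x,t)\bigr)^2\,\mathrm d\boldsymbol x\,\mathrm dt+\frac\beta2\int_\Omega g^2(\boldsymbol x)\,\mathrm d\boldsymbol x .$$ Then the derivative of $\mathcal J$ with respect to $g$ is $$\mathcal J'(g)=\int_0^T\rho(t)v(\boldsymbol x,t)\,\mathrm dt+\beta g(\boldsymbol x),$$ where $v$ solves the adjoint problem $$\begin{cases}-\partial_t v+q\,\hat\partial_t^\alpha v+\mathcal A v=\mathbf 1_\omega\,(u(\boldsymbol x,t;g)-u_d(\boldsymbol x,t)) & \text{in }\Omega\times[0,T),\\ v(\boldsymbol x,T)=0 & \text{for }\boldsymbol x\in\Omega,\\ v=0 & \text{on }\partial\Omega\times[0,T).\end{cases}$$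
   Context: All functions are real-valued. The Caputo derivative of order $\alpha\in(0,1)$ is $\partial_t^\alpha f:=J_{0+}^{1-\alpha}(f')$, where $J_{0+}^{1-\alpha}f(t):=\frac{1}{\Gamma(1-\alpha)}\int_0^t (t-s)^{-\alpha}f(s)\,\mathrm ds$. The backward Riemann-Liouville derivative is $$\hat\partial_t^\alpha z:=-\partial_t\bigl({}_t\hat I_T^{1-\alpha}z\bigr),\qquad {}_t\hat I_T^{1-\alpha}z:=\frac1{\Gamma(1-\alpha)}\int_t^T\frac{z(s)}{(s-t)^\alpha}\,\mathrm ds .$$ $\mathbf 1_\omega$ is the characteristic function of $\omega$; the product $\mathbf 1_\omega(u-u_d)$ is understood to be zero outside $\omega$. The operator $\mathcal A:H^2(\Omega)\cap H_0^1(\Omega)\to L^2(\Omega)$ is $\mathcal A f=-\mathrm{div}(\boldsymbol A(\boldsymbol x)\nabla f)+c(\boldsymbol x)f$, where $\boldsymbol A=(a_{ij})_{1\le i,j\le d}\in C^1(\overline\Omega;\mathbb R^{d\times d}_{\mathrm{sym}})$ is strictly positive-definite on $\overline\Omega$, and $c\in L^\infty(\Omega)$ is nonnegative in $\Omega$. The solution $u(\cdot,\cdot;g)$ is the unique function in $L^2(0,T;H^2(\Omega)\cap H_0^1(\Omega))\cap H^1(0,T;L^2(\Omega))$ satisfying the equation a.e. in $\Omega\times(0,T)$ and the initial condition (existence and uniqueness in this class is known); the solution $v$ of the adjoint problem is understood in the same class, with the equation holding a.e. and $v(\cdot,T)=0$. The derivative is identified with an element of $L^2(\Omega)$: $\mathcal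 J'(g)\in L^2(\Omega)$ is characterized by $\mathcal J(g+\delta g)-\mathcal J(g)=\int_\Omega \mathcal J'(g)\,\delta g\,\mathrm d\boldsymbol x+o(\|\delta g\|_{L^2(\Omega)})$ as $\|\delta g\|_{L^2(\Omega)}\to0$, $\delta g\in L^2(\Omega)$. *)

(* Defs.v *)
From HB Require Import structures.
From mathcomp Require Import all_boot all_order all_algebra.
From mathcomp Require Import all_classical all_reals all_analysis.

Set Implicit Arguments.
Unset Strict Implicit.
Unset Printing Implicit Defensive.
Import Order.TTheory GRing.Theory Num.Theory.
Import numFieldNormedType.Exports.

Local Open Scope classical_set_scope.
Local Open Scope ring_scope.

Definition measure_rV_display : measure_display.
Proof. exact: default_measure_display. Qed.

(* Product sigma-algebra, generated by the n coordinates; it is the Borel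
   sigma-algebra of 'rV[R]_n. *)
Section measurable_rV.
Context {R : realType} {n : nat}.

Let coord : 'I_n -> 'rV[R]_n -> R := fun i x => x ord0 i.

Let rV_set0 : g_sigma_preimage coord set0.
Proof. exact: sigma_algebra0. Qed.

Let rV_setC A : g_sigma_preimage coord A -> g_sigma_preimage coord (~` A).
Proof. exact: sigma_algebraC. Qed.

Let rV_bigcup (F : (set 'rV[R]_n)^nat) :
  (forall i, g_sigma_preimage coord (F i)) ->
  g_sigma_preimage coord (\bigcup_i F i).
Proof. exact: sigma_algebra_bigcup. Qed.

HB.instance Definition _ := @isMeasurable.Build measure_rV_display
  'rV[R]_n (g_sigma_preimage coord) rV_set0 rV_setC rV_bigcup.

Lemma measurable_coord (i : 'I_n) :
  measurable_fun [set: 'rV[R]_n] (fun x : 'rV[R]_n => x ord0 i).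
Proof.
move=> _ Y mY; rewrite setTI; apply: sub_sigma_algebra => /=.
rewrite -bigcup_seq/=; exists i => /=; first by rewrite mem_index_enum.
by exists Y => //; rewrite setTI.
Qed.

End measurable_rV.

Section lebesgue_rV_succ.
Context {R : realType} {n : nat}.

Definition rV_cons (p : R * 'rV[R]_n) : 'rV[R]_n.+1 :=
  row_mx (p.1%:M : 'rV_1) p.2.

Lemma rV_cons0 p : rV_cons p ord0 ord0 = p.1.
Proof.
rewrite /rV_cons mxE; case: splitP => [j _|k /= /esym/eqP//].
by rewrite mxE [j]ord1.
Qed.

Lemma rV_consS p (i : 'I_n) : rV_cons p ord0 (lift ord0 i) = p.2 ord0 i.
Proof.
rewrite /rV_cons mxE; case: splitP => [j|k /=]; first by rewrite ord1.
by rewrite /bump leq0n !add1n => -[] ik; congr (p.2 _ _); exact/val_inj.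
Qed.

Lemma measurable_rV_cons : measurable_fun [set: R * 'rV[R]_n] rV_cons.
Proof.
move=> _ A mA; rewrite setTI; move: A mA.
apply: smallest_sub.
  split=> [|A mA|F mF].
  - by rewrite preimage_set0.
  - by rewrite setTD -preimage_setC; exact: measurableC.
  - by rewrite preimage_bigcup; exact: bigcupT_measurable.
move=> A; rewrite -bigcup_seq => -[i _ [B mB <-]]; rewrite setTI.
case: (unliftP ord0 i) => [j ->|->]; rewrite -comp_preimage.
- rewrite [X in X @^-1` _](_ : _ = (fun x : 'rV[R]_n => x ord0 j) \o snd).
    rewrite -[X in measurable X]setTI.
    by apply: (measurableT_comp (measurable_coord j) measurable_snd).
  by apply/funext => p /=; rewrite rV_consS.
- rewrite [X in X @^-1` _](_ : _ = fst).
    by rewrite -[X in measurable X]setTI; exact: measurable_fst.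
  by apply/funext => p /=; rewrite rV_cons0.
Qed.

Variable m : {sigma_finite_measure set 'rV[R]_n -> \bar R}.

Definition lebesgue_rV_succ : set 'rV[R]_n.+1 -> \bar R :=
  pushforward (@lebesgue_measure R \x m)%E rV_cons.

Let succ0 : lebesgue_rV_succ set0 = 0%E.
Proof. by rewrite /lebesgue_rV_succ /pushforward preimage_set0 measure0. Qed.

Let succ_ge0 A : (0 <= lebesgue_rV_succ A)%E.
Proof.
rewrite /lebesgue_rV_succ /pushforward.
exact: (@measure_ge0 _ _ _ (@lebesgue_measure R \x m)%E).
Qed.

Let succ_sigma_additive : semi_sigma_additive lebesgue_rV_succ.
Proof.
have mpre B : measurable B -> measurable (rV_cons @^-1` B).
  by move=> mB; rewrite -[X in measurable X]setTI; exact: measurable_rV_cons.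
move=> F mF tF mUF; rewrite /lebesgue_rV_succ /pushforward preimage_bigcup.
apply: measure_semi_sigma_additive.
- by move=> k; exact: mpre.
- apply/trivIsetP => /= i j _ _ ij; rewrite -preimage_setI.
  by move/trivIsetP : tF => /(_ _ _ _ _ ij) ->//; rewrite preimage_set0.
- by rewrite -preimage_bigcup; exact: mpre.
Qed.

HB.instance Definition _ := isMeasure.Build _ _ _
  lebesgue_rV_succ succ0 succ_ge0 succ_sigma_additive.

Definition rV_uncons (x : 'rV[R]_n.+1) : R * 'rV[R]_n :=
  (x ord0 ord0, \row_i x ord0 (lift ord0 i)).

Lemma rV_unconsK : cancel rV_uncons rV_cons.
Proof.
move=> x; apply/rowP => i; case: (unliftP ord0 i) => [j ->|->].
- by rewrite rV_consS mxE.
- by rewrite rV_cons0.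
Qed.

Lemma rV_consK : cancel rV_cons rV_uncons.
Proof.
move=> [r x]; rewrite /rV_uncons rV_cons0; congr pair.
by apply/rowP => i; rewrite mxE rV_consS.
Qed.

Lemma measurable_rV_uncons : measurable_fun [set: 'rV[R]_n.+1] rV_uncons.
Proof.
apply: measurable_fun_pair; first exact: measurable_coord.
move=> _ A mA; rewrite setTI; move: A mA.
apply: smallest_sub.
  split=> [|A mA|F mF].
  - by rewrite preimage_set0.
  - by rewrite setTD -preimage_setC; exact: measurableC.
  - by rewrite preimage_bigcup; exact: bigcupT_measurable.
move=> A; rewrite -bigcup_seq => -[i _ [B mB <-]]; rewrite setTI.
rewrite -comp_preimage -[X in measurable X]setTI.
rewrite (_ : _ \o _ = fun x : 'rV[R]_n.+1 => x ord0 (lift ord0 i)).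
  exact: measurable_coord.
by apply/funext => x /=; rewrite mxE.
Qed.

Let succ_sigma_finite : sigma_finite setT lebesgue_rV_succ.
Proof.
have /sigma_finiteP[F [TF ndF Foo]] := sigma_finiteT (@lebesgue_measure R).
have /sigma_finiteP[G [TG ndG Goo]] := sigma_finiteT m.
exists (fun k => rV_uncons @^-1` (F k `*` G k)).
  rewrite -preimage_bigcup -(preimage_setT rV_uncons); congr (_ @^-1` _).
  apply/esym; rewrite -subTset => -[r x] _.
  have [i _ Fi] : (\bigcup_k F k) r by rewrite -TF.
  have [j _ Gj] : (\bigcup_k G k) x by rewrite -TG.
  exists (maxn i j) => //; split => /=.
  - by move: Fi; exact/subsetPset/ndF/leq_maxl.
  - by move: Gj; exact/subsetPset/ndG/leq_maxr.
move=> k; have [mF Fk] := Foo k; have [mG Gk] := Goo k; split.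
  rewrite -[X in measurable X]setTI; apply: measurable_rV_uncons => //.
  exact: measurableX.
rewrite /lebesgue_rV_succ /pushforward -comp_preimage.
rewrite (_ : rV_uncons \o rV_cons = id) ?preimage_id; last first.
  by apply/funext => p /=; rewrite rV_consK.
rewrite product_measure1E// lte_mul_pinfty// ge0_fin_numE//.
Qed.

HB.instance Definition _ := @Measure_isSigmaFinite.Build _ _ _
  lebesgue_rV_succ succ_sigma_finite.

End lebesgue_rV_succ.

Section lebesgue_rV.
Context {R : realType}.

Fixpoint lebesgue_rV (n : nat) : {sigma_finite_measure set 'rV[R]_n -> \bar R} :=
  match n with
  | 0 => \d_(0 : 'rV[R]_0)
  | n'.+1 => lebesgue_rV_succ (lebesgue_rV n')
  end.

Lemma lebesgue_rV_box (n : nat) (B : 'I_n -> set R) :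
  (forall i, measurable (B i)) ->
  lebesgue_rV n [set x | forall i, B i (x ord0 i)] =
  (\prod_(i < n) lebesgue_measure (B i))%E.
Proof.
elim: n B => [|n IHn] B mB.
  rewrite big_ord0 /= diracE mem_set//= => -[].
  by case.
rewrite big_ord_recl -IHn//.
have mBn : measurable [set x : 'rV[R]_n | forall i, B (lift ord0 i) (x ord0 i)].
  rewrite (_ : mkset _ = \bigcap_(i in [set: 'I_n])
      ((fun x : 'rV[R]_n => x ord0 i) @^-1` B (lift ord0 i))).
    apply: fin_bigcap_measurable => // i _.
    by rewrite -[X in measurable X]setTI; exact: measurable_coord.
  by apply/seteqP; split => x /= Bx i; [move=> _|]; exact: Bx.
rewrite /= /lebesgue_rV_succ /pushforward -product_measure1E//; last exact: (mB ord0).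
congr product_measure1.
apply/seteqP; split => -[r x] /=.
- move=> H; split=> [|i]; first by have := H ord0; rewrite rV_cons0.
  by have := H (lift ord0 i); rewrite rV_consS.
- move=> [H0 H] i; case: (unliftP ord0 i) => [j ->|->].
  + by rewrite rV_consS; exact: H.
  + by rewrite rV_cons0.
Qed.

End lebesgue_rV.

Section Lebesgue_spaces.
Context {dd : measure_display} {X : measurableType dd} {R : realType}.
Variable mu : {measure set X -> \bar R}.

(* The functions below are defined on the whole ambient space and only their
   restriction to the domain D matters; restriction is f \_ D. *)
Definition memLp (p : \bar R) (D : set X) (f : X -> R) : Prop :=
  (f \_ D) \in Lfun mu p.

Definition memL2 := memLp 2%:E.

Definition normL2 (D : set X) (f : X -> R) : R :=
  fine ('N[mu]_2%:E[EFin \o (f \_ D)]).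

End Lebesgue_spaces.

Section Sobolev.
Context {R : realType} {d : nat}.
Notation E := 'rV[R]_d.
Implicit Types (Omega : set E) (f h : E -> R).

Local Notation leb := (lebesgue_rV d).

Definition partial (i : 'I_d) f : E -> R := 'D_(delta_mx ord0 i : E) f.

Fixpoint is_Ck (k : nat) f : Prop :=
  continuous f /\
  (if k is k'.+1 then
     forall i, (forall x, derivable f x (delta_mx ord0 i)) /\
               is_Ck k' (partial i f)
   else True).

Definition smooth f : Prop := forall k, is_Ck k f.

Definition test_fun Omega (phi : E -> R) : Prop :=
  [/\ smooth phi, compact (closure [set x | phi x != 0])
    & closure [set x | phi x != 0] `<=` Omega].

Definition is_weak_partial Omega (i : 'I_d) f h : Prop :=
  [/\ memL2 leb Omega f, memL2 leb Omega h
    & forall phi, test_fun Omega phi ->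
      \int[leb]_(x in Omega) (f x * partial i phi x) =
      - \int[leb]_(x in Omega) (h x * phi x)].

Definition has_weak_partial Omega (i : 'I_d) f : Prop :=
  exists h, is_weak_partial Omega i f h.

(* A representative of the weak partial derivative (junk value 0 when there
   is none). *)
Definition weak_partial Omega (i : 'I_d) f : E -> R :=
  xget (cst 0) [set h | is_weak_partial Omega i f h].

Definition memH1 Omega f : Prop :=
  memL2 leb Omega f /\ forall i, has_weak_partial Omega i f.

Definition memH2 Omega f : Prop :=
  memH1 Omega f /\ forall i, memH1 Omega (weak_partial Omega i f).

Definition normH2 Omega f : R :=
  Num.sqrt (normL2 leb Omega f ^+ 2 +
    \sum_(i < d) normL2 leb Omega (weak_partial Omega i f) ^+ 2 +
    \sum_(i < d) \sum_(j < d)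
      normL2 leb Omega (weak_partial Omega j (weak_partial Omega i f)) ^+ 2).

(* Closure of C_c^oo(Omega) in H^1(Omega). *)
Definition memH10 Omega f : Prop :=
  memH1 Omega f /\
  exists phi : nat -> E -> R,
    [/\ forall n, test_fun Omega (phi n),
        normL2 leb Omega (f \- phi n) @[n --> \oo] --> (0 : R)
      & forall i, normL2 leb Omega (weak_partial Omega i f \- partial i (phi n))
          @[n --> \oo] --> (0 : R)].

Definition domain Omega : Prop :=
  [/\ open Omega, Omega !=set0 & connected Omega].

(* Near each boundary point, Omega is the negativity set of a smooth function
   with nonvanishing gradient there.  Multiplying by a cut-off, the local
   defining function may be taken smooth on the whole space. *)
Definition smooth_boundary Omega : Prop :=
  forall p, (closure Omega `\` interior Omega) p ->
    exists phi : E -> R,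
      [/\ smooth phi, exists i, partial i phi p != 0
        & \forall x \near p, Omega x <-> phi x < 0].

(* C^1(closure Omega): the first partial derivatives exist in Omega and they,
   like f, extend continuously to the closure. *)
Definition is_C1_closure Omega f : Prop :=
  [/\ {within closure Omega, continuous f},
      forall i x, Omega x -> derivable f x (delta_mx ord0 i)
    & forall i, exists h : E -> R,
        {within closure Omega, continuous h} /\
        (forall x, Omega x -> h x = partial i f x)].

Definition elliptic_coeffs Omega (A : E -> 'M[R]_d) (c : E -> R) : Prop :=
  [/\ forall i j, is_C1_closure Omega (fun x => A x i j),
      forall x, closure Omega x -> (A x)^T = A x,
      forall x (xi : 'rV[R]_d), closure Omega x -> xi != 0 ->
        0 < (xi *m A x *m xi^T) ord0 ord0,
      memLp leb +oo%E Omega c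
    & \forall x \ae leb, Omega x -> 0 <= c x].

Definition elliptic_op Omega (A : E -> 'M[R]_d) (c : E -> R) f : E -> R :=
  fun x =>
    - (\sum_(i < d) weak_partial Omega i
        (fun y => \sum_(j < d) A y i j * weak_partial Omega j f y) x)
    + c x * f x.

End Sobolev.

Section Bochner.
Context {R : realType} {d : nat}.
Notation E := 'rV[R]_d.
Implicit Types (Omega : set E) (u h : E -> R -> R) (T : R).

Local Notation leb := (lebesgue_rV d).
Local Notation lebt := (@lebesgue_measure R).

Definition cylinder Omega T : set (E * R) := Omega `*` `]0, T[.

Definition simple_fun (V : set (E -> R)) (s : R -> E -> R) : Prop :=
  exists (m : nat) (B : 'I_m -> set R) (f : 'I_m -> E -> R),
    [/\ forall k, measurable (B k), forall k, V (f k)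
      & s = fun t x => \sum_(k < m) \1_(B k) t * f k x].

(* The Bochner space L^2(0,T;V), for a function space V on Omega with norm N.
   Its elements are represented by jointly measurable functions of (x,t); the
   clause on simple functions is strong measurability of the V-valued function
   t |-> u(.,t). *)
Definition memL2t T Omega (V : set (E -> R)) (N : (E -> R) -> R) u : Prop :=
  measurable_fun (cylinder Omega T) (fun p => u p.1 p.2) /\
  [/\ \forall t \ae lebt, t \in `]0, T[ -> V (u ^~ t),
      exists s : nat -> R -> E -> R,
        (forall n, simple_fun V (s n)) /\
        \forall t \ae lebt, t \in `]0, T[ ->
          N (u ^~ t \- s n t) @[n --> \oo] --> (0 : R)
    & (\int[lebt]_(t in `]0%R, T[) (N (u ^~ t) ^+ 2)%:E < +oo)%E].

Definition memL2L2 T Omega u : Prop :=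
  memL2t T Omega (memL2 leb Omega) (normL2 leb Omega) u.

Definition memL2H2H10 T Omega u : Prop :=
  memL2t T Omega [set f | memH2 Omega f /\ memH10 Omega f] (normH2 Omega) u.

Definition time_test_fun T (phi : R -> R) : Prop :=
  [/\ forall n t, derivable (derive1n n phi) t 1,
      compact (closure [set t | phi t != 0])
    & closure [set t | phi t != 0] `<=` `]0, T[].

(* h is the weak derivative of u : (0,T) -> L^2(Omega).  The L^2(Omega)-valued
   integrals are computed pointwise in x. *)
Definition is_weak_dt T Omega u h : Prop :=
  [/\ memL2L2 T Omega u, memL2L2 T Omega h
    & forall phi, time_test_fun T phi ->
      \forall x \ae leb, Omega x ->
        \int[lebt]_(t in `]0, T[) (u x t * derive1 phi t) =
        - \int[lebt]_(t in `]0, T[) (h x t * phi t)].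

Definition memH1L2 T Omega u : Prop := exists h, is_weak_dt T Omega u h.

Definition weak_dt T Omega u : E -> R -> R :=
  xget (fun _ _ => 0) [set h | is_weak_dt T Omega u h].

(* u(.,t0) = b, for t0 in [0,T]: the continuous L^2(Omega)-valued
   representative w of u takes the value b at t0. *)
Definition has_time_value T Omega u (t0 : R) (b : E -> R) : Prop :=
  exists w : R -> E -> R,
    [/\ forall t, t \in `[0, T] -> memL2 leb Omega (w t),
        forall s, s \in `[0, T] ->
          normL2 leb Omega (w t \- w s) @[t --> within `[0, T] (nbhs s)]
            --> (0 : R),
        \forall t \ae lebt, t \in `]0, T[ ->
          \forall x \ae leb, Omega x -> w t x = u x t
      & \forall x \ae leb, Omega x -> w t0 x = b x].

End Bochner.

Section fractional.
Context {R : realType}.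
Implicit Types (alpha T z : R) (f : R -> R).

Local Notation lebt := (@lebesgue_measure R).

(* Euler's Gamma function, for z > 0 *)
Definition Gamma z : R :=
  \int[lebt]_(s in `]0, +oo[) (s `^ (z - 1) * expR (- s)).

(* J_{0+}^{1-alpha} f *)
Definition frac_int alpha f (t : R) : R :=
  (Gamma (1 - alpha))^-1 *
  \int[lebt]_(s in `]0, t[) ((t - s) `^ (- alpha) * f s).

(* backward integral of order 1 - alpha, ending at T *)
Definition back_frac_int T alpha f (t : R) : R :=
  (Gamma (1 - alpha))^-1 *
  \int[lebt]_(s in `]t, T[) (f s / (s - t) `^ alpha).

End fractional.

Section fractional_dt.
Context {R : realType} {d : nat}.
Notation E := 'rV[R]_d.

Definition caputo T (Omega : set E) (alpha : R) (u : E -> R -> R) : E -> R -> R :=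
  fun x => frac_int alpha (weak_dt T Omega u x).

Definition back_RL T (Omega : set E) (alpha : R) (z : E -> R -> R) : E -> R -> R :=
  fun x t => - weak_dt T Omega (fun y => back_frac_int T alpha (z y)) x t.

End fractional_dt.

Section problems.
Context {R : realType} {d : nat}.
Notation E := 'rV[R]_d.
Variables (Omega : set E) (A : E -> 'M[R]_d) (c : E -> R) (T q alpha : R).

Local Notation leb := (lebesgue_rV d).
Local Notation lebt := (@lebesgue_measure R).

(* Au is a jointly measurable representative of A u, the operator acting on
   u(.,t) for a.e. t. *)
Definition elliptic_op_t (u Au : E -> R -> R) : Prop :=
  measurable_fun (cylinder Omega T) (fun p => Au p.1 p.2) /\
  \forall t \ae lebt, t \in `]0, T[ ->
    \forall x \ae leb, Omega x -> Au x t = elliptic_op Omega A c (u ^~ t) x.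

(* The homogeneous Dirichlet condition is part of membership in H^1_0. *)
Definition forward_solution (a : E -> R) (rho : R -> R) (g : E -> R)
    (u : E -> R -> R) : Prop :=
  [/\ memL2H2H10 T Omega u, memH1L2 T Omega u, has_time_value T Omega u 0 a
    & exists2 Au, elliptic_op_t u Au &
      \forall p \ae (leb \x lebt)%E, cylinder Omega T p ->
        weak_dt T Omega u p.1 p.2 + q * caputo T Omega alpha u p.1 p.2
          + Au p.1 p.2 = rho p.2 * g p.1].

Definition adjoint_solution (F : E -> R -> R) (v : E -> R -> R) : Prop :=
  [/\ memL2H2H10 T Omega v, memH1L2 T Omega v,
      has_time_value T Omega v T (cst 0),
      memH1L2 T Omega (fun x => back_frac_int T alpha (v x))
    & exists2 Av, elliptic_op_t v Av &
      \forall p \ae (leb \x lebt)%E, cylinder Omega T p ->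
        - weak_dt T Omega v p.1 p.2 + q * back_RL T Omega alpha v p.1 p.2
          + Av p.1 p.2 = F p.1 p.2].

Definition cost (omega : set E) (ud : E -> R -> R) (beta : R)
    (u : (E -> R) -> E -> R -> R) (g : E -> R) : R :=
  2^-1 * \int[lebt]_(t in `]0, T[) \int[leb]_(x in omega)
           ((u g x t - ud x t) ^+ 2)
  + beta / 2 * \int[leb]_(x in Omega) (g x ^+ 2).

Definition is_L2_derivative (J : (E -> R) -> R) (g G : E -> R) : Prop :=
  memL2 leb Omega G /\
  forall eps : R, 0 < eps -> exists2 eta : R, 0 < eta &
    forall dg, memL2 leb Omega dg -> normL2 leb Omega dg < eta ->
      `|J (g \+ dg) - J g - \int[leb]_(x in Omega) (G x * dg x)|
        <= eps * normL2 leb Omega dg.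

End problems.

(* Main.v *)
Require Import Defs.
From HB Require Import structures.
From mathcomp Require Import all_boot all_order all_algebra.
From mathcomp Require finmap.
From mathcomp Require Import all_classical all_reals all_analysis.
From mathcomp Require Import measurable_realfun.
From mathcomp Require Import ring lra.

(** Write w = u(g + dg) - u(g) and h for its time derivative.  The control-to-state
    map being affine, J(g + dg) - J(g) - <G, dg> is half the square of w integrated
    over omega x (0,T), plus beta / 2 ||dg||^2, as soon as

      (1)  \iint rho dg v = \iint w 1_omega (u(g) - u_d),

    and the theorem follows from (1) and the energy estimate

      (2)  \iint w^2 <= 4 T^2 \iint (rho dg)^2.

    For a.e. x, du Bois-Reymond's lemma makes w(x,.), v(x,.) and the backward integral
    of v(x,.) primitives, whose constants are found from the time values of u and v
    and from the decay of the backward integral at T.  Fubini on the triangle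
    s < t then transposes the time operator in (1); in (2), tested against (T - t) w,
    the fractional term is nonnegative because t^-alpha is a superposition of step
    kernels 1_{t < r}.  For a.e. t, Green's formula disposes of the elliptic operator,
    by symmetry in (1) and monotonicity in (2).

    Green's formula needs a f to have a weak partial derivative when a is C^1 and f is
    H^1, that is, test functions of class C^1 for f.  Given such a function phi and a
    smooth cut-off S positive on its support, a Bernstein polynomial approximating
    the i-th partial derivative of phi / S has an antiderivative p in the i-th variable,
    and S p is a genuine test function close to phi together with its i-th derivative. *)

Set Implicit Arguments.
Unset Strict Implicit.
Unset Printing Implicit Defensive.
Import Order.TTheory GRing.Theory Num.Theory.
Import numFieldNormedType.Exports.

Local Open Scope classical_set_scope.
Local Open Scope ring_scope.

(** * Square-integrable functions and iterated integrals *)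

(** Two kinds of choices shape the argument. A weak time derivative is tested by one function [phi]
    at a time, and the exceptional null set of [x] depends on [phi]; du Bois-Reymond's lemma
    therefore has to work from a countable family of test functions, built on rational endpoints.
    The representatives [weak_dt] and [weak_partial] are arbitrary selections, and that of a
    difference need not be the difference of those: the data of two solutions are subtracted, and w
    itself is never differentiated.

    Real-valued integrals are 0 on functions that are not integrable, and A w and the fractional
    derivative of w enter only as measurable functions. Bilinear bounds of Schur type make their
    products with w and v integrable before Fubini's theorem is applied; source minus A w is carried
    as one function.

    The weight T - t in (2) is the integral of 1 over ]t,T[: testing with it integrates over t the
    energy balance on ]0,t[ and so controls the integral of w^2. It also decreases, so that shifting
    w^2 to the right loses weight, which is the source of positivity. Its bound T and Young's
    inequality give 4 T^2. *)

Section L2.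
Context {dd : measure_display} {X : measurableType dd} {R : realType}.
Variable mu : {measure set X -> \bar R}.
Variable D : set X.
Hypothesis mD : measurable D.
Implicit Types f g : X -> R.

Lemma Lnorm2E f :
  ('N[mu]_2%:E[EFin \o (f \_ D)] =
   (\int[mu]_(x in D) (f x ^+ 2)%:E) `^ 2^-1)%E.
Proof.
rewrite unlock /=; congr (_ `^ _)%E.
rewrite [RHS]integral_mkcond; apply: eq_integral => x _ /=.
rewrite powR_mulrn// !patchE; case: ifPn => _ /=.
  by rewrite real_normK ?num_real.
by rewrite normr0 expr0n.
Qed.

Lemma integral_sqr_ge0 f : (0 <= \int[mu]_(x in D) ((f x ^+ 2)%:E))%E.
Proof. by apply: integral_ge0 => x _; rewrite lee_fin sqr_ge0. Qed.

Lemma memL2P f : memL2 mu D f <->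
  measurable_fun D f /\ mu.-integrable D (EFin \o (fun x => f x ^+ 2)).
Proof.
have E : (('N[mu]_2%:E[EFin \o (f \_ D)] < +oo) <->
    (\int[mu]_(x in D) ((f x ^+ 2)%:E) < +oo))%E.
  by rewrite Lnorm2E; split; [exact: lty_poweRy|exact: poweR_lty].
split=> [/andP[]|[mf /integrableP[mf2 fi]]].
- rewrite inE /= => mf; rewrite inE /= => /E fi.
  have mfD := (measurable_restrictT f mD).2 mf.
  split=> //; apply/integrableP; split.
    by apply/measurable_EFinP; exact: measurable_funX.
  rewrite (eq_integral (fun x => (f x ^+ 2)%:E))// => x _ /=.
  by rewrite ger0_norm// sqr_ge0.
- rewrite /memL2 /memLp inE; apply/andP; split; rewrite inE /=.
    exact: (measurable_restrictT f mD).1.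
  apply/E; move: fi; rewrite (eq_integral (fun x => (f x ^+ 2)%:E))//.
  by move=> x _ /=; rewrite ger0_norm// sqr_ge0.
Qed.

Lemma memL2_meas f : memL2 mu D f -> measurable_fun D f.
Proof. by move=> /memL2P[]. Qed.

Lemma memL2_sqr f : memL2 mu D f ->
  mu.-integrable D (EFin \o (fun x => f x ^+ 2)).
Proof. by move=> /memL2P[]. Qed.

Lemma normL2_ge0 f : 0 <= normL2 mu D f.
Proof. by rewrite /normL2 fine_ge0// Lnorm2E poweR_ge0. Qed.

(** No integrability is assumed: when the integral is infinite so is its square root, and [fine]
    sends both to 0. *)
Lemma normL2_sqr f : normL2 mu D f ^+ 2 = \int[mu]_(x in D) (f x ^+ 2).
Proof.
rewrite /normL2 Lnorm2E /Rintegral.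
have := integral_sqr_ge0 f; case: (integral _ _ _) => [r| |]//=.
- rewrite lee_fin => r0; rewrite -powR_mulrn ?powR_ge0// -powRrM mulVf ?powRr1//.
- move=> _; rewrite (_ : (2^-1 == 0 :> R) = false) /= ?expr0n//.
  by apply/negbTE; rewrite invr_neq0.
Qed.

Lemma integrable_le_real f g : measurable_fun D f ->
  (forall x, D x -> `|f x| <= g x) -> mu.-integrable D (EFin \o g) ->
  mu.-integrable D (EFin \o f).
Proof.
move=> mf fg; apply: le_integrable => //; first exact/measurable_EFinP.
by move=> x Dx /=; rewrite lee_fin (le_trans (fg _ Dx))// ler_norm.
Qed.

Lemma integrable_real_meas f : mu.-integrable D (EFin \o f) -> measurable_fun D f.
Proof. by move=> /measurable_int /measurable_EFinP. Qed.

Lemma integrableD_real f g : mu.-integrable D (EFin \o f) ->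
  mu.-integrable D (EFin \o g) -> mu.-integrable D (EFin \o (fun x => f x + g x)).
Proof. by move=> fi gi; exact: (integrableD _ fi gi). Qed.

Lemma integrableB_real f g : mu.-integrable D (EFin \o f) ->
  mu.-integrable D (EFin \o g) -> mu.-integrable D (EFin \o (fun x => f x - g x)).
Proof. by move=> fi gi; exact: (integrableB _ fi gi). Qed.

Lemma integrableZ_real (k : R) f : mu.-integrable D (EFin \o f) ->
  mu.-integrable D (EFin \o (fun x => k * f x)).
Proof. by move=> fi; exact: (integrableZl _ _ fi). Qed.

Lemma integrable0_real : mu.-integrable D (EFin \o (fun=> 0 : R)).
Proof. exact: integrable0. Qed.

Lemma integrable_sum_real (I : Type) (s : seq I) (P : pred I) (F : I -> X -> R) :
  (forall i, P i -> mu.-integrable D (EFin \o F i)) ->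
  mu.-integrable D (EFin \o (fun x => \sum_(i <- s | P i) F i x)).
Proof.
move=> Fi; have := integrable_sum mD s Fi.
by apply: eq_integrable => // x _ /=; rewrite sumEFin.
Qed.

Lemma Rintegral_sum (I : Type) (s : seq I) (F : I -> X -> R) :
  (forall i, mu.-integrable D (EFin \o F i)) ->
  \int[mu]_(x in D) (\sum_(i <- s) F i x) = \sum_(i <- s) \int[mu]_(x in D) F i x.
Proof.
move=> Fi; elim: s => [|i s ih].
  by under eq_Rintegral do rewrite big_nil; rewrite big_nil Rintegral_cst// mul0r.
under eq_Rintegral do rewrite big_cons.
by rewrite RintegralD// ?big_cons ?ih//; exact: integrable_sum_real.
Qed.

Lemma eq_integrable_real f g : {in D, f =1 g} ->
  mu.-integrable D (EFin \o f) -> mu.-integrable D (EFin \o g).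
Proof. by move=> fg; apply: eq_integrable => // x xD /=; rewrite fg. Qed.

Lemma memL2D f g : memL2 mu D f -> memL2 mu D g -> memL2 mu D (fun x => f x + g x).
Proof.
move=> /memL2P[mf fi] /memL2P[mg gi]; apply/memL2P; split; first exact: measurable_funD.
apply: (@integrable_le_real _ (fun x => 2 * (f x ^+ 2 + g x ^+ 2))).
- by apply: measurable_funX; exact: measurable_funD.
- move=> x _; rewrite ger0_norm ?sqr_ge0//.
  by have := sqr_ge0 (f x - g x); nra.
- by apply: integrableZ_real; exact: integrableD_real.
Qed.

Lemma memL2Z k f : memL2 mu D f -> memL2 mu D (fun x => k * f x).
Proof.
move=> /memL2P[mf fi]; apply/memL2P; split; first exact: measurable_funM.
apply: (@eq_integrable_real (fun x => k ^+ 2 * f x ^+ 2)).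
  by move=> x _; rewrite exprMn.
exact: integrableZ_real.
Qed.

Lemma memL2N f : memL2 mu D f -> memL2 mu D (fun x => - f x).
Proof. by move=> /(memL2Z (-1)); under eq_fun do rewrite mulN1r. Qed.

Lemma memL2B f g : memL2 mu D f -> memL2 mu D g -> memL2 mu D (fun x => f x - g x).
Proof. by move=> fL /memL2N; exact: memL2D. Qed.

Lemma memL2_0 : memL2 mu D (fun=> 0).
Proof.
by apply/memL2P; split=> //; under eq_fun do rewrite expr0n /=; exact: integrable0_real.
Qed.

Lemma memL2_sum (I : Type) (s : seq I) (F : I -> X -> R) :
  (forall i, memL2 mu D (F i)) -> memL2 mu D (fun x => \sum_(i <- s) F i x).
Proof.
move=> FL; elim: s => [|i s ih].
  by under eq_fun do rewrite big_nil; exact: memL2_0.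
by under eq_fun do rewrite big_cons; exact: memL2D.
Qed.

Lemma memL2_le f g : measurable_fun D f -> (forall x, D x -> `|f x| <= `|g x|) ->
  memL2 mu D g -> memL2 mu D f.
Proof.
move=> mf fg /memL2P[mg gi]; apply/memL2P; split=> //.
apply: (integrable_le_real _ _ gi); first exact: measurable_funX.
move=> x Dx; rewrite ger0_norm ?sqr_ge0// -(real_normK (num_real (f x))).
by rewrite -(real_normK (num_real (g x))) lerXn2r ?nnegrE// fg.
Qed.

Lemma memL2_bounded M f g : measurable_fun D f -> (forall x, D x -> `|f x| <= M) ->
  memL2 mu D g -> memL2 mu D (fun x => f x * g x).
Proof.
move=> mf fM gL; apply: (@memL2_le _ (fun x => M * g x)); last exact: memL2Z.
  by apply: measurable_funM => //; exact: memL2_meas.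
move=> x Dx; rewrite !normrM ler_wpM2r//.
by rewrite (le_trans (fM _ Dx))// ler_norm.
Qed.

Lemma eq_memL2 f g : {in D, f =1 g} -> memL2 mu D f -> memL2 mu D g.
Proof.
move=> fg /memL2P[mf fi]; apply/memL2P; split.
  exact: (eq_measurable_fun f).
by apply: eq_integrable_real fi => x xD; rewrite fg.
Qed.

Lemma memL2_mul f g : memL2 mu D f -> memL2 mu D g ->
  mu.-integrable D (EFin \o (fun x => f x * g x)).
Proof.
move=> /memL2P[mf fi] /memL2P[mg gi].
apply: (@integrable_le_real _ (fun x => f x ^+ 2 + g x ^+ 2)).
- exact: measurable_funM.
- move=> x _; rewrite ler_norml; apply/andP.
  have := sqr_ge0 (f x - g x); have := sqr_ge0 (f x + g x).
  have := sqr_ge0 (f x); have := sqr_ge0 (g x).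
  by split; nra.
- exact: integrableD_real.
Qed.

(* By nonnegativity of the quadratic polynomial [s |-> \int (s f + g)^2]. *)
Lemma cauchy_schwarz f g : memL2 mu D f -> memL2 mu D g ->
  `|\int[mu]_(x in D) (f x * g x)| <= normL2 mu D f * normL2 mu D g.
Proof.
move=> fL gL; rewrite -(@ler_pXn2r _ 2)// ?nnegrE ?mulr_ge0 ?normL2_ge0//.
rewrite exprMn !normL2_sqr real_normK ?num_real//.
have fgi := memL2_mul fL gL.
have [fi gi] := (memL2_sqr fL, memL2_sqr gL).
set A := Rintegral _ _ (fun x => f x ^+ 2); set B := Rintegral _ _ _.
set C := Rintegral _ _ _.
have P s : 0 <= s ^+ 2 * A + 2 * s * B + C.
  have : 0 <= \int[mu]_(x in D) ((s * f x + g x) ^+ 2).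
    by apply: Rintegral_ge0 => x _; exact: sqr_ge0.
  rewrite (@eq_Rintegral _ _ _ mu _ (fun x => (s ^+ 2 * f x ^+ 2 + 2 * s * (f x * g x)) + g x ^+ 2)); last first.
    by move=> x _; ring.
  rewrite RintegralD//; last first.
    by apply: integrableD_real; exact: integrableZ_real.
  by rewrite RintegralD ?RintegralZl//; exact: integrableZ_real.
have A0 : 0 <= A by apply: Rintegral_ge0 => x _; exact: sqr_ge0.
(* If [A] is 0 the polynomial is affine; unless [B] is 0 as well, it takes the value -1 at
   [s = -(C + 1) / (2 B)], against [P]. Otherwise its value at the minimiser [-B / A] gives the
   claim. *)
have [A_eq0|A_neq0] := eqVneq A 0.
  have [->|B0] := eqVneq B 0; first by rewrite expr0n/= A_eq0 mul0r.
  have := P (- (C + 1) / (2 * B)); rewrite A_eq0 mulr0 add0r.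
  rewrite (_ : 2 * _ * B = - (C + 1)); last by field.
  by lra.
have Agt0 : 0 < A by rewrite lt_def A_neq0.
have := P (- B / A).
rewrite (_ : _ + C = (A * C - B ^+ 2) / A); last by field.
by rewrite pmulr_lge0 ?invr_gt0// subr_ge0.
Qed.

End L2.

Section Fubini_on.
Context {d1 d2 : measure_display} {X : measurableType d1} {Y : measurableType d2}.
Context {R : realType}.
Variables (m1 : {sigma_finite_measure set X -> \bar R}).
Variables (m2 : {sigma_finite_measure set Y -> \bar R}).
Variables (D1 : set X) (D2 : set Y).
Hypotheses (mD1 : measurable D1) (mD2 : measurable D2).
Implicit Types f : X * Y -> R.
Local Notation m12 := (m1 \x m2)%E.
Local Notation D12 := (D1 `*` D2).

Let mD12 : measurable D12. Proof. exact: measurableX. Qed.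

(** Extension by zero is compatible with sections: this carries the theorems of Tonelli and Fubini
    from the whole product to [D1] times [D2]. *)
Lemma patch_setX1 f x : (fun y => (f \_ D12) (x, y)) =
  (if x \in D1 then (fun y => f (x, y)) \_ D2 else cst 0).
Proof.
apply/funext => y; rewrite patchE in_setX /=.
by case: (x \in D1) => //=; rewrite patchE.
Qed.

Lemma patch_setX2 f y : (fun x => (f \_ D12) (x, y)) =
  (if y \in D2 then (fun x => f (x, y)) \_ D1 else cst 0).
Proof.
apply/funext => x; rewrite patchE in_setX /= andbC.
by case: (y \in D2) => //=; rewrite patchE.
Qed.

Lemma measurable_section1 f x : measurable_fun D12 f -> D1 x ->
  measurable_fun D2 (fun y => f (x, y)).
Proof.
move=> /(measurable_restrictT f mD12).1 mf D1x; apply/(measurable_restrictT _ mD2).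
have := measurableT_comp mf (measurable_pair1 x).
by rewrite /comp patch_setX1 mem_set.
Qed.

Lemma measurable_section2 f y : measurable_fun D12 f -> D2 y ->
  measurable_fun D1 (fun x => f (x, y)).
Proof.
move=> /(measurable_restrictT f mD12).1 mf D2y; apply/(measurable_restrictT _ mD1).
have := measurableT_comp mf (measurable_pair2 y).
by rewrite /comp patch_setX2 mem_set.
Qed.

Let iterE1 f x : (\int[m2]_y ((f \_ D12) (x, y))%:E =
  ((fun x => \int[m2]_(y in D2) (f (x, y))%:E) \_ D1) x)%E.
Proof.
rewrite [RHS]patchE; case: ifPn => xD1.
  rewrite [RHS]integral_mkcond; apply: eq_integral => y _.
  by rewrite !patchE in_setX /= xD1 /=; case: ifP.
by rewrite integral0_eq// => y _; rewrite patchE in_setX /= (negbTE xD1).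
Qed.

Let iterE2 f y : (\int[m1]_x ((f \_ D12) (x, y))%:E =
  ((fun y => \int[m1]_(x in D1) (f (x, y))%:E) \_ D2) y)%E.
Proof.
rewrite [RHS]patchE; case: ifPn => yD2.
  rewrite [RHS]integral_mkcond; apply: eq_integral => x _.
  by rewrite !patchE in_setX /= yD2 andbT /=; case: ifP.
by rewrite integral0_eq// => x _; rewrite patchE in_setX /= (negbTE yD2) andbF.
Qed.

Let int12E f : (\int[m12]_(p in D12) (f p)%:E = \int[m12]_p ((f \_ D12) p)%:E)%E.
Proof.
rewrite integral_mkcond; apply: eq_integral => p _.
by rewrite !patchE; case: ifP.
Qed.

Section nonneg.
Variable f : X * Y -> R.
Hypotheses (mf : measurable_fun D12 f) (f0 : forall p, D12 p -> 0 <= f p).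

Let mfD : measurable_fun setT (fun p => ((f \_ D12) p)%:E).
Proof. by apply/measurable_EFinP; exact: (measurable_restrictT f mD12).1. Qed.

Let fD0 p : (0 <= ((f \_ D12) p)%:E)%E.
Proof. by rewrite lee_fin patchE; case: ifPn => // /set_mem; exact: f0. Qed.

Lemma measurable_tonelli1 : measurable_fun D1 (fun x => \int[m2]_(y in D2) (f (x, y))%:E)%E.
Proof.
apply/(measurable_restrictT _ mD1).
have := @measurable_fun_fubini_tonelli_F _ _ _ _ _ m2 _ mfD fD0.
by apply: eq_measurable_fun => x _; rewrite /fubini_F iterE1.
Qed.

Lemma measurable_tonelli2 : measurable_fun D2 (fun y => \int[m1]_(x in D1) (f (x, y))%:E)%E.
Proof.
apply/(measurable_restrictT _ mD2).
have := @measurable_fun_fubini_tonelli_G _ _ _ _ _ m1 _ mfD fD0.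
by apply: eq_measurable_fun => y _; rewrite /fubini_G iterE2.
Qed.

Lemma tonelli1 : (\int[m12]_(p in D12) (f p)%:E =
  \int[m1]_(x in D1) \int[m2]_(y in D2) (f (x, y))%:E)%E.
Proof.
rewrite int12E (@fubini_tonelli1 _ _ _ _ _ m1 m2 _ mfD fD0) [RHS]integral_mkcond.
by apply: eq_integral => x _; exact: iterE1.
Qed.

Lemma tonelli2 : (\int[m12]_(p in D12) (f p)%:E =
  \int[m2]_(y in D2) \int[m1]_(x in D1) (f (x, y))%:E)%E.
Proof.
rewrite int12E (@fubini_tonelli2 _ _ _ _ _ m1 m2 _ mfD fD0) [RHS]integral_mkcond.
by apply: eq_integral => y _; exact: iterE2.
Qed.

End nonneg.

Section integrable.
Variable f : X * Y -> R.
Hypothesis fi : m12.-integrable D12 (EFin \o f).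

Let fDi : m12.-integrable setT (EFin \o (f \_ D12)).
Proof.
have := (integrable_mkcond _ mD12).1 fi; apply: eq_integrable => // p _.
by rewrite /= !patchE; case: ifP.
Qed.

Lemma ae_integrable_section1 :
  {ae m1, forall x, D1 x -> m2.-integrable D2 (fun y => (f (x, y))%:E)}.
Proof.
apply: filterS (ae_integrable1 fDi) => x + D1x.
rewrite (_ : (fun y => _) = (fun y => (f (x, y))%:E) \_ D2).
  by move=> ?; exact/(integrable_mkcond _ mD2).
apply/funext => y /=; have /(congr1 (fun h => h y)) /= -> := patch_setX1 f x.
by rewrite mem_set// !patchE; case: ifP.
Qed.

Lemma ae_integrable_section2 :
  {ae m2, forall y, D2 y -> m1.-integrable D1 (fun x => (f (x, y))%:E)}.
Proof.
apply: filterS (ae_integrable2 fDi) => y + D2y.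
rewrite (_ : (fun x => _) = (fun x => (f (x, y))%:E) \_ D1).
  by move=> ?; exact/(integrable_mkcond _ mD1).
apply/funext => x /=; have /(congr1 (fun h => h x)) /= -> := patch_setX2 f y.
by rewrite mem_set// !patchE; case: ifP.
Qed.

Let i1 : m1.-integrable D1 (fun x => \int[m2]_(y in D2) (f (x, y))%:E)%E.
Proof.
apply/(integrable_mkcond _ mD1); have := integrable_fubini_F fDi.
by apply: eq_integrable => // x _; exact: iterE1.
Qed.

Let i2 : m2.-integrable D2 (fun y => \int[m1]_(x in D1) (f (x, y))%:E)%E.
Proof.
apply/(integrable_mkcond _ mD2).
have mf := measurable_int _ fDi.
have mfn : measurable_fun setT (fun p => `|(EFin \o (f \_ D12)) p|%E).
  exact: measurableT_comp.
have : m2.-integrable setT (fubini_G m1 (EFin \o (f \_ D12))).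
  apply/integrableP; split; first exact: (measurable_fubini_G fDi).
  apply: le_lt_trans ((integrable21ltyP m1 m2 mf).1 fDi).
  apply: ge0_le_integral => //.
  - by apply: measurableT_comp => //; exact: (measurable_fubini_G fDi).
  - exact: (@measurable_fun_fubini_tonelli_G _ _ _ _ _ m1 _ mfn).
  - move=> y _; apply: le_abse_integral => //.
    exact: measurableT_comp mf (measurable_pair2 y).
by apply: eq_integrable => // y _; exact: iterE2.
Qed.

(** The inner integral may be infinite for some [x]. There [Rintegral] is 0, so it is dominated
    everywhere by the extended-real inner integral, which is integrable by Fubini's theorem. *)
Lemma integrable_Rintegral1 :
  m1.-integrable D1 (EFin \o (fun x => \int[m2]_(y in D2) f (x, y))).
Proof.
have mi : measurable_fun D1 (EFin \o (fun x => \int[m2]_(y in D2) f (x, y))).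
  apply/measurable_EFinP.
  by apply: measurableT_comp => //; exact: measurable_int i1.
apply: (le_integrable mD1 mi _ i1) => x _ /=; rewrite /Rintegral.
by case: (integral _ _ _) => [r| |]//=; rewrite ?normr0 ?leey.
Qed.

Lemma integrable_Rintegral2 :
  m2.-integrable D2 (EFin \o (fun y => \int[m1]_(x in D1) f (x, y))).
Proof.
have mi : measurable_fun D2 (EFin \o (fun y => \int[m1]_(x in D1) f (x, y))).
  apply/measurable_EFinP.
  by apply: measurableT_comp => //; exact: measurable_int i2.
apply: (le_integrable mD2 mi _ i2) => x _ /=; rewrite /Rintegral.
by case: (integral _ _ _) => [r| |]//=; rewrite ?normr0 ?leey.
Qed.

Lemma Rintegral_fubini1 :
  \int[m12]_(p in D12) f p = \int[m1]_(x in D1) \int[m2]_(y in D2) f (x, y).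
Proof.
rewrite /Rintegral; congr fine; rewrite int12E -(integral12_prod_meas1 fDi).
transitivity (\int[m1]_(x in D1) \int[m2]_(y in D2) (f (x, y))%:E)%E.
  by rewrite [RHS]integral_mkcond; apply: eq_integral => x _; exact: iterE1.
apply: ae_eq_integral => //; first exact: measurable_int i1.
  exact: measurable_int integrable_Rintegral1.
apply: filterS ae_integrable_section1 => x + D1x => /(_ D1x) xi.
by rewrite fineK//; exact: integrable_fin_num.
Qed.

Lemma Rintegral_fubini2 :
  \int[m12]_(p in D12) f p = \int[m2]_(y in D2) \int[m1]_(x in D1) f (x, y).
Proof.
rewrite /Rintegral; congr fine; rewrite int12E -(integral21_prod_meas1 fDi).
transitivity (\int[m2]_(y in D2) \int[m1]_(x in D1) (f (x, y))%:E)%E.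
  by rewrite [RHS]integral_mkcond; apply: eq_integral => x _; exact: iterE2.
apply: ae_eq_integral => //; first exact: measurable_int i2.
  exact: measurable_int integrable_Rintegral2.
apply: filterS ae_integrable_section2 => x + D1x => /(_ D1x) xi.
by rewrite fineK//; exact: integrable_fin_num.
Qed.

End integrable.

(** The measure of a null set of the product is the integral of the measures of its sections, so
    almost all sections are null. Equations holding almost everywhere on the cylinder are read in
    this way at fixed [x]. *)
Lemma ae_section1 (P : X * Y -> Prop) : {ae m12, forall p, P p} ->
  {ae m1, forall x, {ae m2, forall y, P (x, y)}}.
Proof.
move=> [N [mN N0 PN]].
have : {ae m1, forall x, m2 (xsection N x) = 0%E}.
  have mx : measurable_fun setT (fun x => m2 (xsection N x)).
    exact: measurable_fun_xsection.
  have I0 : (\int[m1]_x `|m2 (xsection N x)| = 0)%E.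
    rewrite -[RHS]N0 [RHS]/product_measure1; apply: eq_integral => x _.
    by rewrite gee0_abs.
  have := (ae_eq_integral_abs m1 measurableT mx).1 I0.
  by apply: filterS => x /(_ I).
apply: filterS => x xN; exists (xsection N x); split=> //.
  exact: measurable_xsection.
by move=> y /= nP; rewrite /xsection /=; apply/mem_set; exact: PN.
Qed.

Lemma ae_memL2_section1 f : memL2 m12 D12 f ->
  {ae m1, forall x, D1 x -> memL2 m2 D2 (fun y => f (x, y))}.
Proof.
move=> /(memL2P _ mD12)[mf fi].
apply: filterS (ae_integrable_section1 fi) => x xi D1x; apply/memL2P => //; split.
  exact: measurable_section1.
exact: xi.
Qed.

Lemma ae_memL2_section2 f : memL2 m12 D12 f ->
  {ae m2, forall y, D2 y -> memL2 m1 D1 (fun x => f (x, y))}.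
Proof.
move=> /(memL2P _ mD12)[mf fi].
apply: filterS (ae_integrable_section2 fi) => y yi D2y; apply/memL2P => //; split.
  exact: measurable_section2.
exact: yi.
Qed.

End Fubini_on.

(** * Smooth bumps on the line *)

Section smooth1.
Context {R : realType}.
Implicit Types (f g : R -> R) (n : nat).

Definition smooth1 f := forall n t, derivable (derive1n n f) t 1.

Lemma derive1nSr n f : derive1n n.+1 f = derive1n n (derive1 f).
Proof. by elim: n => [|n ih]; rewrite ?derive1n1 ?derive1n0// derive1nS ih -derive1nS. Qed.

(** Differentiability n + 1 times. Unlike [derive1n], the recursion takes the first derivative
    first, which suits inductions on sums, products and affine substitutions. *)
Fixpoint Dn n f : Prop := (forall t, derivable f t 1) /\
  (if n is m.+1 then Dn m (derive1 f) else True).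

Lemma DnW n f : Dn n.+1 f -> Dn n f.
Proof.
elim: n f => [f [df _]|n ih f [df Df]]; first by split.
by split; [exact: df|exact: ih].
Qed.

Lemma Dn_derivable n f : Dn n f -> forall t, derivable f t 1.
Proof. by case: n => [[]|n []]. Qed.

Lemma smooth1P f : smooth1 f <-> forall n, Dn n f.
Proof.
split=> [sf n|Df n]; last first.
  elim: n f Df => [|n ih] f Df t; first by rewrite derive1n0; exact: Dn_derivable (Df 0%N) t.
  by rewrite derive1nSr; apply: ih => k; have [_] := Df k.+1.
elim: n f sf => [|n ih] f sf; split.
- by move=> t; exact: sf 0%N t.
- by [].
- by move=> t; exact: sf 0%N t.
- by apply: ih => k t; rewrite -derive1nSr; exact: sf.
Qed.

Lemma DnD n f g : Dn n f -> Dn n g -> Dn n (fun t => f t + g t).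
Proof.
elim: n f g => [|n ih] f g Df Dg; have df := Dn_derivable Df; have dg := Dn_derivable Dg.
  by split; [move=> t; exact: derivableD|].
split; first by move=> t; exact: derivableD.
rewrite (_ : derive1 _ = fun t => derive1 f t + derive1 g t).
  by apply: ih; [case: Df|case: Dg].
by apply/funext => t; rewrite !derive1E deriveD.
Qed.

Lemma DnM n f g : Dn n f -> Dn n g -> Dn n (fun t => f t * g t).
Proof.
elim: n f g => [|n ih] f g Df Dg.
  by split; [move=> t; apply: derivableM; [exact: Dn_derivable Df t|exact: Dn_derivable Dg t]|].
have df := Dn_derivable Df; have dg := Dn_derivable Dg.
split; first by move=> t; exact: derivableM.
rewrite (_ : derive1 _ = fun t => f t * derive1 g t + g t * derive1 f t); last first.
  by apply/funext => t; rewrite !derive1E deriveM.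
by apply: DnD; apply: ih; [exact: DnW|case: Dg|exact: DnW|case: Df].
Qed.

Lemma Dn_cst n (c : R) : Dn n (fun=> c).
Proof.
elim: n c => [|n ih] c; split=> [t|]; try exact: derivable_cst; first by [].
rewrite (_ : derive1 _ = fun=> 0); first exact: ih.
by apply/funext => t; rewrite derive1_cst.
Qed.

Lemma is_derive_affine (a b t : R) : is_derive t 1 (fun s => a * s + b) a.
Proof.
have h := is_deriveZ a (is_derive_id t (1 : R)).
have := is_deriveD h (is_derive_cst b t (1 : R)).
by move=> {}h; apply: is_derive_eq h _; rewrite addr0 /GRing.scale /= mulr1.
Qed.

Lemma Dn_affine n f a b : Dn n f -> Dn n (fun t => f (a * t + b)).
Proof.
elim: n f => [|n ih] f Df.
  split=> // t; apply/derivable1_diffP; apply: differentiable_comp; last first.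
    by apply/derivable1_diffP; exact: Dn_derivable Df _.
  by apply/derivable1_diffP; have [] := is_derive_affine a b t.
have H (t : R) : is_derive t 1 (fun t => f (a * t + b)) (derive1 f (a * t + b) * a).
  have h1 : is_derive (a * t + b) 1 f (derive1 f (a * t + b)).
    by rewrite derive1E; apply/derivableP; exact: Dn_derivable Df _.
  have h2 := is_derive_affine a b t; have h3 := @is_derive1_comp _ f (fun s => a * s + b) _ _ _ h1 h2.
  exact: h3.
split; first by move=> t; have [] := H t.
rewrite (_ : derive1 _ = fun t => derive1 f (a * t + b) * a).
  by apply: DnM; [apply: ih; case: Df|exact: Dn_cst].
by apply/funext => t; rewrite derive1E; have [] := H t.
Qed.

End smooth1.

Section exp_bump.
Context {R : realType}.
Implicit Types (p : {poly R}) (t : R).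

Lemma exprn_le_expR n (y : R) : 0 <= y -> y ^+ n <= n`!%:R * expR y.
Proof.
case: n => [|n] y0; first by rewrite expr0 mul1r (le_trans _ (expR_ge1Dx y))// lerDl.
have := expR_ge1Dxn n y0; have f0 : 0 < (n.+1)`!%:R :> R by rewrite ltr0n fact_gt0.
move=> h; rewrite mulrC -ler_pdivrMr//; apply: le_trans h; by rewrite lerDr.
Qed.

Lemma horner_le_expR p : exists2 C, 0 <= C & forall y : R, 0 <= y -> `|p.[y]| <= C * expR y.
Proof.
exists (\sum_(i < size p) `|p`_i| * i`!%:R); first by apply: sumr_ge0 => i _; rewrite mulr_ge0.
move=> y y0; rewrite horner_coef; apply: le_trans (ler_norm_sum _ _ _) _.
rewrite mulr_suml; apply: ler_sum => i _; rewrite normrM -mulrA ler_wpM2l//.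
by rewrite ger0_norm ?exprn_ge0//; exact: exprn_le_expR.
Qed.

(** The functions [p(1/t) exp(-1/t)], extended by 0 to [t <= 0], form a family stable under
    differentiation; [p = 1] is the classical smooth function that is flat at 0. *)
Definition Ebump p t : R := if 0 < t then p.[t^-1] * expR (- t^-1) else 0.

(** From [d/dt (p(1/t) exp(-1/t)) = t^-2 (p - p')(1/t) exp(-1/t)]. *)
Definition Eder p : {poly R} := 'X^2 * (p - p^`()).

(** The exponential beats [p] times the square of the variable. The factor [t ^+ 2] makes the
    difference quotients at 0 tend to 0, which settles the derivative at the junction. *)
Lemma Ebump_le p : exists2 C, 0 <= C & forall t, `|Ebump p t| <= C * t ^+ 2.
Proof.
have [C C0 HC] := horner_le_expR (p * 'X^2).
exists C => // t; rewrite /Ebump; case: ifPn => [t0|_]; last by rewrite normr0 mulr_ge0 ?sqr_ge0.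
have ti0 : 0 <= t^-1 by rewrite invr_ge0 ltW.
have := HC _ ti0; rewrite hornerM hornerXn normrM [`|t^-1 ^+ 2|]ger0_norm ?exprn_ge0//.
move=> h; rewrite normrM (ger0_norm (expR_ge0 _)) expRN ler_pdivrMr ?expR_gt0//.
rewrite mulrAC -ler_pdivrMr ?exprn_gt0// -exprVn; exact: h.
Qed.

Lemma is_derive_Ebump p t : is_derive t 1 (Ebump p) (Ebump (Eder p) t).
Proof.
case: (ltgtP 0 t) => [t0|t0|<-].
- rewrite {2}/Ebump t0.
  have nE : \near t, (fun s : R => p.[s^-1] * expR (- s^-1)) t = Ebump p t.
    near=> s; rewrite /Ebump ifT//; near: s; exact: lt_nbhsr.
  apply: near_eq_is_derive nE _.
  have t_neq0 : t != 0 by rewrite gt_eqF.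
  have h0 : is_derive t 1 (fun s : R => s^-1) (- t ^- 2).
    by apply: is_derive_eq (is_deriveV t_neq0 (is_derive_id t 1)) _; rewrite scaler1.
  have h1 := is_derive1_comp (is_derive_poly p t^-1) h0.
  have h2 : is_derive t 1 (fun s : R => - s^-1) (t ^- 2).
    by apply: is_derive_eq (is_deriveN h0) _; rewrite opprK.
  have h3 := @is_derive1_comp _ _ (fun s : R => - s^-1) _ _ _ (is_derive_expR (- t^-1)) h2.
  apply: is_derive_eq (is_deriveM h1 h3) _; rewrite /GRing.scale /= /Eder hornerM hornerD hornerN hornerXn.
  by rewrite exprVn; ring.
- rewrite {2}/Ebump ltNge (ltW t0)/=.
  have nE : \near t, (cst 0 : R -> R) t = Ebump p t.
    near=> s; rewrite /Ebump ifF//; apply/negbTE; rewrite -leNgt ltW//; near: s; exact: lt_nbhsl.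
  apply: near_eq_is_derive nE _; exact: is_derive_cst.
- rewrite {2}/Ebump ltxx; have [C C0 HC] := Ebump_le p.
  have cv : h^-1 *: ((Ebump p \o shift 0) (h *: (1:R)) - Ebump p 0) @[h --> 0^'] --> (0 : R).
    apply/cvgrPdist_le => e e0; near=> h.
    rewrite sub0r normrN /= addr0 /GRing.scale /= mulr1 {2}/Ebump ltxx subr0 normrM normfV.
    have h0 : h != 0 by near: h; exact: nbhs_dnbhs_neq.
    rewrite mulrC ler_pdivrMr ?normr_gt0//; apply: le_trans (HC h) _.
    rewrite -real_normK ?num_real// expr2 mulrA ler_wpM2r//.
    have : `|h| <= e / (C + 1).
      by near: h; apply: dnbhs0_le; rewrite divr_gt0// ltr_pwDr.
    rewrite ler_pdivlMr ?ltr_pwDr// => hh; apply: le_trans hh.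
    by rewrite mulrC ler_wpM2l// lerDl.
  by split; [apply/cvg_ex; exists 0; exact: cv|apply/cvg_lim => //; exact: cv].
Unshelve. all: by end_near. Qed.

Lemma Dn_Ebump n p : Dn n (Ebump p).
Proof.
have d t q : derivable (Ebump q) t 1 by have [] := is_derive_Ebump q t.
elim: n p => [|n ih] p; split=> //.
rewrite (_ : derive1 _ = Ebump (Eder p)); first exact: ih.
by apply/funext => t; rewrite derive1E; have [] := is_derive_Ebump p t.
Qed.

End exp_bump.

Lemma Rintegral_eq0_outside d (X : measurableType d) (R : realType)
    (mu : {measure set X -> \bar R}) (D D' : set X) (f : X -> R) :
  D `<=` D' -> (forall x, D' x -> ~ D x -> f x = 0) ->
  \int[mu]_(x in D') f x = \int[mu]_(x in D) f x.
Proof.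
move=> DD f0; rewrite [LHS]Rintegral_mkcond [RHS]Rintegral_mkcond.
apply: eq_Rintegral => x _; rewrite !patchE.
case: ifPn => [/set_mem D'x|D'x]; case: ifPn => // Dx.
  by rewrite f0//; move=> /mem_set; exact/negP.
by move/negP : D'x => []; apply/mem_set/DD/set_mem.
Qed.

Section window.
Context {R : realType}.
Local Notation lebt := (@lebesgue_measure R).
Implicit Types (T b t : R) (n : nat).

Let e1 n (s : R) : R := Ebump 1 (n%:R * s + (-1)).

Let e1_ge0 n s : 0 <= e1 n s.
Proof. by rewrite /e1 /Ebump; case: ifP => // _; rewrite hornerC mul1r expR_ge0. Qed.

Let e1_le1 n s : e1 n s <= 1.
Proof.
rewrite /e1 /Ebump; case: ifP => // s0.
by rewrite hornerC mul1r -[leRHS]expR0 ler_expR oppr_le0 invr_ge0 ltW.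
Qed.

Let e1_eq0 n s : n%:R * s <= 1 -> e1 n s = 0.
Proof. by move=> ns; rewrite /e1 /Ebump ltNge subr_le0 ns. Qed.

Let e1_cvg s : 0 < s -> e1 n s @[n --> \oo] --> (1 : R).
Proof.
move=> s0; apply/cvgrPdist_le => e e_gt0; near=> n.
(* Once [n s - 1 >= 1/e], the inequality [1 - exp(-x) <= x] at [x = 1/(n s - 1)] leaves at most
   [e]. *)
have ns : (1 + e^-1) <= n%:R * s.
  rewrite -ler_pdivrMr//; near: n; exact: nbhs_infty_ger.
have ns1 : e^-1 <= n%:R * s - 1 by rewrite lerBrDl.
have ei : 0 < e^-1 by rewrite invr_gt0.
have ns0 : 0 < n%:R * s - 1 by rewrite (lt_le_trans ei).
rewrite ger0_norm ?subr_ge0//.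
rewrite /e1 /Ebump ns0 hornerC mul1r lerBlDl -lerBlDr.
apply: le_trans (expR_ge1Dx _); rewrite lerD2l lerN2.
by rewrite -[e]invrK lef_pV2 ?posrE.
Unshelve. all: by end_near. Qed.

(** A smooth replacement for the indicator of []0, b[], supported in a compact part of it and
    converging to it pointwise: integrals over []0, b[] become limits of integrals against smooth
    functions of compact support. *)
Definition window n b t : R := e1 n t * e1 n (b - t).

Lemma window_ge0 n b t : 0 <= window n b t.
Proof. by rewrite mulr_ge0. Qed.

Lemma window_le1 n b t : window n b t <= 1.
Proof. by rewrite mulr_ile1. Qed.

Lemma window_neq0 n b t : window n b t != 0 ->
  [/\ (0 < n)%N, n%:R^-1 <= t & t <= b - n%:R^-1].
Proof.
rewrite mulf_eq0 negb_or => /andP[].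
have [nt|nt _] := leP (n%:R * t) 1; first by rewrite e1_eq0 ?eqxx.
have [nbt|nbt _] := leP (n%:R * (b - t)) 1; first by rewrite e1_eq0 ?eqxx.
have n0 : (0 < n)%N.
  by rewrite lt0n; apply/eqP => n0; move: nt; rewrite n0 mul0r ltr10.
have n0' : 0 < n%:R :> R by rewrite ltr0n.
split=> //; first by rewrite -div1r ler_pdivrMr// mulrC ltW.
by rewrite lerBrDr -lerBrDl -div1r ler_pdivrMr// mulrC ltW.
Qed.

Lemma Dn_window m n b : Dn m (window n b).
Proof.
apply: DnM; first exact: Dn_affine (Dn_Ebump _ _).
rewrite (_ : (fun t => _) = fun t => Ebump 1 (- n%:R * t + (n%:R * b - 1))).
  exact: Dn_affine (Dn_Ebump _ _).
by apply/funext => t; rewrite /e1; congr Ebump; ring.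
Qed.

Lemma continuous_Dn n (f : R -> R) : Dn n f -> continuous f.
Proof.
move=> /Dn_derivable df t; apply: differentiable_continuous.
exact/derivable1_diffP.
Qed.

Lemma window_cvg b t : window n b t @[n --> \oo] --> (\1_`]0, b[ t : R).
Proof.
rewrite indicE; have [tb|tb] := boolP (t \in `]0, b[%classic).
  move: tb; rewrite inE /= in_itv /= => /andP[t0 tb].
  by rewrite -[1%:R]mulr1; apply: cvgM; apply: e1_cvg; rewrite ?subr_gt0.
apply: cvg_near_cst; near=> n; apply/eqP; apply: contraNT tb => /window_neq0[n0 tn bn].
have n0' : 0 < n%:R^-1 :> R by rewrite invr_gt0 ltr0n.
rewrite inE /= in_itv /= (lt_le_trans n0' tn)/=.
by rewrite (le_lt_trans bn)// ltrBlDr ltrDl.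
Unshelve. all: by end_near. Qed.

Lemma Rintegral_window_cvg T b (y : R -> R) : b <= T ->
  lebt.-integrable `]0, T[ (EFin \o y) ->
  \int[lebt]_(t in `]0, T[) (window n b t * y t) @[n --> \oo] -->
  \int[lebt]_(t in `]0, b[) y t.
Proof.
move=> bT yi.
have my : measurable_fun `]0, T[ y by exact: integrable_real_meas yi.
have mw n : measurable_fun `]0, T[ (window n b).
  apply: measurable_funS (measurableT) _ _ => //.
  exact: continuous_measurable_fun (continuous_Dn (Dn_window 0 n b)).
have [] := @dominated_convergence _ _ _ lebt `]0, T[%classic (measurable_itv _)
  (fun n t => (window n b t * y t)%:E) (fun t => (\1_`]0, b[ t * y t)%:E)
  (fun t => `|y t|%:E).
- by move=> n; apply/measurable_EFinP; exact: (measurable_funM (mw n) my).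
- have m1 : measurable_fun `]0, T[ (\1_`]0, b[ : R -> R) by exact: measurable_indic.
  by apply/measurable_EFinP; exact: (measurable_funM m1 my).
- apply: aeW => t _; apply: cvg_EFin; first by near=> n.
  by apply: cvgM; [exact: window_cvg|exact: cvg_cst].
- exact: (integrable_norm yi).
- apply: aeW => t n _ /=; rewrite lee_fin normrM ler_piMl// ger0_norm ?window_ge0//.
  exact: window_le1.
move=> fi _ cv.
have E : \int[lebt]_(t in `]0, b[) y t = \int[lebt]_(t in `]0, T[) (\1_`]0, b[ t * y t).
  rewrite [RHS](@Rintegral_eq0_outside _ _ _ lebt `]0, b[%classic).
  - by apply: eq_Rintegral => t tb; rewrite indicE tb mul1r.
  - by apply: subset_itvl; rewrite bnd_simp.
  - by move=> t _ tb; rewrite indicE memNset// mul0r.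
rewrite E /Rintegral; apply: fine_cvg; rewrite fineK//.
exact: integrable_fin_num.
Unshelve. all: by end_near. Qed.

End window.

(** * Integrals over the triangle s < t *)

Section junk.
Context d (X : measurableType d) (R : realType).
Variable mu : {measure set X -> \bar R}.
Variables (D : set X) (mD : measurable D).
Implicit Type f : X -> R.

(** The integral is the difference of those of the positive and negative parts, and if either of
    them is infinite so is the difference. *)
Lemma integrable_fin_integral f : measurable_fun D f ->
  (\int[mu]_(x in D) (f x)%:E)%E \is a fin_num -> mu.-integrable D (EFin \o f).
Proof.
move=> mf; have mEf : measurable_fun D (EFin \o f) by exact/measurable_EFinP.
rewrite integralE fin_numB => /andP[fp fn]; apply/integrableP; split=> //.
rewrite (_ : (fun x => `|(EFin \o f) x|%E) = (EFin \o f)^\+ \+ (EFin \o f)^\-)%E; last first.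
  by rewrite -fune_abse.
rewrite ge0_integralD//; [|exact: measurable_funepos|exact: measurable_funeneg].
by rewrite lte_add_pinfty// ltey_eq ?fp ?fn.
Qed.

(* Real-valued integrals take the junk value 0 on non-integrable functions,
   so homogeneity needs no integrability. *)
Lemma RintegralZl_measurable f (k : R) : measurable_fun D f ->
  \int[mu]_(x in D) (k * f x) = k * \int[mu]_(x in D) f x.
Proof.
move=> mf; have [fi|fi] := pselect (mu.-integrable D (EFin \o f)); first exact: RintegralZl.
have [->|k0] := eqVneq k 0.
  by under eq_Rintegral do rewrite mul0r; rewrite Rintegral_cst// !mul0r.
have junk g : measurable_fun D g -> ~ mu.-integrable D (EFin \o g) -> \int[mu]_(x in D) g x = 0.
  move=> mg ng; rewrite /Rintegral; have : ~ (\int[mu]_(x in D) (g x)%:E)%E \is a fin_num.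
    by move=> /(integrable_fin_integral mg).
  by case: (integral _ _ _).
rewrite !junk ?mulr0//; first exact: measurable_funM.
move=> kfi; apply: fi; have := integrableZ_real mD k^-1 kfi.
by apply: (eq_integrable_real mD) => x _ /=; rewrite mulKf.
Qed.

Lemma ae_eq_Rintegral f g : measurable_fun D f -> measurable_fun D g ->
  {ae mu, forall x, D x -> f x = g x} ->
  \int[mu]_(x in D) f x = \int[mu]_(x in D) g x.
Proof.
move=> mf mg fg; rewrite /Rintegral; congr fine; apply: ae_eq_integral => //.
- exact/measurable_EFinP.
- exact/measurable_EFinP.
- by apply: filterS fg => x + Dx => /(_ Dx) /= ->.
Qed.

Lemma ae_integrable_real f g : measurable_fun D g ->
  {ae mu, forall x, D x -> f x = g x} -> mu.-integrable D (EFin \o f) ->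
  mu.-integrable D (EFin \o g).
Proof.
move=> mg fg fi; apply/integrableP; split; first exact/measurable_EFinP.
move/integrableP : (fi) => [mf]; apply: le_lt_trans; rewrite le_eqVlt; apply/orP; left.
apply/eqP; apply: ae_eq_integral => //; try exact: measurableT_comp.
- by apply: measurableT_comp => //; exact/measurable_EFinP.
- by apply: filterS fg => x + Dx => /(_ Dx) /= ->.
Qed.

Lemma ae_memL2 f g : measurable_fun D g ->
  {ae mu, forall x, D x -> f x = g x} -> memL2 mu D f -> memL2 mu D g.
Proof.
move=> mg fg /(memL2P _ mD)[mf fi]; apply/memL2P => //; split=> //.
apply: ae_integrable_real fi; first exact: measurable_funX.
by apply: filterS fg => x + Dx => /(_ Dx) /= ->.
Qed.

End junk.

Lemma ae_mono d (X : sigmaRingType d) (R : realType) (mu : {measure set X -> \bar R}) (P Q : X -> Prop) :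
  (forall x, P x -> Q x) -> {ae mu, forall x, P x} -> {ae mu, forall x, Q x}.
Proof. by move=> PQ; exact: filterS. Qed.

Section triangle.
Context {R : realType}.
Local Notation lebt := (@lebesgue_measure R).
Variables (T : R) (k : R -> R).
Hypothesis mk : measurable_fun setT k.
Local Notation I := (`]0, T[%classic : set R).
Implicit Types g h : R -> R.

(** Here [p] is the pair [(t, s)]. Cutting the integrand down to [0 < s < t] by an indicator lets
    Fubini's theorem be applied on a square. *)
Definition tri_kernel g h (p : R * R) : R := \1_(`]0, p.1[) p.2 * (k (p.1 - p.2) * (g p.1 * h p.2)).

Let mI : @measurable _ (measurableTypeR R) I. Proof. exact: measurable_itv. Qed.

Lemma measurable_lt_pair : measurable_fun setT (fun p : R * R => \1_(`]0, p.1[) p.2 : R).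
Proof.
rewrite (_ : (fun p => _) = \1_[set p : R * R | 0 < p.2 /\ p.2 < p.1]); last first.
  apply/funext => p; rewrite !indicE; congr (_%:R); congr nat_of_bool.
  by apply/idP/idP; rewrite !inE /= in_itv /=; [move=> /andP[]|move=> [-> ->]].
apply: measurable_indic.
have lt_meas (f g : R * R -> R) : measurable_fun setT f -> measurable_fun setT g ->
    measurable [set p | f p < g p].
  move=> mf mg; have mt : measurable [set true] by [].
  by have := measurable_fun_ltr mf mg measurableT mt; rewrite setTI.
by apply: measurableI; apply: lt_meas.
Qed.

Lemma measurable_tri_kernel g h : measurable_fun I g -> measurable_fun I h ->
  measurable_fun (I `*` I) (tri_kernel g h).
Proof.
move=> mg mh; apply: measurable_funM.
  by apply: measurable_funS measurable_lt_pair.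
apply: measurable_funM.
  have : measurable_fun setT (fun p : R * R => k (p.1 - p.2)).
    by apply: measurableT_comp mk _; apply: measurable_funB; [exact: measurable_fst|exact: measurable_snd].
  exact: measurable_funS.
apply: measurable_funM.
- apply: (measurable_comp (F := I)) mg _ => //; first by move=> _ [p [] ? ? <-].
  by apply: measurable_funS measurable_fst.
- apply: (measurable_comp (F := I)) mh _ => //; first by move=> _ [p [] ? ? <-].
  by apply: measurable_funS measurable_snd.
Qed.

(** Every [t] is allowed, even one at which the inner integral diverges, because the totalised
    integral is homogeneous on all measurable functions. *)
Lemma Rintegral_tri_fst g h t : measurable_fun I h -> I t ->
  \int[lebt]_(s in I) tri_kernel g h (t, s) = g t * \int[lebt]_(s in `]0, t[) (k (t - s) * h s).
Proof.
move=> mh It; have tT : `]0, t[ `<=` I.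
  by apply: subset_itvl; rewrite bnd_simp; move: It; rewrite /= in_itv /= => /andP[_ /ltW].
rewrite (@Rintegral_eq0_outside _ _ _ lebt `]0, t[%classic)//; last first.
  by move=> s _ st; rewrite /tri_kernel indicE memNset//= mul0r.
rewrite -RintegralZl_measurable//.
  apply: eq_Rintegral => s st; rewrite /tri_kernel indicE st mul1r /=; ring.
apply: measurable_funM; last exact: measurable_funS mh.
apply: (@measurable_funS _ _ _ _ setT) => //.
by apply: measurableT_comp mk _; exact: measurable_funB.
Qed.

Lemma Rintegral_tri_snd g h s : measurable_fun I g -> I s ->
  \int[lebt]_(t in I) tri_kernel g h (t, s) = h s * \int[lebt]_(t in `]s, T[) (k (t - s) * g t).
Proof.
move=> mg Is; have s0 : 0 < s by move: Is; rewrite /= in_itv /= => /andP[].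
have sT : `]s, T[ `<=` I by apply: subset_itvr; rewrite bnd_simp ltW.
rewrite (@Rintegral_eq0_outside _ _ _ lebt `]s, T[%classic)//; last first.
  move=> t It st; rewrite /tri_kernel indicE memNset ?mul0r//= in_itv /= s0 /= => st'.
  by apply: st; rewrite /= in_itv /= st'; move: It; rewrite /= in_itv /= => /andP[_].
rewrite -RintegralZl_measurable//.
  apply: eq_Rintegral => t; rewrite inE /= in_itv /= => /andP[st tT].
  by rewrite /tri_kernel indicE mem_set /= ?in_itv /= ?s0// mul1r; ring.
apply: measurable_funM; last exact: measurable_funS mg.
apply: (@measurable_funS _ _ _ _ setT) => //.
by apply: measurableT_comp mk _; exact: measurable_funB.
Qed.

(** Dirichlet's exchange of the order of integration. The kernel 1 turns it into integration by
    parts, the power kernel into the transposition of the fractional integral. *)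
Lemma Rintegral_triangle g h : measurable_fun I g -> measurable_fun I h ->
  (lebt \x lebt)%E.-integrable (I `*` I) (EFin \o tri_kernel g h) ->
  \int[lebt]_(t in I) (g t * \int[lebt]_(s in `]0, t[) (k (t - s) * h s)) =
  \int[lebt]_(s in I) (h s * \int[lebt]_(t in `]s, T[) (k (t - s) * g t)).
Proof.
move=> mg mh Mi; transitivity (\int[lebt]_(t in I) \int[lebt]_(s in I) tri_kernel g h (t, s)).
  by apply: eq_Rintegral => t; rewrite inE => It; rewrite Rintegral_tri_fst.
rewrite -(Rintegral_fubini1 mI mI Mi) (Rintegral_fubini2 mI mI Mi).
by apply: eq_Rintegral => s; rewrite inE => Is; rewrite Rintegral_tri_snd.
Qed.

Lemma integrable_tri_fst g h : measurable_fun I h ->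
  (lebt \x lebt)%E.-integrable (I `*` I) (EFin \o tri_kernel g h) ->
  lebt.-integrable I (EFin \o (fun t => g t * \int[lebt]_(s in `]0, t[) (k (t - s) * h s))).
Proof.
move=> mh Mi; have := integrable_Rintegral1 mI mI Mi.
by apply: eq_integrable_real => // t; rewrite inE => It; rewrite Rintegral_tri_fst.
Qed.

End triangle.

Section kernel.
Context {R : realType}.
Local Notation lebt := (@lebesgue_measure R).

(** The integrand may blow up at an endpoint, so the fundamental theorem of calculus is applied on
    compact subintervals, followed by monotone convergence; the bound [K] on the increments of [F]
    replaces its limits at the endpoints. *)
Lemma integral_oo_le (f F : R -> R) (a b K : R) : a < b ->
  (forall x, a < x < b -> 0 <= f x) ->
  (forall x, a < x < b -> is_derive x 1 F (f x)) ->
  (forall x, a < x < b -> {for x, continuous f}) ->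
  (forall c d, a < c -> c < d -> d < b -> F d - F c <= K) ->
  measurable_fun `]a, b[ f ->
  (\int[lebt]_(x in `]a, b[) (f x)%:E <= K%:E)%E.
Proof.
move=> ab f0 dF cf FK mf.
(* The offset 3 makes [2 * e n] smaller than [b - a] from the first [n] on, so that no subinterval
   is degenerate. *)
pose e n : R := (b - a) / n.+3%:R.
have ba : 0 < b - a by rewrite subr_gt0.
have e0 n : 0 < e n by rewrite divr_gt0.
have e2 n : e n + e n < b - a.
  rewrite /e -mulrDl ltr_pdivrMr//.
  have : 3 <= n.+3%:R :> R by rewrite ler_nat.
  by move=> h; nra.
have e_nincr m n : (m <= n)%N -> e n <= e m.
  by move=> mn; rewrite /e ler_pM2l// lef_pV2 ?posrE// ler_nat !ltnS.
pose G n := `[a + e n, b - e n]%classic : set R.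
have GI n : G n `<=` `]a, b[%classic.
  move=> x; rewrite /G /= !in_itv /= => /andP[ax xb].
  by rewrite (lt_le_trans _ ax) ?ltrDl//= (le_lt_trans xb)// ltrBlDr ltrDl.
have UG : \bigcup_i G i = `]a, b[%classic.
  apply/seteqP; split=> [x [n _] /GI//|x]; rewrite /= in_itv /= => /andP[ax xb].
  have [n Hn] : exists n, e n <= Num.min (x - a) (b - x).
    have m0 : 0 < Num.min (x - a) (b - x) by rewrite lt_min !subr_gt0 ax xb.
    exists (Num.truncn ((b - a) / Num.min (x - a) (b - x))).
    rewrite /e ler_pdivrMr// mulrC -ler_pdivrMr//.
    apply: le_trans (ltW (Num.Theory.truncnS_gt _)) _.
    by rewrite ler_nat ltnS -addn2 leq_addr.
  exists n => //; rewrite /G /= in_itv /=.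
  move: Hn; rewrite le_min => /andP[h1 h2].
  by rewrite -lerBrDl h1/= lerBrDr addrC -lerBrDr.
have H := @ge0_nondecreasing_set_cvg_integral _ (measurableTypeR R) _ G (EFin \o f) lebt.
have : (\int[lebt]_(x in G i) (f x)%:E)%E @[i --> \oo] --> (\int[lebt]_(x in \bigcup_i G i) (f x)%:E)%E.
  apply: H.
  - move=> m n mn; apply/subsetPset => x; rewrite /G /= !in_itv /= => /andP[h1 h2].
    have := e_nincr _ _ mn; move=> h.
    by rewrite (le_trans _ h1) ?lerD2l//= (le_trans h2)// lerD2l lerN2.
  - by move=> i; exact: measurable_itv.
  - move=> i; apply/measurable_EFinP; exact: measurable_funS mf.
  - by move=> i x /GI; rewrite /= in_itv /= lee_fin; exact: f0.
rewrite UG => cv; rewrite -(cvg_lim _ cv)//.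
apply: lime_le; first by apply/cvg_ex; eexists; exact: cv.
near=> n; rewrite /G.
have cd : a + e n < b - e n by have := e2 n; lra.
have dF' x : a + e n <= x <= b - e n -> is_derive x 1 F (f x).
  move=> xx; have := GI n x; rewrite /G /= !in_itv /= => /(_ xx); exact: dF.
rewrite (continuous_FTC2 cd (F := F)).
- by rewrite -EFinB lee_fin; apply: FK => //; rewrite ?ltrDl// ltrBlDr ltrDl.
- apply/continuous_in_subspaceT => x; rewrite inE => /GI; rewrite /= in_itv /=; exact: cf.
- split.
  + move=> x; rewrite in_itv /= => /andP[h1 h2].
    by have [] := dF' x; rewrite ?(ltW h1) ?(ltW h2).
  + apply: cvg_at_right_filter; apply: differentiable_continuous.
    by apply/derivable1_diffP; have [] := dF' (a + e n); rewrite ?lexx ?(ltW cd).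
  + apply: cvg_at_left_filter; apply: differentiable_continuous.
    by apply/derivable1_diffP; have [] := dF' (b - e n); rewrite ?lexx ?(ltW cd).
- move=> x; rewrite in_itv /= => /andP[h1 h2]; rewrite derive1E.
  by have [] := dF' x; rewrite ?(ltW h1) ?(ltW h2).
Unshelve. all: by end_near. Qed.

Section power.
Variables (alpha T : R).
Hypotheses (a0 : 0 < alpha) (a1 : alpha < 1) (T0 : 0 < T).

(** The integral of [x^-alpha] over []0, T[], which bounds the rows and columns of the kernel in
    Schur's test. *)
Definition frac_const : R := T `^ (1 - alpha) / (1 - alpha).

Let a1' : 0 < 1 - alpha. Proof. by rewrite subr_gt0. Qed.

Lemma frac_const_ge0 : 0 <= frac_const.
Proof. by rewrite divr_ge0 ?powR_ge0// ltW. Qed.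

Lemma measurable_power : measurable_fun setT (fun x : R => x `^ (- alpha)).
Proof. exact: measurable_powR. Qed.

Let dpow (x : R) : 0 < x ->
  is_derive x 1 (fun x => x `^ (1 - alpha) / (1 - alpha)) (x `^ (- alpha)).
Proof.
move=> x0; have := is_derive1_powR (1 - alpha) x0; move=> h.
have := is_deriveZ (1 - alpha)^-1 h => {}h.
rewrite (_ : (fun x : R => _) = (1 - alpha)^-1 \*: (fun x => x `^ (1 - alpha))); last first.
  by apply/funext => y; rewrite /= /GRing.scale /= mulrC.
apply: is_derive_eq h _; rewrite /GRing.scale /= mulKf ?gt_eqF//.
by congr (_ `^ _); rewrite addrAC subrr add0r.
Qed.

Let cpow (x : R) : 0 < x -> {for x, continuous (fun x : R => x `^ (- alpha))}.
Proof.
move=> x0; have [d _] := is_derive1_powR (- alpha) x0.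
apply: differentiable_continuous; exact/derivable1_diffP.
Qed.

Let cpow_comp (g : R -> R) (x : R) : {for x, continuous g} -> 0 < g x ->
  {for x, continuous (fun x : R => g x `^ (- alpha))}.
Proof. by move=> cg /cpow cp; exact: (@continuous_comp R R R g (fun x => x `^ (- alpha)) x cg cp). Qed.

Let powle (x y : R) : 0 <= x -> x <= y -> x `^ (1 - alpha) / (1 - alpha) <= y `^ (1 - alpha) / (1 - alpha).
Proof.
by move=> x0 xy; rewrite ler_pM2r ?invr_gt0// ge0_ler_powR ?nnegrE ?(ltW a1')// (le_trans x0).
Qed.

(** The factor [(T - s)^(1 - alpha)] is kept because it gives the rate at which the backward
    integral decays at [T]. *)
Lemma integral_power_tail (s : R) : s < T ->
  (\int[lebt]_(t in `]s, T[) ((t - s) `^ (- alpha))%:E <=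
   ((T - s) `^ (1 - alpha) / (1 - alpha))%:E)%E.
Proof.
move=> sT.
apply: (@integral_oo_le _ (fun t => (t - s) `^ (1 - alpha) / (1 - alpha))) => //.
- by move=> x _; exact: powR_ge0.
- move=> x /andP[sx _]; have xs : 0 < x - s by rewrite subr_gt0.
  have h2 := is_deriveB (is_derive_id x (1 : R)) (is_derive_cst s x (1 : R)).
  have h1 := @is_derive1_comp _ _ (fun t : R => t - s) _ _ _ (dpow xs) h2.
  by apply: is_derive_eq h1 _; rewrite subr0 mulr1.
- move=> x /andP[sx _]; have xs : 0 < x - s by rewrite subr_gt0.
  apply: (cpow_comp (g := fun t => t - s)) => //.
  by apply: (@cvgB _ R); [exact: cvg_id|exact: cvg_cst].
- move=> c d sc cd dT; rewrite lerBlDr (@le_trans _ _ ((T - s) `^ (1 - alpha) / (1 - alpha)))//.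
    by apply: powle; lra.
  by rewrite lerDl divr_ge0 ?powR_ge0// ltW.
- apply: (@measurable_funS _ _ _ _ setT) => //.
  by apply: measurableT_comp measurable_power _; exact: measurable_funB.
Qed.

Lemma integral_power_right (s : R) : 0 <= s < T ->
  (\int[lebt]_(t in `]s, T[) ((t - s) `^ (- alpha))%:E <= frac_const%:E)%E.
Proof.
move=> /andP[s0 sT]; apply: le_trans (integral_power_tail sT) _; rewrite lee_fin.
by apply: powle; lra.
Qed.

Lemma integral_power_left (t : R) : 0 < t <= T ->
  (\int[lebt]_(s in `]0%R, t[) ((t - s) `^ (- alpha))%:E <= frac_const%:E)%E.
Proof.
move=> /andP[t0 tT].
apply: (@integral_oo_le _ (fun s => - ((t - s) `^ (1 - alpha) / (1 - alpha)))) => //.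
- by move=> x _; exact: powR_ge0.
- move=> x /andP[_ xt]; have xs : 0 < t - x by rewrite subr_gt0.
  have h2 := is_deriveB (is_derive_cst t x (1 : R)) (is_derive_id x (1 : R)).
  have h1 := @is_derive1_comp _ _ (fun s : R => t - s) _ _ _ (dpow xs) h2.
  have h3 := is_deriveN h1.
  by apply: is_derive_eq h3 _; rewrite sub0r mulrN1 opprK.
- move=> x /andP[_ xt]; have xs : 0 < t - x by rewrite subr_gt0.
  apply: (cpow_comp (g := fun s => t - s)) => //.
  by apply: (@cvgB _ R); [exact: cvg_cst|exact: cvg_id].
- move=> c d c0 cd dt; rewrite opprK addrC lerBlDr (@le_trans _ _ frac_const)//.
    by apply: powle; lra.
  by rewrite lerDl divr_ge0 ?powR_ge0// ltW.
- apply: (@measurable_funS _ _ _ _ setT) => //.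
  by apply: measurableT_comp measurable_power _; exact: measurable_funB.
Qed.

End power.
End kernel.

Section triangle_integrability.
Context {R : realType}.
Local Notation lebt := (@lebesgue_measure R).
Variables (T : R).
Local Notation I := (`]0, T[%classic : set R).
Local Notation RR := (measurableTypeR R).
Implicit Types g h : R -> R.

Let mI : @measurable _ (measurableTypeR R) I. Proof. exact: measurable_itv. Qed.

(** The indicator is at most 1, so [|g(t)| |h(s)|] dominates, and Tonelli's theorem factors its
    integral. *)
Lemma integrable_tri_cst g h : lebt.-integrable I (EFin \o g) ->
  lebt.-integrable I (EFin \o h) ->
  (lebt \x lebt)%E.-integrable (I `*` I) (EFin \o tri_kernel (cst 1) g h).
Proof.
move=> gi hi; have mg := integrable_real_meas gi; have mh := integrable_real_meas hi.
have mk : measurable_fun setT (cst 1 : R -> R) by [].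
have mt := measurable_tri_kernel mk mg mh.
have mII : @measurable _ (measurableTypeR R * measurableTypeR R)%type (I `*` I) by exact: measurableX.
pose F (p : RR * RR) := `|g p.1| * `|h p.2|.
have mF : measurable_fun (I `*` I) F.
  apply: measurable_funM; apply: measurableT_comp => //.
  - apply: (measurable_comp (F := I)) mg _ => //; first by move=> _ [p [] ? ? <-].
    by apply: measurable_funS measurable_fst.
  - apply: (measurable_comp (F := I)) mh _ => //; first by move=> _ [p [] ? ? <-].
    by apply: measurable_funS measurable_snd.
apply: (integrable_le_real mII (g := F)) => //.
  move=> [t s] _; rewrite /tri_kernel /F /= mul1r !normrM ler_piMl ?mulr_ge0//.
  by rewrite indicE; case: (_ \in _) => /=; rewrite ?normr1 ?normr0.
apply/integrableP; split; first exact/measurable_EFinP.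
rewrite (eq_integral (fun p : RR * RR => (F p)%:E)); last first.
  by move=> p _ /=; rewrite ger0_norm// mulr_ge0.
rewrite (tonelli1 lebt lebt mI mI mF); last by move=> p _; rewrite mulr_ge0.
rewrite (eq_integral (fun t : RR => `|g t|%:E * \int[lebt]_(s in I) `|h s|%:E)%E); last first.
  move=> t _; rewrite -ge0_integralZl//.
  by apply/measurable_EFinP; exact: measurableT_comp.
have /integrableP[_ gf] := gi; have /integrableP[_ hf] := hi.
rewrite ge0_integralZr//.
- by rewrite lte_mul_pinfty// ?integral_ge0// ge0_fin_numE ?integral_ge0.
- by apply/measurable_EFinP; exact: measurableT_comp.
- exact: integral_ge0.
Qed.

Variables (k : R -> R) (K : R).
Hypotheses (mk : measurable_fun setT k) (k0 : forall x, 0 <= k x).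
Hypothesis kl : forall t, 0 < t < T -> (\int[lebt]_(s in `]0%R, t[) (k (t - s))%:E <= K%:E)%E.
Hypothesis kr : forall s, 0 < s < T -> (\int[lebt]_(t in `]s, T[) (k (t - s))%:E <= K%:E)%E.

(** Schur's test: [|g(t) h(s)| <= g(t)^2 + h(s)^2]. The first square is integrated in [s] first and
    the second in [t] first, so that each meets one of the two bounds by [K]. *)
Lemma integrable_tri_schur g h : memL2 lebt I g -> memL2 lebt I h ->
  (lebt \x lebt)%E.-integrable (I `*` I) (EFin \o tri_kernel k g h) /\
  (\int[(lebt \x lebt)%E]_(p in I `*` I) `|(tri_kernel k g h p)%:E| <=
    (K * (\int[lebt]_(t in I) (g t ^+ 2) + \int[lebt]_(t in I) (h t ^+ 2)))%:E)%E.
Proof.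
move=> gL hL; have mg := memL2_meas mI gL; have mh := memL2_meas mI hL.
have gi := memL2_sqr mI gL; have hi := memL2_sqr mI hL.
have mII : @measurable _ (measurableTypeR R * measurableTypeR R)%type (I `*` I) by exact: measurableX.
have mt := measurable_tri_kernel mk mg mh.
pose w (p : RR * RR) : R := \1_(`]0, p.1[) p.2 * k (p.1 - p.2).
have w0 p : 0 <= w p by rewrite mulr_ge0// indicE ler0n.
have mw : measurable_fun (I `*` I) w.
  apply: measurable_funM; first by apply: measurable_funS measurable_lt_pair.
  have : measurable_fun setT (fun p : RR * RR => k (p.1 - p.2)).
    by apply: measurableT_comp mk _; apply: measurable_funB; [exact: measurable_fst|exact: measurable_snd].
  exact: measurable_funS.
pose F1 (p : RR * RR) := w p * g p.1 ^+ 2; pose F2 (p : RR * RR) := w p * h p.2 ^+ 2.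
have mF1 : measurable_fun (I `*` I) F1.
  apply: measurable_funM => //; apply: measurable_funX.
  apply: (measurable_comp (F := I)) mg _ => //; first by move=> _ [p [] ? ? <-].
  by apply: measurable_funS measurable_fst.
have mF2 : measurable_fun (I `*` I) F2.
  apply: measurable_funM => //; apply: measurable_funX.
  apply: (measurable_comp (F := I)) mh _ => //; first by move=> _ [p [] ? ? <-].
  by apply: measurable_funS measurable_snd.
have F10 p : 0 <= F1 p by rewrite mulr_ge0 ?sqr_ge0.
have F20 p : 0 <= F2 p by rewrite mulr_ge0 ?sqr_ge0.
have sqE (f : R -> R) : lebt.-integrable I (EFin \o (fun x => f x ^+ 2)) ->
    (\int[lebt]_(x in I) (K%:E * (f x ^+ 2)%:E))%E = (K * \int[lebt]_(t in I) (f t ^+ 2))%:E.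
  move=> fi; rewrite integralZl// EFinM; congr (_ * _)%E.
  by rewrite fineK//; exact: integrable_fin_num.
have B1 : (\int[(lebt \x lebt)%E]_(p in I `*` I) (F1 p)%:E <= (K * \int[lebt]_(t in I) (g t ^+ 2))%:E)%E.
  rewrite (tonelli1 lebt lebt mI mI mF1)// -sqE//; apply: ge0_le_integral => //.
  - by move=> t _; apply: integral_ge0 => s _; rewrite lee_fin.
  - exact: measurable_tonelli1.
  - by apply: emeasurable_funM => //; exact/measurable_EFinP/measurable_funX.
  move=> t It; rewrite (eq_integral (fun s : RR => (g t ^+ 2)%:E * (w (t, s))%:E)%E); last first.
    by move=> s _; rewrite -EFinM mulrC.
  rewrite ge0_integralZl//; last 3 first.
  - by apply/measurable_EFinP; apply: (measurable_section1 mI mI mw).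
  - by move=> s _; rewrite lee_fin.
  - by rewrite lee_fin sqr_ge0.
  rewrite muleC; apply: lee_wpmul2r; first by rewrite lee_fin sqr_ge0.
  move: It; rewrite /= in_itv /= => tI; apply: le_trans (kl tI).
  have tT : `]0, t[ `<=` I by apply: subset_itvl; rewrite bnd_simp; case/andP : tI => _ /ltW.
  rewrite le_eqVlt; apply/orP; left; apply/eqP.
  rewrite [LHS]integral_mkcond [RHS]integral_mkcond; apply: eq_integral => s _.
  rewrite !patchE /w; case: ifPn => [/set_mem Is|nIs]; case: ifPn => // st.
  + by rewrite indicE st mul1r.
  + by rewrite indicE (negbTE st) mul0r.
  + by move/negP : nIs => []; apply/mem_set/tT/set_mem.
have B2 : (\int[(lebt \x lebt)%E]_(p in I `*` I) (F2 p)%:E <= (K * \int[lebt]_(t in I) (h t ^+ 2))%:E)%E.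
  rewrite (tonelli2 lebt lebt mI mI mF2)// -sqE//; apply: ge0_le_integral => //.
  - by move=> t _; apply: integral_ge0 => s _; rewrite lee_fin.
  - exact: measurable_tonelli2.
  - by apply: emeasurable_funM => //; exact/measurable_EFinP/measurable_funX.
  move=> s Is; rewrite (eq_integral (fun t : RR => (h s ^+ 2)%:E * (w (t, s))%:E)%E); last first.
    by move=> t _; rewrite -EFinM mulrC.
  rewrite ge0_integralZl//; last 3 first.
  - by apply/measurable_EFinP; apply: (measurable_section2 mI mI mw).
  - by move=> t _; rewrite lee_fin.
  - by rewrite lee_fin sqr_ge0.
  rewrite muleC; apply: lee_wpmul2r; first by rewrite lee_fin sqr_ge0.
  move: (Is); rewrite /= in_itv /= => sI; apply: le_trans (kr sI).
  have s0 : 0 < s by case/andP : sI.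
  have sT : `]s, T[ `<=` I by apply: subset_itvr; rewrite bnd_simp ltW.
  rewrite le_eqVlt; apply/orP; left; apply/eqP.
  rewrite [LHS]integral_mkcond [RHS]integral_mkcond; apply: eq_integral => t _.
  rewrite !patchE /w; case: ifPn => [/set_mem It|nIt]; case: ifPn => // st.
  + move: st; rewrite inE /= in_itv /= => /andP[st _].
    by rewrite indicE mem_set ?mul1r//= in_itv /= s0.
  + rewrite indicE memNset ?mul0r//= in_itv /= s0 /= => st'.
    by move/negP : st => []; rewrite inE /= in_itv /= st'; move: It; rewrite /= in_itv /= => /andP[].
  + by move/negP : nIt => []; apply/mem_set/sT/set_mem.
have B12 : (\int[(lebt \x lebt)%E]_(p in I `*` I) `|(tri_kernel k g h p)%:E| <=
    (K * (\int[lebt]_(t in I) (g t ^+ 2) + \int[lebt]_(t in I) (h t ^+ 2)))%:E)%E.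
  rewrite mulrDr EFinD; apply: le_trans (leeD B1 B2).
  rewrite -ge0_integralD//; last 4 first.
  - by move=> p _; rewrite lee_fin.
  - exact/measurable_EFinP.
  - by move=> p _; rewrite lee_fin.
  - exact/measurable_EFinP.
  apply: ge0_le_integral => //.
  - by apply: measurableT_comp => //; exact/measurable_EFinP.
  - by apply: emeasurable_funD; exact/measurable_EFinP.
  move=> p _; have -> : (`|(tri_kernel k g h p)%:E| = (w p * `|g p.1 * h p.2|)%:E)%E.
    have -> : tri_kernel k g h p = w p * (g p.1 * h p.2).
      exact: mulrA.
    by rewrite [LHS]/= normrM (ger0_norm (w0 p)).
  rewrite -EFinD lee_fin.
  rewrite -mulrDr ler_wpM2l// ler_norml; apply/andP.
  have := sqr_ge0 (g p.1 - h p.2); have := sqr_ge0 (g p.1 + h p.2).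
  have := sqr_ge0 (g p.1); have := sqr_ge0 (h p.2).
  by split; nra.
split=> //; apply/integrableP; split; first exact/measurable_EFinP.
by apply: le_lt_trans B12 _; rewrite ltry.
Qed.

End triangle_integrability.

(** * The du Bois-Reymond lemma *)

Section ae_zero.
Context {R : realType}.
Local Notation lebt := (@lebesgue_measure R).

(** By continuity the primitive vanishes at all times and not only at the rational ones; Lebesgue's
    differentiation theorem then gives [w = 0]. Rational endpoints keep the hypothesis countable. *)
Lemma ae_eq0_rat_integrals (T : R) (w : R -> R) : 0 < T ->
  lebt.-integrable `]0, T[ (EFin \o w) ->
  (forall q : rat, 0 < (ratr q : R) < T -> \int[lebt]_(t in `]0, (ratr q : R)[) w t = 0) ->
  {ae lebt, forall t, `]0, T[%classic t -> w t = 0}.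
Proof.
move=> T0 wi w0; pose G := w \_ `]0, T[%classic.
have Gi : lebt.-integrable setT (EFin \o G).
  have := (@integrable_mkcond _ (measurableTypeR R) _ lebt `]0, T[%classic (EFin \o w) (measurable_itv _)).1 wi.
  by apply: eq_integrable => // p _; rewrite /= /G !patchE; case: ifP.
have GiS (D : set R) : measurable D -> lebt.-integrable D (EFin \o G).
  by move=> mD; apply: integrableS Gi.
have mG : measurable_fun setT G by exact: integrable_real_meas Gi.
have loc : locally_integrable [set: R] G.
  split=> //; first exact: openT.
  move=> K _ cK; have /integrableP[_] : lebt.-integrable K (EFin \o G).
    by apply: GiS; exact: compact_measurable.
  by [].
have F1 := FTC1Ny (fun y => GiS _ (measurable_itv `]-oo, y])) loc.
pose F (x : R) := \int[lebt]_(t in `]-oo, x]) G t.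
have FP x : 0 <= x -> F x = \int[lebt]_(t in `[0, x]) G t.
  move=> x0; rewrite /F (@Rintegral_eq0_outside _ _ _ lebt `[0, x]%classic)//.
    by apply: subset_itvr; rewrite bnd_simp.
  move=> t; rewrite /= !in_itv /= => tx nt; rewrite /G patchE memNset//= in_itv /=.
  by move=> /andP[t0 _]; apply: nt; rewrite (ltW t0).
have F0q (q : rat) : 0 < (ratr q : R) < T -> F (ratr q) = 0.
  move=> /[dup] qT /andP[q0 _]; rewrite FP ?(ltW q0)//.
  transitivity (\int[lebt]_(t in `]0, (ratr q : R)[) w t); last exact: w0.
  rewrite -Rintegral_itv_obnd_cbnd; last exact: (GiS _ (measurable_itv _)).
  rewrite -Rintegral_itv_bndo_bndc; last exact: (GiS _ (measurable_itv _)).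
  apply: eq_Rintegral => t; rewrite inE /= in_itv /= => /andP[t0 tq].
  rewrite /G patchE mem_set//= in_itv /= t0 /= (lt_trans tq)//.
  by case/andP : qT.
have F0 x : 0 < x < T -> F x = 0.
  move=> /andP[x0 xT]; apply/eqP/negP => /negP Fx.
  have cP := parameterized_integral_continuous (ltW T0) (GiS _ (measurable_itv `[0, T])).
  have /continuous_within_itvP := cP; move=> /(_ T0)[cI _ _].
  have {}cI := cI x; rewrite in_itv /= x0 xT in cI; have {}cI := cI isT.
  have : \forall y \near x, F y != 0.
    have : \forall y \near x, parameterized_integral lebt 0 y G != 0.
      have P0 : parameterized_integral lebt 0 x G != 0.
        by rewrite /parameterized_integral -FP ?(ltW x0).
      exact: (cvgr_neq0 _ cI P0).
    apply: filterS2 (lt_nbhsr x0) => y /ltW y0.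
    by rewrite FP.
  move=> H; have : \forall y \near x, [/\ F y != 0, 0 < y & y < T].
    near=> y; split; near: y => //; [exact: lt_nbhsr|exact: lt_nbhsl].
  move=> /nbhs_ballP[e /= e0 He].
  have xe : x - e < x + e by rewrite ltrBlDr -addrA ltrDl addr_gt0.
  have [q] := rat_in_itvoo xe.
  rewrite in_itv /= => /andP[q1 q2].
  have [] := He (ratr q).
    by rewrite /ball /= ltr_distlC q1 q2.
  by move=> + q0 qT; rewrite F0q ?q0 ?qT// eqxx.
apply: ae_mono F1 => x [dF +] xI; rewrite /= in_itv /= in xI.
rewrite {2}/G patchE mem_set//; move=> <-.
rewrite derive1E (@near_eq_derive _ _ _ _ (cst 0))//.
  by rewrite derive_cst.
have /andP[x0 xT] := xI.
near=> y; apply: F0; apply/andP; split; near: y; [exact: lt_nbhsr|exact: lt_nbhsl].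
Unshelve. all: by end_near. Qed.

End ae_zero.

Lemma cvg_mul_unique (R : realType) (a b c d : nat -> R) (la lb lc ld : R) :
  (forall n, a n * b n = c n * d n) ->
  a n @[n --> \oo] --> la -> b n @[n --> \oo] --> lb ->
  c n @[n --> \oo] --> lc -> d n @[n --> \oo] --> ld -> la * lb = lc * ld.
Proof.
move=> E ha hb hc hd.
have hab : a n * b n @[n --> \oo] --> la * lb by exact: cvgM.
have hcd : c n * d n @[n --> \oo] --> lc * ld by exact: cvgM.
rewrite -(cvg_lim (@Rhausdorff R) hab) -(cvg_lim (@Rhausdorff R) hcd).
by congr (limn _); apply/funext => n; exact: E.
Qed.

Section du_bois_reymond.
Context {R : realType}.
Local Notation lebt := (@lebesgue_measure R).
Local Notation RR := (measurableTypeR R).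
Implicit Types (T b : R) (f h z : R -> R).

(** The primitive vanishes before [lo], and after [hi] it equals the total integral: the zero mean
    is exactly what makes its support compact. *)
Lemma primitive_test_fun T lo hi f : 0 < lo -> hi < T ->
  (forall n, Dn n f) -> (forall t, f t != 0 -> lo <= t <= hi) ->
  \int[lebt]_(t in `]0, T[) f t = 0 ->
  exists phi, [/\ time_test_fun T phi, derive1 phi = f &
    forall t, `]0, T[%classic t -> phi t = \int[lebt]_(s in `]0, t[) f s].
Proof.
move=> lo0 hiT Df fsupp f0.
have cf : continuous f := continuous_Dn (Df 0%N).
have fz t : ~ (lo <= t <= hi) -> f t = 0.
  by move=> nt; apply/eqP/negPn/negP => /fsupp.
have fi : lebt.-integrable setT (EFin \o f).
  have : lebt.-integrable `[lo, hi] (EFin \o f).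
    apply: continuous_compact_integrable; first exact: segment_compact.
    exact: continuous_subspaceT.
  move/(@integrable_mkcond _ RR _ lebt `[lo, hi]%classic (EFin \o f) (measurable_itv _)).1.
  apply: eq_integrable => // p _; rewrite /= !patchE; case: ifPn => // np.
  by rewrite fz// => lp; move/negP : np; apply; rewrite inE /= in_itv.
pose phi (x : R) := \int[lebt]_(t in `]-oo, x]) f t.
have dphi x : derivable phi x 1 /\ derive1 phi x = f x.
  have xx : x < x + 1 by rewrite ltrDl.
  apply: (continuous_FTC1 xx); [|by rewrite ltNyr|exact: cf].
  by apply: (integrableS _ _ _ fi) => //; exact: measurable_itv.
have phiE : derive1 phi = f by apply/funext => x; have [] := dphi x.
have phi_supp x : phi x != 0 -> lo <= x <= hi.
  apply: contraNT; rewrite negb_and -!ltNge => /orP[xlo|xhi]; apply/eqP.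
    rewrite /phi (@Rintegral_eq0_outside _ _ _ lebt set0)//; last first.
      move=> t; rewrite /= in_itv /= => tx _; apply: fz; apply/negP; rewrite negb_and -ltNge.
      by rewrite (le_lt_trans tx).
    by rewrite Rintegral_set0.
  rewrite -[RHS]f0 /phi (@Rintegral_eq0_outside _ _ _ lebt `[lo, hi]%classic).
  - rewrite [RHS](@Rintegral_eq0_outside _ _ _ lebt `[lo, hi]%classic)//.
      by move=> t; rewrite /= !in_itv /= => /andP[h1 h2]; rewrite (lt_le_trans lo0)//= (le_lt_trans h2).
    by move=> t _; rewrite /= in_itv /=; exact: fz.
  - by move=> t; rewrite /= !in_itv /= => /andP[h1 h2]; rewrite (le_trans h2)// ltW.
  - by move=> t _; rewrite /= in_itv /=; exact: fz.
have clI : closure [set t | phi t != 0] `<=` `[lo, hi]%classic.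
  apply: (@subset_trans _ (closure `[lo, hi]%classic)).
    by apply: closure_subset => x /phi_supp; rewrite /= in_itv.
  by move=> x; rewrite -(closure_id _).1//; exact: itv_closed.
exists phi; split=> //.
- split.
  + case=> [t|n t]; first by have [] := dphi t.
    by rewrite derive1nSr phiE; have /smooth1P := Df; exact.
  + apply: (subclosed_compact _ (@segment_compact _ lo hi)) => //.
    exact: closed_closure.
  + move=> x /clI; rewrite /= !in_itv /= => /andP[h1 h2].
    by rewrite (lt_le_trans lo0)//= (le_lt_trans h2).
- move=> t; rewrite /= in_itv /= => /andP[t0 tT].
  rewrite Rintegral_itv_bndo_bndc; last first.
    by apply: (integrableS _ _ _ fi) => //; exact: measurable_itv.
  rewrite /phi (@Rintegral_eq0_outside _ _ _ lebt `]0, t]%classic)//.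
    by apply: subset_itvr; rewrite bnd_simp.
  move=> s; rewrite /= !in_itv /= => st; rewrite st andbT => /negP s0.
  by apply: fz; apply/negP; rewrite negb_and -ltNge (le_lt_trans _ lo0)// leNgt.
Qed.

(** Each window is weighted by the mean of the other, so the total mean is 0 and the primitive is a
    test function. Rational [b] and [b'] give a countable family. *)
Definition dbr_fun T b b' n n' t : R :=
  (\int[lebt]_(t in `]0, T[) window n' b' t) * window n b t -
  (\int[lebt]_(t in `]0, T[) window n b t) * window n' b' t.

Lemma measurable_window n b D : measurable_fun D (@window R n b).
Proof.
apply: measurable_funS (measurableT) (@subsetT _ _) _.
exact: continuous_measurable_fun (continuous_Dn (Dn_window 0 n b)).
Qed.

Lemma integrable_window_mul T n b f : lebt.-integrable `]0, T[ (EFin \o f) ->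
  lebt.-integrable `]0, T[ (EFin \o (fun t => window n b t * f t)).
Proof.
move=> fi; have mI : measurable (`]0, T[%classic : set RR) := measurable_itv _.
have mf := integrable_real_meas fi.
apply: (integrable_le_real mI (g := fun t => `|f t|)).
- by apply: measurable_funM => //; exact: measurable_window.
- move=> t _; rewrite normrM ler_piMl// ger0_norm ?window_ge0//; exact: window_le1.
- exact: integrable_norm fi.
Qed.

Lemma lebesgue_measure_oo (a b : R) : a <= b -> lebt `]a, b[ = (b - a)%:E.
Proof.
move=> ab; rewrite lebesgue_measure_itv /= lte_fin; case: ifPn => [//|].
by rewrite -leNgt => ba; rewrite (_ : b = a) ?subrr//; apply/eqP; rewrite eq_le ba.
Qed.

Lemma lebesgue_measure_oo_lty (a b : R) : (lebt `]a, b[ < +oo)%E.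
Proof. by rewrite lebesgue_measure_itv /=; case: ifP => _; rewrite ?ltry. Qed.

Lemma Rintegral_cst_oo (a b c : R) : a <= b -> \int[lebt]_(t in `]a, b[) c = c * (b - a).
Proof.
move=> ab; rewrite Rintegral_cst; last exact: measurable_itv.
by congr (_ * _); rewrite -[RHS]/(fine (b - a)%:E) -lebesgue_measure_oo.
Qed.

Lemma integrable_cst_itv T (c : R) : lebt.-integrable `]0, T[ (EFin \o (fun=> c)).
Proof.
have mI : measurable (`]0, T[%classic : set RR) := measurable_itv _.
apply: (measurable_bounded_integrable mI) => //.
  exact: lebesgue_measure_oo_lty.
by exists `|c|; split; [exact: num_real|move=> M cM t _; exact: ltW].
Qed.

Lemma integrable_dbr_fun T b b' n n' f : lebt.-integrable `]0, T[ (EFin \o f) ->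
  lebt.-integrable `]0, T[ (EFin \o (fun t => dbr_fun T b b' n n' t * f t)).
Proof.
move=> fi; have mI : measurable (`]0, T[%classic : set RR) := measurable_itv _.
have h1 := integrableZ_real mI (\int[lebt]_(t in `]0, T[) window n' b' t) (integrable_window_mul n b fi).
have h2 := integrableZ_real mI (\int[lebt]_(t in `]0, T[) window n b t) (integrable_window_mul n' b' fi).
have := integrableB_real mI h1 h2.
apply: eq_integrable => // t _; rewrite /= /dbr_fun.
by move: (Rintegral _ _ _) (Rintegral _ _ _) => A B; rewrite mulrBl !mulrA.
Qed.

Lemma Rintegral_dbr_fun T b b' n n' f : lebt.-integrable `]0, T[ (EFin \o f) ->
  \int[lebt]_(t in `]0, T[) (dbr_fun T b b' n n' t * f t) =
  (\int[lebt]_(t in `]0, T[) window n' b' t) * (\int[lebt]_(t in `]0, T[) (window n b t * f t)) -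
  (\int[lebt]_(t in `]0, T[) window n b t) * (\int[lebt]_(t in `]0, T[) (window n' b' t * f t)).
Proof.
move=> fi; have mI : measurable (`]0, T[%classic : set RR) := measurable_itv _.
have h n b := integrable_window_mul n b fi.
rewrite -(RintegralZl _ mI (h n b)) -(RintegralZl _ mI (h n' b')) -RintegralB//; last 2 first.
- exact: (integrableZ_real mI).
- exact: (integrableZ_real mI).
apply: eq_Rintegral => t _; rewrite /dbr_fun.
by move: (Rintegral _ _ _) (Rintegral _ _ _) => A B; rewrite mulrBl !mulrA.
Qed.

Lemma Rintegral_dbr_fun0 T b b' n n' : \int[lebt]_(t in `]0, T[) dbr_fun T b b' n n' t = 0.
Proof.
have := Rintegral_dbr_fun b b' n n' (integrable_cst_itv T 1).
under eq_Rintegral do rewrite mulr1; move=> ->.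
under [X in _ * X - _]eq_Rintegral do rewrite mulr1.
under [X in _ - _ * X]eq_Rintegral do rewrite mulr1.
by rewrite mulrC subrr.
Qed.

Lemma dbr_test_fun T b b' n n' : 0 < b < T -> 0 < b' < T ->
  exists phi, [/\ time_test_fun T phi, derive1 phi = dbr_fun T b b' n n' &
    forall t, `]0, T[%classic t -> phi t = \int[lebt]_(s in `]0, t[) dbr_fun T b b' n n' s].
Proof.
move=> /andP[b0 bT] /andP[b'0 b'T].
apply: (@primitive_test_fun T (n + n').+1%:R^-1 (Num.max b b')).
- by rewrite invr_gt0.
- by rewrite gt_max bT b'T.
- move=> m; rewrite (_ : dbr_fun _ _ _ _ _ = fun t =>
    (\int[lebt]_(t in `]0, T[) window n' b' t) * window n b t +
    (- \int[lebt]_(t in `]0, T[) window n b t) * window n' b' t); last first.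
    by apply/funext => t; rewrite /dbr_fun mulNr.
  by apply: DnD; apply: DnM (Dn_cst _ _) (Dn_window _ _ _).
- have W (m : nat) (c t : R) : (m <= n + n')%N -> window m c t != 0 ->
      (n + n').+1%:R^-1 <= t <= c.
    move=> mn /window_neq0[m0 mt tc].
    have m0' : 0 < m%:R^-1 :> R by rewrite invr_gt0 ltr0n.
    rewrite (le_trans _ mt)/=; last first.
      by rewrite lef_pV2 ?posrE ?ltr0n// ler_nat (leq_trans mn)// leqnSn.
    by rewrite (le_trans tc)// gerBl ltW.
  move=> t ft; have : (window n b t != 0) || (window n' b' t != 0).
    apply: contraNT ft; rewrite negb_or !negbK => /andP[/eqP w1 /eqP w2].
    by rewrite /dbr_fun w1 w2 !mulr0 subrr.
  move=> /orP[/W|/W].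
    by move=> /(_ (leq_addr _ _))/andP[-> h]; rewrite le_max h.
  by move=> /(_ (leq_addl _ _))/andP[-> h]; rewrite le_max h orbT.
- exact: Rintegral_dbr_fun0.
Qed.

Lemma Rintegral_itv_split T t h : `]0, T[%classic t -> lebt.-integrable `]0, T[ (EFin \o h) ->
  \int[lebt]_(s in `]0, T[) h s = \int[lebt]_(s in `]0, t[) h s + \int[lebt]_(s in `]t, T[) h s.
Proof.
rewrite /= in_itv /= => /andP[t0 tT] hi.
have := @Rintegral_itvB _ h (BRight 0) (BLeft T) t hi; rewrite !bnd_simp => /(_ (ltW t0) tT) <-.
rewrite (@Rintegral_itv_bndo_bndc _ _ t) ?subrKC//.
apply: integrableS hi => //; try exact: measurable_itv.
by apply: subset_itvl; rewrite bnd_simp ltW.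
Qed.

Lemma integrable_primitive T h : lebt.-integrable `]0, T[ (EFin \o h) ->
  lebt.-integrable `]0, T[ (EFin \o (fun t => \int[lebt]_(s in `]0, t[) h s)).
Proof.
move=> hi; have mh := integrable_real_meas hi.
have := integrable_tri_fst (_ : measurable_fun setT (cst 1 : R -> R)) mh
  (integrable_tri_cst (integrable_cst_itv T 1) hi) => /(_ (measurable_cst _)).
apply: eq_integrable => // t _ /=; rewrite mul1r; congr (_%:E).
by apply: eq_Rintegral => s _; rewrite mul1r.
Qed.

(** Put [y = z - P], with [P] the primitive of [h]. Integration by parts makes [y] orthogonal to
    every [dbr_fun]; as the windows fill []0, b[] and []0, b'[] this becomes [b' Y(b) = b Y(b')] for
    the primitive [Y] of [y]. Hence [Y] is linear and [y] is constant. *)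
Lemma du_bois_reymond T z h : 0 < T ->
  lebt.-integrable `]0, T[ (EFin \o z) -> lebt.-integrable `]0, T[ (EFin \o h) ->
  (forall (q q' : rat) n n', 0 < (ratr q : R) < T -> 0 < (ratr q' : R) < T ->
    let f := dbr_fun T (ratr q) (ratr q') n n' in
    \int[lebt]_(t in `]0, T[) (z t * f t) =
    - \int[lebt]_(t in `]0, T[) (h t * \int[lebt]_(s in `]0, t[) f s)) ->
  exists C, {ae lebt, forall t, `]0, T[%classic t -> z t = C + \int[lebt]_(s in `]0, t[) h s}.
Proof.
move=> T0 zi hi H; have mI : measurable (`]0, T[%classic : set RR) := measurable_itv _.
have mh := integrable_real_meas hi.
pose P t := \int[lebt]_(s in `]0, t[) h s; pose y t := z t - P t.
have Pi : lebt.-integrable `]0, T[ (EFin \o P) := integrable_primitive hi.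
have yi : lebt.-integrable `]0, T[ (EFin \o y) := integrableB_real mI zi Pi.
have fy0 (q q' : rat) n n' : 0 < (ratr q : R) < T -> 0 < (ratr q' : R) < T ->
    \int[lebt]_(t in `]0, T[) (dbr_fun T (ratr q) (ratr q') n n' t * y t) = 0.
  move=> qT q'T; set f := dbr_fun _ _ _ _ _.
  have fi g := @integrable_dbr_fun T (ratr q) (ratr q') n n' g.
  have f1i : lebt.-integrable `]0, T[ (EFin \o f).
    by have := fi _ (integrable_cst_itv T 1); apply: eq_integrable => // t _ /=; rewrite mulr1.
  have mf := integrable_real_meas f1i.
  have tri := Rintegral_triangle (measurable_cst (1 : R)) mh mf (integrable_tri_cst hi f1i).
  (* The exchange of order produces the integral of [h] over []s, T[], that is its full integral
     minus [P s]; the full integral gets multiplied by the mean of [f], which is 0. *)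
  have E : \int[lebt]_(t in `]0, T[) (h t * \int[lebt]_(s in `]0, t[) f s) =
      - \int[lebt]_(s in `]0, T[) (f s * P s).
    transitivity (\int[lebt]_(s in `]0, T[) (f s * \int[lebt]_(t in `]s, T[) h t)).
      transitivity (\int[lebt]_(t in `]0, T[) (h t * \int[lebt]_(s in `]0, t[) (1 * f s))).
        by apply: eq_Rintegral => t _; congr (_ * _); apply: eq_Rintegral => s _; rewrite mul1r.
      rewrite tri; apply: eq_Rintegral => t _; congr (_ * _).
      by apply: eq_Rintegral => s _; rewrite mul1r.
    transitivity (\int[lebt]_(s in `]0, T[) (f s * (\int[lebt]_(t in `]0, T[) h t) - f s * P s)).
      apply: eq_Rintegral => s; rewrite inE => Is.
      by rewrite (Rintegral_itv_split Is hi) -mulrBr addrAC subrr add0r.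
    rewrite RintegralB//; last 2 first.
    - by have := integrableZ_real mI (\int[lebt]_(t in `]0, T[) h t) f1i;
        apply: eq_integrable => // t _ /=; rewrite mulrC.
    - exact: fi.
    by rewrite RintegralZr// Rintegral_dbr_fun0 mul0r sub0r.
  have := H q q' n n' qT q'T; rewrite /= -/f E opprK => Ez.
  transitivity (\int[lebt]_(t in `]0, T[) (f t * z t - f t * P t)).
    by apply: eq_Rintegral => t _; rewrite mulrBr.
  rewrite RintegralB//; try exact: fi.
  rewrite -Ez; apply/eqP; rewrite subr_eq0; apply/eqP.
  by apply: eq_Rintegral => t _; rewrite mulrC.
pose Y b := \int[lebt]_(t in `]0, b[) y t.
have w1 b : 0 < b < T -> \int[lebt]_(t in `]0, T[) window n b t @[n --> \oo] --> b.
  move=> /andP[b0 bT].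
  have := Rintegral_window_cvg (ltW bT) (integrable_cst_itv T 1).
  rewrite Rintegral_cst_oo ?(ltW b0)// mul1r subr0.
  by apply: cvg_trans; apply: near_eq_cvg; near=> n; apply: eq_Rintegral => t _; rewrite mulr1.
have YY (q q' : rat) : 0 < (ratr q : R) < T -> 0 < (ratr q' : R) < T ->
    ratr q' * Y (ratr q) = ratr q * Y (ratr q').
  move=> qT q'T.
  have S n n' := fy0 q q' n n' qT q'T.
  have S' n n' : (\int[lebt]_(t in `]0, T[) window n' (ratr q') t) *
      (\int[lebt]_(t in `]0, T[) (window n (ratr q) t * y t)) =
      (\int[lebt]_(t in `]0, T[) window n (ratr q) t) *
      (\int[lebt]_(t in `]0, T[) (window n' (ratr q') t * y t)).
    by apply/eqP; rewrite -subr_eq0 -Rintegral_dbr_fun// S.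
  have lq := Rintegral_window_cvg (ltW (andP qT).2) yi.
  have lq' := Rintegral_window_cvg (ltW (andP q'T).2) yi.
  exact: (cvg_mul_unique (fun n => S' n n) (w1 _ q'T) lq (w1 _ qT) lq').
have [q0] := rat_in_itvoo T0; rewrite in_itv /= => q0T.
have q0_neq0 : ratr q0 != 0 :> R by rewrite gt_eqF//; case/andP : q0T.
(* The slope of the linear function [Y], read at one rational time. *)
pose C := Y (ratr q0) / ratr q0.
exists C; have wi : lebt.-integrable `]0, T[ (EFin \o (fun t => y t - C)).
  exact: (integrableB_real mI yi (integrable_cst_itv T C)).
have : forall q : rat, 0 < (ratr q : R) < T -> \int[lebt]_(t in `]0, (ratr q : R)[) (y t - C) = 0.
  move=> q qT; have /andP[qp qT'] := qT.
  have sub : `]0, (ratr q : R)[ `<=` `]0, T[ by apply: subset_itvl; rewrite bnd_simp ltW.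
  rewrite RintegralB//; [|by apply: (integrableS _ _ _ yi) => //; exact: measurable_itv|exact: integrable_cst_itv].
  rewrite -/(Y _) Rintegral_cst_oo ?(ltW qp)// subr0 /C.
  have := YY q0 q q0T qT => E; apply/eqP; rewrite subr_eq0; apply/eqP.
  by apply: (mulfI q0_neq0); rewrite -YY// mulrCA mulrA mulfVK// mulrC.
move/(ae_eq0_rat_integrals T0 wi); apply: ae_mono => t + It => /(_ It) /eqP.
by rewrite subr_eq0 /y subr_eq => /eqP.
Unshelve. all: by end_near. Qed.

End du_bois_reymond.

(** * Primitives and fractional integrals *)

Section primitives.
Context {R : realType}.
Local Notation lebt := (@lebesgue_measure R).
Local Notation RR := (measurableTypeR R).
Implicit Types (g h m : R -> R).
Variable T : R.
Hypothesis T0 : 0 < T.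
Local Notation I := (`]0, T[%classic : set R).

Definition primitive h (t : R) : R := \int[lebt]_(s in `]0, t[) h s.

Let mI : @measurable _ RR I. Proof. exact: measurable_itv. Qed.

Lemma memL2_integrable h : memL2 lebt I h -> lebt.-integrable I (EFin \o h).
Proof.
move=> hL; apply: (integrable_le_real mI (g := fun t => 1 + h t ^+ 2)).
- exact: memL2_meas hL.
- move=> t _; rewrite ler_norml; apply/andP; have := sqr_ge0 (h t - 1); have := sqr_ge0 (h t + 1).
  by split; nra.
- by apply: (integrableD_real mI) (memL2_sqr mI hL); exact: integrable_cst_itv.
Qed.

(** The interval of integration is empty. A shifted primitive at [t - r] thus behaves like that of a
    function extended by zero to the past. *)
Lemma primitive_le0 h x : x <= 0 -> primitive h x = 0.
Proof.
move=> x0; rewrite /primitive (_ : `]0, x[%classic = set0) ?Rintegral_set0//.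
by apply/seteqP; split=> // t; rewrite /= in_itv /= => /andP[t0 tx]; have := lt_trans t0 tx; rewrite ltNge x0.
Qed.

Lemma primitive_bounded h t : lebt.-integrable I (EFin \o h) -> t <= T ->
  `|primitive h t| <= \int[lebt]_(s in I) `|h s|.
Proof.
move=> hi tT; have tI : `]0, t[ `<=` I by apply: subset_itvl; rewrite bnd_simp.
have mt : @measurable _ RR `]0, t[%classic by exact: measurable_itv.
have hti : lebt.-integrable `]0, t[ (EFin \o h) by exact: integrableS hi.
apply: le_trans (le_normr_Rintegral mt hti) _.
rewrite [leLHS](_ : _ = \int[lebt]_(s in I) (\1_`]0, t[ s * `|h s|)); last first.
  rewrite [RHS](@Rintegral_eq0_outside _ _ _ lebt `]0, t[%classic)//.
    by apply: eq_Rintegral => s ts; rewrite indicE ts mul1r.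
  by move=> s _ ts; rewrite indicE memNset// mul0r.
have hn : lebt.-integrable I (EFin \o (fun s => `|h s|)) := integrable_norm hi.
have leh s : \1_`]0, t[ s * `|h s| <= `|h s| by rewrite ler_piMl// indicE; case: (_ \in _).
apply: le_Rintegral => //; apply: (integrable_le_real mI (g := fun s => `|h s|)) => //.
  apply: measurable_funM; first exact: measurable_indic.
  exact: integrable_real_meas hn.
by move=> s _; rewrite ger0_norm ?leh// mulr_ge0// indicE.
Qed.

Lemma measurable_primitive h : lebt.-integrable I (EFin \o h) -> measurable_fun I (primitive h).
Proof. by move=> /integrable_primitive /integrable_real_meas. Qed.

Lemma memL2_bounded_fun h M : measurable_fun I h -> (forall t, I t -> `|h t| <= M) -> memL2 lebt I h.
Proof.
move=> mh hM; apply: (@memL2_le _ RR _ lebt I mI _ (fun=> M)) => //.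
  by move=> t It; rewrite (le_trans (hM t It))// ler_norm.
apply/(memL2P _ mI); split=> //; exact: integrable_cst_itv.
Qed.

Lemma memL2_primitive h : lebt.-integrable I (EFin \o h) -> memL2 lebt I (primitive h).
Proof.
move=> hi; apply: (memL2_bounded_fun (M := \int[lebt]_(s in I) `|h s|)).
  exact: measurable_primitive.
by move=> t; rewrite /= in_itv /= => /andP[_ /ltW]; exact: primitive_bounded.
Qed.

Lemma integrable_mul_primitive g h : lebt.-integrable I (EFin \o g) ->
  lebt.-integrable I (EFin \o h) -> lebt.-integrable I (EFin \o (fun t => g t * primitive h t)).
Proof.
move=> gi hi; pose M := \int[lebt]_(s in I) `|h s|.
apply: (integrable_le_real mI (g := fun t => M * `|g t|)).
- by apply: measurable_funM; [exact: integrable_real_meas gi|exact: measurable_primitive].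
- move=> t; rewrite /= in_itv /= => /andP[_ /ltW tT]; rewrite normrM mulrC ler_wpM2r//.
  exact: primitive_bounded.
- exact: (integrableZ_real mI _ (integrable_norm gi)).
Qed.

Lemma Rintegral_primitive_swap g h : lebt.-integrable I (EFin \o g) -> lebt.-integrable I (EFin \o h) ->
  \int[lebt]_(t in I) (g t * primitive h t) =
  \int[lebt]_(s in I) (h s * \int[lebt]_(t in `]s, T[) g t).
Proof.
move=> gi hi; have [mg mh] := (integrable_real_meas gi, integrable_real_meas hi).
have := Rintegral_triangle (measurable_cst (1 : R)) mg mh (integrable_tri_cst gi hi).
have E1 t (D : set R) (f : R -> R) : \int[lebt]_(s in D) (cst 1 (t s : R) * f s) = \int[lebt]_(s in D) f s.
  by apply: eq_Rintegral => s _; rewrite mul1r.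
move=> E; transitivity (\int[lebt]_(t in I) (g t * \int[lebt]_(s in `]0, t[) (1 * h s))).
  by apply: eq_Rintegral => t _; rewrite (E1 (fun=> 0)).
by rewrite E; apply: eq_Rintegral => s _; rewrite (E1 (fun=> 0)).
Qed.

(** One factor is a primitive vanishing at 0 and the other a primitive vanishing at [T], so no
    boundary term appears. *)
Lemma integration_by_parts_ae h m y : lebt.-integrable I (EFin \o h) ->
  lebt.-integrable I (EFin \o m) -> measurable_fun I y ->
  {ae lebt, forall t, I t -> y t = - \int[lebt]_(s in `]t, T[) m s} ->
  \int[lebt]_(t in I) (h t * y t) = - \int[lebt]_(t in I) (m t * primitive h t).
Proof.
move=> hi mi my yE; rewrite (Rintegral_primitive_swap mi hi).
have mh := integrable_real_meas hi.
have mt : measurable_fun I (fun t => \int[lebt]_(s in `]t, T[) m s).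
  have : measurable_fun I (fun t => \int[lebt]_(s in I) m s - primitive m t).
    by apply: measurable_funB => //; exact: measurable_primitive.
  apply: eq_measurable_fun => t; rewrite inE => It.
  by rewrite (Rintegral_itv_split It mi) addrAC subrr add0r.
rewrite (ae_eq_Rintegral mI (g := fun t => -1 * (h t * \int[lebt]_(s in `]t, T[) m s))).
- by rewrite RintegralZl_measurable ?mulN1r//; exact: measurable_funM.
- exact: measurable_funM.
- by apply: measurable_funM => //; exact: measurable_funM.
- by apply: ae_mono yE => t + It => /(_ It) ->; rewrite mulN1r mulrN.
Qed.

End primitives.

(** * Energy identities and positivity of the fractional convolution *)

Section energy.
Context {R : realType}.
Local Notation lebt := (@lebesgue_measure R).
Local Notation RR := (measurableTypeR R).
Implicit Types (g h m : R -> R).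

(** With [H] the primitive and [X] the integral of [h H], the exchange of order gives
    [X = H(T)^2 - X]. *)
Lemma Rintegral_mul_primitive (T : R) h : 0 < T -> lebt.-integrable `]0, T[ (EFin \o h) ->
  2 * \int[lebt]_(t in `]0, T[) (h t * primitive h t) = primitive h T ^+ 2.
Proof.
move=> T0 hi; have mI : @measurable _ RR `]0, T[%classic := measurable_itv _.
have hp := integrable_mul_primitive hi hi.
have E : \int[lebt]_(t in `]0, T[) (h t * \int[lebt]_(s in `]t, T[) h s) =
    primitive h T * primitive h T - \int[lebt]_(t in `]0, T[) (h t * primitive h t).
  rewrite -[X in X * _]/(\int[lebt]_(t in `]0, T[) h t) -RintegralZr// -RintegralB//.
    apply: eq_Rintegral => t; rewrite inE => It; rewrite -mulrBr; congr (_ * _).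
    by rewrite /primitive (Rintegral_itv_split It hi) addrAC subrr add0r.
  by apply: eq_integrable_real (integrableZ_real mI (primitive h T) hi) => // t _; rewrite mulrC.
have := Rintegral_primitive_swap hi hi; rewrite E.
move: (Rintegral _ _ _) (primitive h T) => X P XE.
by rewrite mulr_natl mulr2n {1}XE expr2 subrK.
Qed.

(** The identity of [Rintegral_mul_primitive] on []0, t[], integrated over [t]: exchanging the order
    turns the outer integration into the weight [T - t]. *)
Lemma Rintegral_energy (T : R) h : 0 < T -> memL2 lebt `]0, T[ h ->
  \int[lebt]_(t in `]0, T[) ((T - t) * (h t * primitive h t)) =
  2^-1 * \int[lebt]_(t in `]0, T[) (primitive h t ^+ 2).
Proof.
move=> T0 hL; have mI : @measurable _ RR `]0, T[%classic := measurable_itv _.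
have hi := memL2_integrable hL; have hp := integrable_mul_primitive hi hi.
have := Rintegral_primitive_swap (integrable_cst_itv T 1) hp.
rewrite (_ : \int[lebt]_(t in _) _ = 2^-1 * \int[lebt]_(t in `]0, T[) (primitive h t ^+ 2)); last first.
  rewrite -RintegralZl//; last by exact: (memL2_sqr mI (memL2_primitive hi)).
  apply: eq_Rintegral => t; rewrite inE /= in_itv /= => /andP[t0 tT].
  have hti : lebt.-integrable `]0, t[ (EFin \o h).
    apply: integrableS hi => //.
    by apply: subset_itvl; rewrite bnd_simp ltW.
  by rewrite -(Rintegral_mul_primitive t0 hti) mulKf ?mul1r.
move=> ->; apply: eq_Rintegral => t; rewrite inE /= in_itv /= => /andP[t0 tT].
by rewrite Rintegral_cst_oo ?(ltW tT)// mul1r mulrC.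
Qed.

End energy.

Lemma le_Rintegral_subset d (X : measurableType d) (R : realType)
    (mu : {measure set X -> \bar R}) (D D' : set X) (f g : X -> R) :
  measurable D -> measurable D' -> D `<=` D' ->
  mu.-integrable D (EFin \o f) -> mu.-integrable D' (EFin \o g) ->
  (forall x, D x -> f x <= g x) -> (forall x, D' x -> 0 <= g x) ->
  \int[mu]_(x in D) f x <= \int[mu]_(x in D') g x.
Proof.
move=> mD mD' DD' fi gi fg g0.
have gDi : mu.-integrable D (EFin \o g) by exact: integrableS gi.
apply: (le_trans (le_Rintegral mD fi gDi fg)).
rewrite /Rintegral fine_le//; [exact: integrable_fin_num|exact: integrable_fin_num|].
apply: ge0_subset_integral => //; first exact: measurable_int gi.
Qed.

Section positivity.
Context {R : realType}.
Local Notation lebt := (@lebesgue_measure R).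
Local Notation RR := (measurableTypeR R).
Variables (T : R) (h : R -> R).
Hypotheses (T0 : 0 < T) (hL : memL2 lebt `]0, T[ h).
Local Notation I := (`]0, T[%classic : set R).
Local Notation w := (primitive h).

Let mI : @measurable _ RR I. Proof. exact: measurable_itv. Qed.
Let hi : lebt.-integrable I (EFin \o h). Proof. exact: memL2_integrable. Qed.
Let wL : memL2 lebt I w. Proof. exact: memL2_primitive. Qed.

(** Continuity is taken up to both endpoints because the change of variables in [Rintegral_shift]
    works on closed intervals. *)
Lemma continuous_primitive : {within `[0, T], continuous w}.
Proof.
pose G := h \_ I.
have Gi : lebt.-integrable setT (EFin \o G).
  have := (@integrable_mkcond _ RR _ lebt I (EFin \o h) mI).1 hi.
  by apply: eq_integrable => // p _; rewrite /= /G !patchE; case: ifP.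
have GiS (a b : itv_bound R) : lebt.-integrable [set` Interval a b] (EFin \o G).
  by apply: (integrableS _ _ _ Gi) => //; exact: measurable_itv.
have cP := parameterized_integral_continuous (ltW T0) (GiS (BLeft 0) (BRight T)).
have E x : x \in `[0, T] -> parameterized_integral lebt 0 x G = w x.
  rewrite in_itv /= => /andP[x0 xT]; rewrite /parameterized_integral /primitive.
  rewrite -(Rintegral_itv_obnd_cbnd (GiS (BRight 0) (BRight x))).
  rewrite -(Rintegral_itv_bndo_bndc (GiS (BRight 0) (BLeft x))).
  apply: eq_Rintegral => t; rewrite inE /= in_itv /= => /andP[t0 tx].
  by rewrite /G patchE mem_set//= in_itv /= t0 (lt_le_trans tx).
apply: subspace_eq_continuous cP.
by move=> x; rewrite inE /= => xI; exact: E.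
Qed.

Lemma Rintegral_shift r : 0 < r < T ->
  \int[lebt]_(t in `]r, T[) ((T - t) * w (t - r) ^+ 2) =
  \int[lebt]_(t in `]0, T - r[) ((T - r - t) * w t ^+ 2).
Proof.
move=> /andP[r0 rT].
pose G (t : R) := (T - r - t) * w t ^+ 2; pose F (t : R) := t - r.
have dF (x : R) : is_derive x 1 F 1.
  have := is_deriveB (is_derive_id x (1 : R)) (is_derive_cst r x (1 : R)).
  by rewrite subr0.
have F'1 : derive1 F = cst 1.
  by apply/funext => x; rewrite derive1E; have [] := dF x.
have cF x : {for x, continuous F}.
  by apply: differentiable_continuous; apply/derivable1_diffP; have [] := dF x.
have subI : `[0, T - r] `<=` `[0, T].
  by apply: subset_itvl; rewrite bnd_simp lerBlDr lerDl ltW.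
have cG : {within `[F r, F T], continuous G}.
  rewrite /F subrr.
  have cw : {within `[0, T - r], continuous w} := continuous_subspaceW subI continuous_primitive.
  have c1 : {within `[0, T - r], continuous (fun t : R => T - r - t)}.
    apply: continuous_subspaceT => t; apply: (@cvgB _ R); [exact: cvg_cst|exact: cvg_id].
  have c2 : {within `[0, T - r], continuous (fun t : R => w t * w t)}.
    by move=> x; apply: cvgM; exact: cw.
  by move=> x; exact: (cvgM (c1 x) (c2 x)).
have H : (\int[lebt]_(x in `[F r, F T]) (G x)%:E = \int[lebt]_(x in `[r, T]) (((G \o F) * derive1 F) x)%:E)%E.
  apply: integration_by_substitution_increasing => //.
  - exact: ltW.
  - by move=> x y _ _ xy; rewrite /F ltrD2r.
  - by rewrite F'1 => x _; exact: cvg_cst.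
  - by rewrite F'1; exact: is_cvg_cst.
  - by rewrite F'1; exact: is_cvg_cst.
  - split.
    + by move=> x _; have [] := dF x.
    + by apply: cvg_at_right_filter; exact: cF.
    + by apply: cvg_at_left_filter; exact: cF.
have mG : measurable_fun `]0, T - r[ G.
  apply: measurable_funM; first by apply: measurable_funB.
  apply: measurable_funX; apply: measurable_funS (measurable_primitive hi) => //.
  by apply: subset_itvl; rewrite bnd_simp lerBlDr lerDl ltW.
have mGF : measurable_fun `]r, T[ (G \o F).
  apply: (measurable_comp (F := `]0, T - r[%classic)) mG _ => //.
    move=> _ [t + <-]; rewrite /= !in_itv /= => /andP[rt tT].
    by rewrite /F subr_gt0 rt ltrD2r.
  exact: measurable_funB.
have E1 : (\int[lebt]_(x in `[F r, F T]) (G x)%:E = \int[lebt]_(x in `]0%R, (T - r)%R[) (G x)%:E)%E.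
  rewrite /F subrr integral_itv_bndoo//; exact/measurable_EFinP.
have E2 : (\int[lebt]_(x in `[r, T]) (((G \o F) * derive1 F) x)%:E = \int[lebt]_(x in `]r, T[) ((G \o F) x)%:E)%E.
  transitivity (\int[lebt]_(x in `[r, T]) ((G \o F) x)%:E)%E.
    by apply: eq_integral => x _; rewrite F'1; congr EFin; exact: mulr1.
  apply: integral_itv_bndoo; exact/measurable_EFinP.
apply: (congr1 fine).
apply: (etrans _ (etrans (esym E2) (etrans (esym H) E1))).
by apply: eq_integral => t _; rewrite /= /G /F; congr (_ * _)%:E; ring.
Qed.

(** Since [w] vanishes at negative times, the shift only moves the values of [w^2] to later times,
    where the weight [T - t] is smaller. *)
Lemma Rintegral_shift_le r : 0 < r ->
  \int[lebt]_(t in I) ((T - t) * w (t - r) ^+ 2) <= \int[lebt]_(t in I) ((T - t) * w t ^+ 2).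
Proof.
move=> r0; have w2 := memL2_sqr mI wL.
have R0 : 0 <= \int[lebt]_(t in I) ((T - t) * w t ^+ 2).
  apply: Rintegral_ge0 => t; rewrite /= in_itv /= => /andP[_ tT].
  by rewrite mulr_ge0 ?sqr_ge0// subr_ge0 ltW.
have [Tr|rT] := leP T r.
  rewrite (@Rintegral_eq0_outside _ _ _ lebt set0) ?Rintegral_set0//.
  move=> t; rewrite /= in_itv /= => /andP[t0 tT] _.
  by rewrite primitive_le0 ?expr0n ?mulr0// subr_le0 ltW// (lt_le_trans tT).
have rI : `]r, T[ `<=` I by apply: subset_itvr; rewrite bnd_simp ltW.
rewrite (@Rintegral_eq0_outside _ _ _ lebt `]r, T[%classic); [|exact: rI|].
  2: {
  move=> t; rewrite /= !in_itv /= => /andP[t0 tT]; rewrite tT andbT => /negP; rewrite -leNgt => tr.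
  by rewrite primitive_le0 ?expr0n ?mulr0// subr_le0. }
rewrite Rintegral_shift ?r0//.
have sub : `]0, T - r[ `<=` I by apply: subset_itvl; rewrite bnd_simp lerBlDr lerDl ltW.
have mT : measurable_fun setT (fun t : R => T - t) by exact: measurable_funB.
have Ti c : lebt.-integrable I (EFin \o (fun t => (c - t) * w t ^+ 2)).
  apply: (integrable_le_real mI (g := fun t => (`|c| + T) * w t ^+ 2)).
  - apply: measurable_funM; first by apply: measurable_funB.
    by apply: measurable_funX; exact: measurable_primitive.
  - move=> t; rewrite /= in_itv /= => /andP[t0 tT].
    rewrite normrM (ger0_norm (sqr_ge0 _)) ler_wpM2r ?sqr_ge0//.
    by rewrite (le_trans (ler_normB _ _))// lerD2l gtr0_norm// ltW.
  - exact: integrableZ_real.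
apply: le_Rintegral_subset => //.
- by apply: integrableS (Ti _) => //; exact: measurable_itv.
- move=> t; rewrite /= in_itv /= => /andP[t0 tT].
  by rewrite ler_wpM2r ?sqr_ge0// lerD2r gerBl ltW.
- move=> t; rewrite /= in_itv /= => /andP[_ tT].
  by rewrite mulr_ge0 ?sqr_ge0// subr_ge0 ltW.
Qed.

End positivity.

(* The canonical sigma-finite structure of [product_measure1] is the one inherited
   from subprobabilities; this alias carries the general one. *)
Definition product_sigma d1 d2 (X : measurableType d1) (Y : measurableType d2) (R : realType)
    (m1 : {sigma_finite_measure set X -> \bar R}) (m2 : {sigma_finite_measure set Y -> \bar R}) :
  set (X * Y) -> \bar R := (m1 \x m2)%E.

Section product_sigma_finite.
Context d1 d2 (X : measurableType d1) (Y : measurableType d2) (R : realType).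
Variable m1 : {sigma_finite_measure set X -> \bar R}.
Variable m2 : {sigma_finite_measure set Y -> \bar R}.

HB.instance Definition _ := Measure.copy (product_sigma m1 m2) (m1 \x m2)%E.

Let product_sigma_finite : sigma_finite setT (product_sigma m1 m2).
Proof.
have /sigma_finiteP[F [FT Fnd Ffin]] := sigma_finiteT m1.
have /sigma_finiteP[G [GT Gnd Gfin]] := sigma_finiteT m2.
exists (fun n => F n `*` G n) => [|n].
  apply/esym; rewrite -subTset => -[x y] _.
  have [i _ Fx] : (\bigcup_n F n) x by rewrite -FT.
  have [j _ Gy] : (\bigcup_n G n) y by rewrite -GT.
  exists (maxn i j) => //; split.
    by move/subsetPset: (Fnd i _ (leq_maxl i j)); exact.
  by move/subsetPset: (Gnd j _ (leq_maxr i j)); exact.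
have [mF Fn] := Ffin n; have [mG Gn] := Gfin n; split; first exact: measurableX.
by rewrite /product_sigma product_measure1E// lte_mul_pinfty// ge0_fin_numE.
Qed.

HB.instance Definition _ := @Measure_isSigmaFinite.Build _ _ _
  (product_sigma m1 m2) product_sigma_finite.

End product_sigma_finite.

Section step_kernel.
Context {R : realType}.
Local Notation lebt := (@lebesgue_measure R).
Local Notation RR := (measurableTypeR R).
Variables (T : R) (h : R -> R).
Hypotheses (T0 : 0 < T) (hL : memL2 lebt `]0, T[ h).
Local Notation I := (`]0, T[%classic : set R).
Local Notation w := (primitive h).

Let mI : @measurable _ RR I. Proof. exact: measurable_itv. Qed.
Let hi : lebt.-integrable I (EFin \o h). Proof. exact: memL2_integrable. Qed.
Let wL : memL2 lebt I w. Proof. exact: memL2_primitive. Qed.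

(** The step kernel keeps the part of []0, t[] with [t - s < r], over which [h] is integrated; for
    [r >= t] the subtracted term is 0, as it is a primitive at a nonpositive time. *)
Lemma Rintegral_step_kernel (k : R -> R) (r t : R) : I t -> 0 < r ->
  (forall x, 0 < x < T -> k x = (x < r)%R%:R) ->
  \int[lebt]_(s in `]0, t[) (k (t - s) * h s) = w t - w (t - r).
Proof.
rewrite /= in_itv /= => /andP[t0 tT] r0 kE.
have kE' s : s \in `]0, t[%classic -> k (t - s) * h s = (t - s < r)%R%:R * h s.
  rewrite inE /= in_itv /= => /andP[s0 st]; rewrite kE// subr_gt0 st/=.
  by rewrite (lt_trans _ tT)// ltrBlDr ltrDl.
transitivity (\int[lebt]_(s in `]0, t[) ((t - s < r)%R%:R * h s)); first exact: eq_Rintegral.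
have hti : lebt.-integrable `]0, t[ (EFin \o h).
  apply: integrableS hi => //.
  by apply: subset_itvl; rewrite bnd_simp ltW.
have [tr|rt] := leP t r.
  rewrite [X in _ = _ - X]primitive_le0 ?subr_le0// subr0.
  apply: eq_Rintegral => s; rewrite inE /= in_itv /= => /andP[s0 st].
  by rewrite (lt_le_trans _ tr) ?mul1r// ltrBlDr ltrDl.
have Itr : `]0, t[%classic (t - r) by rewrite /= in_itv /= subr_gt0 rt ltrBlDr ltrDl.
rewrite /primitive (Rintegral_itv_split Itr hti) addrAC subrr add0r.
rewrite (@Rintegral_eq0_outside _ _ _ lebt `](t - r), t[%classic).
- apply: eq_Rintegral => s; rewrite inE /= in_itv /= => /andP[s0 st].
  by rewrite ltrBlDr addrC -ltrBlDr s0 mul1r.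
- by apply: subset_itvr; rewrite bnd_simp subr_ge0 ltW.
- move=> s; rewrite /= !in_itv /= => /andP[s0 st]; rewrite st andbT => /negP ns.
  by rewrite ltrBlDr addrC -ltrBlDr (negbTE ns) mul0r.
Qed.

(** By [Rintegral_step_kernel] the integrand is [(T - t) a (a - b)] with [a = w(t)] and
    [b = w(t - r)]. From [a (a - b) >= (a^2 - b^2) / 2] the claim reduces to the weighted shift
    inequality. *)
Lemma step_kernel_ge0 (k : R -> R) (r : R) : 0 < r -> measurable_fun setT k ->
  (forall x, 0 < x < T -> k x = (x < r)%R%:R) ->
  0 <= \int[lebt]_(t in I) ((T - t) * w t * \int[lebt]_(s in `]0, t[) (k (t - s) * h s)).
Proof.
move=> r0 mk kE.
have mw : measurable_fun I w := measurable_primitive hi.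
have mTt : measurable_fun I (fun t : R => T - t) by exact: measurable_funB.
have bT t : I t -> `|T - t| <= T.
  by rewrite /= in_itv /= => /andP[t0 tT]; rewrite ger0_norm ?subr_ge0 ?(ltW tT)// gerBl ltW.
(* Measurability of the shifted primitive is read off the convolution with the step kernel. As [k]
   is prescribed only on []0, T[], the convolution is formed with [k] cut off to that interval,
   where it is at most 1. *)
have mwr : measurable_fun I (fun t => w (t - r)).
  have mp : measurable_fun I (fun t => \int[lebt]_(s in `]0, t[) (k (t - s) * h s)).
    have mh := memL2_meas mI hL.
    have k1 : measurable_fun setT (fun x : R => k x * \1_I x).
      by apply: measurable_funM => //; exact: measurable_indic.
    have bk (p : RR * RR) : (I `*` I) p ->
      `|tri_kernel (fun x : R => k x * \1_I x) (cst 1) h p| <= `|tri_kernel (cst 1) (cst 1) h p|.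
      move=> [/=]; case: p => t s /= It Is; rewrite /tri_kernel /=.
      rewrite [\1_`]0, t[ s]indicE.
      have [|_] := boolP (s \in `]0, t[%classic); last by rewrite !mul0r.
      rewrite inE /= in_itv /= => /andP[s0 st]; rewrite !mul1r !normrM ler_piMl//.
      move: It; rewrite /= in_itv /= => /andP[t0 tT].
      have tsT : 0 < t - s < T by rewrite subr_gt0 st/= (lt_trans _ tT)// ltrBlDr ltrDl.
      rewrite kE// indicE -normrM.
      by case: (_ < r); case: (_ \in _); rewrite /= ?mulr1 ?mul0r ?normr1 ?normr0// mulr0 normr0.
    have ti : (lebt \x lebt)%E.-integrable (I `*` I) (EFin \o tri_kernel (fun x : R => k x * \1_I x) (cst 1) h).
      have mII : @measurable _ (RR * RR)%type (I `*` I) by exact: measurableX.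
      apply: (integrable_le_real mII (g := fun p : RR * RR => `|tri_kernel (cst 1) (cst 1) h p|)).
      - exact: measurable_tri_kernel.
      - exact: bk.
      - exact: integrable_norm (integrable_tri_cst (integrable_cst_itv T 1) hi).
    have := integrable_real_meas (integrable_tri_fst k1 mh ti).
    apply: eq_measurable_fun => t; rewrite inE /= in_itv /= => /andP[t0 tT]; rewrite mul1r.
    apply: eq_Rintegral => s; rewrite inE /= in_itv /= => /andP[s0 st].
    have tsT : 0 < t - s < T by rewrite subr_gt0 st/= (lt_trans _ tT)// ltrBlDr ltrDl.
    by rewrite indicE mem_set/= ?in_itv// mulr1.
  have : measurable_fun I (fun t => w t - \int[lebt]_(s in `]0, t[) (k (t - s) * h s)).
    exact: measurable_funB.
  apply: eq_measurable_fun => t; rewrite inE => It.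
  by rewrite (Rintegral_step_kernel It r0 kE) opprB addrC subrK.
have wrL : memL2 lebt I (fun t => w (t - r)).
  apply: (memL2_bounded_fun (M := \int[lebt]_(s in I) `|h s|)) => // t.
  rewrite /= in_itv /= => /andP[_ tT]; apply: primitive_bounded => //.
  by rewrite (le_trans _ (ltW tT))// gerBl ltW.
have Lb f : memL2 lebt I f -> memL2 lebt I (fun t => (T - t) * f t).
  by move=> fL; apply: (memL2_bounded mI mTt bT fL).
have A1 : lebt.-integrable I (EFin \o (fun t => (T - t) * w t ^+ 2)).
  have := memL2_mul mI (Lb _ wL) wL.
  by apply: eq_integrable_real => // t _; rewrite -mulrA.
have A2 : lebt.-integrable I (EFin \o (fun t => (T - t) * w (t - r) ^+ 2)).
  have := memL2_mul mI (Lb _ wrL) wrL.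
  by apply: eq_integrable_real => // t _; rewrite -mulrA.
have A3 : lebt.-integrable I (EFin \o (fun t => (T - t) * w t * (w t - w (t - r)))).
  exact: (memL2_mul mI (Lb _ wL) (memL2B mI wL wrL)).
rewrite (@eq_Rintegral _ _ _ lebt _ (fun t => (T - t) * w t * (w t - w (t - r)))); last first.
  by move=> t; rewrite inE => It; congr (_ * _); exact: Rintegral_step_kernel It r0 kE.
have A4 := integrableB_real mI A1 A2.
have A5 := integrableZ_real mI 2^-1 A4.
have : 2^-1 * \int[lebt]_(t in I) ((T - t) * w t ^+ 2 - (T - t) * w (t - r) ^+ 2) <=
    \int[lebt]_(t in I) ((T - t) * w t * (w t - w (t - r))).
  rewrite -(RintegralZl _ mI A4); apply: (le_Rintegral mI A5 A3) => t It.
  have Tt : 0 <= T - t by move: It; rewrite /= in_itv /= => /andP[_ tT]; rewrite subr_ge0 ltW.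
  move: (w t) (w (t - r)) (T - t) Tt => a b c c0 {It}.
  have -> : 2^-1 * (c * a ^+ 2 - c * b ^+ 2) = c * a * (a - b) - c * ((a - b) ^+ 2 / 2) by field.
  by rewrite gerBl mulr_ge0// divr_ge0 ?sqr_ge0.
apply: le_trans; rewrite mulr_ge0 ?invr_ge0// (RintegralB mI A1 A2) subr_ge0.
exact: Rintegral_shift_le.
Qed.

End step_kernel.

Section layer_cake.
Context {R : realType}.
Local Notation lebt := (@lebesgue_measure R).
Local Notation RR := (measurableTypeR R).
Variables (T alpha : R) (h : R -> R).
Hypotheses (T0 : 0 < T) (a0 : 0 < alpha) (a1 : alpha < 1) (hL : memL2 lebt `]0, T[ h).
Local Notation I := (`]0, T[%classic : set R).
Local Notation L := (`]0, +oo[%classic : set R).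
Local Notation w := (primitive h).
Local Notation k := (fun x : R => x `^ (- alpha)).

Let mI : @measurable _ RR I. Proof. exact: measurable_itv. Qed.
Let mL : @measurable _ RR L. Proof. exact: measurable_itv. Qed.
Let mII : @measurable _ (RR * RR)%type (I `*` I). Proof. exact: measurableX. Qed.
Let hi : lebt.-integrable I (EFin \o h). Proof. exact: memL2_integrable. Qed.

Lemma integral_layer (c : R) : 0 <= c ->
  (\int[lebt]_(l in L) ((l < c)%R%:R)%:E = c%:E)%E.
Proof.
move=> c0; transitivity (\int[lebt]_(l in `]0%R, c[) (cst 1%:E l))%E.
  rewrite [LHS]integral_mkcond [RHS]integral_mkcond; apply: eq_integral => l _.
  rewrite !patchE; case: ifPn => [/set_mem|lL].
    rewrite /= in_itv /= andbT => l0; case: ifPn => [/set_mem|/negP nl].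
      by rewrite /= in_itv /= l0 => /= ->.
    case: ltP => // lc; exfalso; apply: nl; rewrite inE /= in_itv /= l0; exact: lc.
  case: ifPn => // /set_mem; rewrite /= in_itv /= => /andP[l0 _]; exfalso.
  by move/negP : lL; apply; rewrite inE /= in_itv /= l0.
rewrite integral_cst ?mul1e; last exact: measurable_itv.
by rewrite -[in RHS](subr0 c); exact: lebesgue_measure_oo.
Qed.

Let mlt (c : R) (D : set R) : measurable_fun D (fun l : RR => (l < c)%R%:R : R).
Proof.
rewrite (_ : (fun l => _) = \1_[set l : RR | l < c]); last first.
  by apply/funext => x; rewrite indicE; congr (_%:R); congr nat_of_bool; apply/idP/idP; rewrite inE.
apply: measurable_indic; have mt : measurable [set true] by [].
have := measurable_fun_ltr (@measurable_id _ RR setT) (measurable_cst c) measurableT mt.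
by rewrite setTI.
Qed.

Let kl (l x : R) : R := (l < k x)%R%:R.

Let mkl l : measurable_fun setT (kl l).
Proof.
rewrite /kl (_ : (fun x => _) = \1_[set x | l < k x]); last first.
  by apply/funext => x; rewrite indicE; congr (_%:R); congr nat_of_bool; apply/idP/idP; rewrite inE.
apply: measurable_indic; have mt : measurable [set true] by [].
have := measurable_fun_ltr (measurable_cst l) (@measurable_power R alpha) measurableT mt.
by rewrite setTI.
Qed.

(** The kernel is decreasing, with inverse [l^(-1/alpha)]: its superlevel sets are the intervals
    []0, r[], so each layer is a step kernel. *)
Lemma ltr_powN (l x : R) : 0 < l -> 0 < x -> (l < x `^ (- alpha)) = (x < l `^ (- alpha^-1)).
Proof.
move=> l0 x0; apply/idP/idP => lx; rewrite ltNge; apply/negP => h1.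
- have : l `^ (- alpha^-1) `^ (- alpha) >= x `^ (- alpha).
    rewrite !powRN lef_pV2 ?posrE ?powR_gt0 ?invr_gt0 ?powR_gt0// -powRN.
    by rewrite ge0_ler_powR ?nnegrE ?(ltW a0) ?powR_ge0// ltW.
  rewrite -powRrM mulrNN mulVf ?gt_eqF// powRr1 ?(ltW l0)//.
  by rewrite leNgt lx.
- have : x < l `^ (- alpha^-1) by [].
  have : (x `^ (- alpha)) `^ (- alpha^-1) >= l `^ (- alpha^-1).
    rewrite !powRN lef_pV2 ?posrE ?powR_gt0 ?invr_gt0 ?powR_gt0// -powRN.
    by rewrite ge0_ler_powR ?nnegrE ?invr_ge0 ?(ltW a0) ?powR_ge0// ltW.
  rewrite -powRrM mulrNN mulfV ?gt_eqF// powRr1 ?(ltW x0)//.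
  by rewrite leNgt => /negbTE ->.
Qed.

(* Layer-cake: [t^-alpha = \int_0^oo 1_{l < t^-alpha} dl] is a superposition of
   the step kernels [1_{t < r}], for which positivity is elementary. *)
Lemma frac_positivity :
  0 <= \int[lebt]_(t in I) ((T - t) * w t * \int[lebt]_(s in `]0, t[) ((t - s) `^ (- alpha) * h s)).
Proof.
have mk := @measurable_power R alpha.
have k0 x : 0 <= k x := powR_ge0 _ _.
have mh := memL2_meas mI hL; have mw := measurable_primitive hi.
pose g t := (T - t) * w t.
have gL : memL2 lebt I g.
  apply: (memL2_bounded (M := T) mI); last exact: memL2_primitive.
    by apply: measurable_funB.
  by move=> t; rewrite /= in_itv /= => /andP[t0 tT]; rewrite ger0_norm ?subr_ge0 ?(ltW tT)// gerBl ltW.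
have gi := memL2_integrable gL; have mg := memL2_meas mI gL.
have Kl t : 0 < t < T -> (\int[lebt]_(s in `]0%R, t[) (k (t - s))%:E <= (frac_const alpha T)%:E)%E.
  by move=> /andP[t0 tT]; apply: integral_power_left => //; rewrite t0 ltW.
have Kr s : 0 < s < T -> (\int[lebt]_(t in `]s, T[) (k (t - s))%:E <= (frac_const alpha T)%:E)%E.
  by move=> /andP[s0 sT]; apply: integral_power_right => //; rewrite ltW.
have [ti tlt] := integrable_tri_schur mk k0 Kl Kr gL hL.
have tci := integrable_tri_cst gi hi.
(* The level becomes a third variable. Integrating [|H|] over it restores the power kernel, so
   Schur's bound makes [H] integrable and allows the integral over the level to be taken last. *)
pose H (q : (RR * RR) * RR) : R := tri_kernel (kl q.2) g h q.1.
have HE q : H q = kl q.2 (q.1.1 - q.1.2) * tri_kernel (cst 1) g h q.1.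
  by rewrite /H /tri_kernel mul1r mulrCA.
have mkq : measurable_fun setT (fun q : (RR * RR) * RR => kl q.2 (q.1.1 - q.1.2)).
  rewrite /kl (_ : (fun x => _) = \1_[set q : (RR * RR) * RR | q.2 < k (q.1.1 - q.1.2)]); last first.
    by apply/funext => x; rewrite indicE; congr (_%:R); congr nat_of_bool; apply/idP/idP; rewrite inE.
  apply: measurable_indic; have mt : measurable [set true] by [].
  have mkd : measurable_fun setT (fun q : (RR * RR) * RR => k (q.1.1 - q.1.2)).
    apply: measurableT_comp mk _; apply: measurable_funB.
      by apply: (measurableT_comp (f := fst)) => //; exact: measurable_fst.
    by apply: (measurableT_comp (f := snd)) => //; exact: measurable_snd.
  have := measurable_fun_ltr (@measurable_snd _ _ (RR * RR)%type RR) mkd measurableT mt.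
  by rewrite setTI.
have mH : measurable_fun ((I `*` I) `*` L) H.
  rewrite (_ : H = fun q => kl q.2 (q.1.1 - q.1.2) * tri_kernel (cst 1) g h q.1); last by apply/funext => q; exact: HE.
  apply: measurable_funM; first exact: measurable_funS mkq.
  apply: (measurable_comp (F := I `*` I)) (integrable_real_meas tci) _ => //.
    by move=> _ [q [] ? ? <-].
  by apply: measurable_funS measurable_fst.
have HI p : (\int[lebt]_(l in L) `|(H (p, l))%:E| = `|(tri_kernel k g h p)%:E|)%E.
  transitivity (\int[lebt]_(l in L) (`|tri_kernel (cst 1) g h p|%:E * ((l < k (p.1 - p.2))%R%:R)%:E))%E.
    apply: eq_integral => l _; rewrite HE -EFinM /= normrM mulrC; congr ((_ * _)%:E).
    by rewrite /kl ger0_norm.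
  rewrite ge0_integralZl//; last by apply/measurable_EFinP; exact: mlt.
  rewrite integral_layer// -EFinM /=; congr EFin; rewrite -[X in _ * X]ger0_norm// -normrM.
  by rewrite /tri_kernel mul1r; congr (`|_|); ring.
have Hi : ((lebt \x lebt) \x lebt)%E.-integrable ((I `*` I) `*` L) (EFin \o H).
  apply/integrableP; split; first exact/measurable_EFinP.
  have mHn : measurable_fun ((I `*` I) `*` L) (fun q : (RR * RR) * RR => `|H q|) by exact: measurableT_comp.
  have := @tonelli1 _ _ (RR * RR)%type RR R (product_sigma lebt lebt) lebt _ _ mII mL _ mHn (fun q _ => normr_ge0 _).
  move=> E; rewrite [X in (X < _)%E]E (eq_integral (fun p : RR * RR => `|(tri_kernel k g h p)%:E|)%E).
    by apply: le_lt_trans tlt _; rewrite ltry.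
  by move=> p _; exact: HI.
have F1 := @Rintegral_fubini1 _ _ (RR * RR)%type RR R (product_sigma lebt lebt) lebt _ _ mII mL _ Hi.
have F2 := @Rintegral_fubini2 _ _ (RR * RR)%type RR R (product_sigma lebt lebt) lebt _ _ mII mL _ Hi.
have -> : \int[lebt]_(t in I) ((T - t) * w t * \int[lebt]_(s in `]0, t[) ((t - s) `^ (- alpha) * h s)) =
    \int[(lebt \x lebt)%E]_(p in I `*` I) tri_kernel k g h p.
  rewrite (Rintegral_fubini1 mI mI ti); apply: eq_Rintegral => t; rewrite inE => It.
  by rewrite Rintegral_tri_fst.
have -> : \int[(lebt \x lebt)%E]_(p in I `*` I) tri_kernel k g h p =
    \int[(lebt \x lebt)%E]_(p in I `*` I) \int[lebt]_(l in L) H (p, l).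
  apply: eq_Rintegral => p _; transitivity (\int[lebt]_(l in L) (tri_kernel (cst 1) g h p * kl l (p.1 - p.2))).
    rewrite RintegralZl_measurable//.
      rewrite (_ : \int[_]_(_ in _) _ = k (p.1 - p.2)).
        by rewrite /tri_kernel mul1r; ring.
      by rewrite /Rintegral integral_layer.
    exact: mlt.
  by apply: eq_Rintegral => l _; rewrite HE mulrC.
rewrite -F1 F2; apply: Rintegral_ge0 => l; rewrite /= in_itv /= andbT => l0.
have tli : (lebt \x lebt)%E.-integrable (I `*` I) (EFin \o tri_kernel (kl l) g h).
  apply: (integrable_le_real mII (g := fun p => `|tri_kernel (cst 1) g h p|)).
  - exact: measurable_tri_kernel.
  - move=> p _; have := HE (p, l); rewrite /H /= => ->; rewrite normrM ler_piMl// /kl.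
    by case: (_ < _); rewrite ?normr1 ?normr0.
  - exact: integrable_norm tci.
rewrite /H /= (Rintegral_fubini1 mI mI tli).
rewrite (@eq_Rintegral _ _ _ lebt _ (fun t => (T - t) * w t * \int[lebt]_(s in `]0, t[) (kl l (t - s) * h s))).
  apply: (step_kernel_ge0 T0 hL (r := l `^ (- alpha^-1))) => //; first exact: powR_gt0.
  by move=> x /andP[x0 xT]; rewrite /kl ltr_powN.
by move=> t; rewrite inE => It; rewrite Rintegral_tri_fst.
Qed.

End layer_cake.

Lemma ae_mono2 d (X : sigmaRingType d) (R : realType) (mu : {measure set X -> \bar R})
    (P Q S : X -> Prop) : (forall x, P x -> Q x -> S x) ->
  {ae mu, forall x, P x} -> {ae mu, forall x, Q x} -> {ae mu, forall x, S x}.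
Proof. by move=> PQS; exact: filterS2. Qed.

Lemma ae_conj d (X : sigmaRingType d) (R : realType) (mu : {measure set X -> \bar R})
    (D P Q : X -> Prop) : {ae mu, forall x, D x -> P x} -> {ae mu, forall x, D x -> Q x} ->
  {ae mu, forall x, D x -> P x /\ Q x}.
Proof. by apply: ae_mono2 => x p q Dx; split; [exact: p|exact: q]. Qed.

Lemma le_abs_Rintegral d (X : measurableType d) (R : realType) (mu : {measure set X -> \bar R})
    (D : set X) (f : X -> R) : measurable D -> measurable_fun D f ->
  (`|\int[mu]_(x in D) f x|%:E <= \int[mu]_(x in D) `|f x|%:E)%E.
Proof.
move=> mD /measurable_EFinP mf; apply: le_trans (le_abse_integral mu mD mf).
by rewrite /Rintegral; case: (integral _ _ _) => [r| |] //=; rewrite normr0 leey.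
Qed.

(** * The fractional integral and its transpose at a fixed point of space *)

Section frac_scalar.
Context {R : realType}.
Local Notation lebt := (@lebesgue_measure R).
Local Notation RR := (measurableTypeR R).
Variables (T alpha : R).
Hypotheses (T0 : 0 < T) (a0 : 0 < alpha) (a1 : alpha < 1).
Local Notation I := (`]0, T[%classic : set R).
Local Notation k := (fun x : R => x `^ (- alpha)).
Implicit Types g h v : R -> R.

Let mI : @measurable _ RR I. Proof. exact: measurable_itv. Qed.
Let mII : @measurable _ (RR * RR)%type (I `*` I). Proof. exact: measurableX. Qed.
Let mk : measurable_fun setT k. Proof. exact: measurable_power. Qed.
Let k0 x : 0 <= k x. Proof. exact: powR_ge0. Qed.

Let Kl t : 0 < t < T -> (\int[lebt]_(s in `]0%R, t[) (k (t - s))%:E <= (frac_const alpha T)%:E)%E.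
Proof. by move=> /andP[t0 tT]; apply: integral_power_left => //; rewrite t0 ltW. Qed.

Let Kr s : 0 < s < T -> (\int[lebt]_(t in `]s, T[) (k (t - s))%:E <= (frac_const alpha T)%:E)%E.
Proof. by move=> /andP[s0 sT]; apply: integral_power_right => //; rewrite ltW. Qed.

Definition frac_conv h (t : R) := \int[lebt]_(s in `]0, t[) ((t - s) `^ (- alpha) * h s).

Lemma frac_intE h t : frac_int alpha h t = (Gamma (1 - alpha))^-1 * frac_conv h t.
Proof. by []. Qed.

Lemma Gamma_ge0 (z : R) : 0 <= Gamma z.
Proof. by apply: Rintegral_ge0 => s _; rewrite mulr_ge0 ?powR_ge0 ?expR_ge0. Qed.

Lemma back_frac_intE v s : back_frac_int T alpha v s =
  (Gamma (1 - alpha))^-1 * \int[lebt]_(t in `]s, T[) ((t - s) `^ (- alpha) * v t).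
Proof.
by congr (_ * _); apply: eq_Rintegral => t _; rewrite powRN mulrC.
Qed.

Lemma integrable_mul_frac g h : memL2 lebt I g -> memL2 lebt I h ->
  lebt.-integrable I (EFin \o (fun t => g t * frac_conv h t)).
Proof.
move=> gL hL; have [ti _] := integrable_tri_schur mk k0 Kl Kr gL hL.
exact: (integrable_tri_fst mk (memL2_meas mI hL) ti).
Qed.

Lemma mul_frac_le g h : memL2 lebt I g -> memL2 lebt I h ->
  (\int[lebt]_(t in I) `|(g t * frac_conv h t)%:E| <=
   (frac_const alpha T * (\int[lebt]_(t in I) (g t ^+ 2) + \int[lebt]_(t in I) (h t ^+ 2)))%:E)%E.
Proof.
move=> gL hL; have [ti tb] := integrable_tri_schur mk k0 Kl Kr gL hL.
have mt := integrable_real_meas ti; have mh := memL2_meas mI hL.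
have mtn : measurable_fun (I `*` I) (fun p : RR * RR => `|tri_kernel k g h p|).
  exact: measurableT_comp.
apply: le_trans tb.
have E := tonelli1 lebt lebt mI mI mtn (fun p _ => normr_ge0 _).
rewrite [X in (_ <= X)%E]E; apply: ge0_le_integral => //.
- apply/measurable_EFinP; apply: measurableT_comp => //.
  exact: integrable_real_meas (integrable_mul_frac gL hL).
- exact: (measurable_tonelli1 lebt mI mI mtn (fun p _ => normr_ge0 _)).
move=> t It; have mt1 := measurable_section1 mI mI mt It.
rewrite /frac_conv -(Rintegral_tri_fst mk g mh It).
exact: le_abs_Rintegral.
Qed.

(** From Schur's test against the constant 1. Convergence at almost every [t] only is the reason why
    [ae_frac_convB] is an almost everywhere identity. *)
Lemma ae_integrable_frac h : memL2 lebt I h ->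
  {ae lebt, forall t, I t -> lebt.-integrable `]0, t[ (EFin \o (fun s => (t - s) `^ (- alpha) * h s))}.
Proof.
move=> hL; have gL : memL2 lebt I (cst 1).
  by apply: (memL2_bounded_fun (M := 1)) => // t _; rewrite normr1.
have [ti _] := integrable_tri_schur mk k0 Kl Kr gL hL.
apply: ae_mono (ae_integrable_section1 mI mI ti) => t + It => /(_ It) tti.
have sub : `]0, t[ `<=` I by apply: subset_itvl; rewrite bnd_simp; move: It; rewrite /= in_itv /= => /andP[_ /ltW].
have : lebt.-integrable `]0, t[ (fun s => (tri_kernel k (cst 1) h (t, s))%:E).
  exact: (@integrableS _ RR _ lebt I `]0, t[%classic _ mI (measurable_itv _) sub tti).
apply: eq_integrable; first exact: measurable_itv.
by move=> s st; rewrite /tri_kernel indicE st !mul1r.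
Qed.

Lemma ae_frac_convB h1 h2 : memL2 lebt I h1 -> memL2 lebt I h2 ->
  {ae lebt, forall t, I t -> frac_conv (fun s => h1 s - h2 s) t = frac_conv h1 t - frac_conv h2 t}.
Proof.
move=> /ae_integrable_frac h1i /ae_integrable_frac h2i.
apply: ae_mono2 h1i h2i => t h1t h2t It.
have mt : @measurable _ RR `]0, t[%classic by exact: measurable_itv.
rewrite /frac_conv -(RintegralB mt (h1t It) (h2t It)).
by apply: eq_Rintegral => s _; rewrite mulrBr.
Qed.

Lemma Rintegral_mul_frac g h : memL2 lebt I g -> memL2 lebt I h ->
  \int[lebt]_(t in I) (g t * frac_conv h t) =
  \int[lebt]_(s in I) (h s * \int[lebt]_(t in `]s, T[) ((t - s) `^ (- alpha) * g t)).
Proof.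
move=> gL hL; have [ti _] := integrable_tri_schur mk k0 Kl Kr gL hL.
exact: (Rintegral_triangle mk (memL2_meas mI gL) (memL2_meas mI hL) ti).
Qed.

(** The exchange of order moves the kernel from [h] to [g], where it forms the backward integral;
    this is a primitive vanishing at [T], and integration by parts applies. *)
Lemma Rintegral_frac_by_parts g h m : memL2 lebt I g -> memL2 lebt I h -> memL2 lebt I m ->
  measurable_fun I (back_frac_int T alpha g) ->
  {ae lebt, forall t, I t -> back_frac_int T alpha g t = - \int[lebt]_(s in `]t, T[) m s} ->
  \int[lebt]_(t in I) (g t * frac_int alpha h t) = - \int[lebt]_(t in I) (m t * primitive h t).
Proof.
move=> gL hL mL mb bE; have [hi mi] := (memL2_integrable hL, memL2_integrable mL).
rewrite -(integration_by_parts_ae hi mi mb bE); pose G := (Gamma (1 - alpha))^-1.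
transitivity (\int[lebt]_(t in I) (G * (g t * frac_conv h t))).
  by apply: eq_Rintegral => t _; rewrite frac_intE mulrCA.
rewrite RintegralZl_measurable//; last exact: integrable_real_meas (integrable_mul_frac gL hL).
have [ti _] := integrable_tri_schur mk k0 Kl Kr gL hL.
have mg := memL2_meas mI gL.
have : measurable_fun I (fun s => h s * \int[lebt]_(t in `]s, T[) ((t - s) `^ (- alpha) * g t)).
  have := integrable_real_meas (integrable_Rintegral2 mI mI ti).
  by apply: eq_measurable_fun => s; rewrite inE => Is; rewrite (Rintegral_tri_snd mk h mg Is).
move=> /(@RintegralZl_measurable _ RR _ lebt I mI _ G); rewrite (Rintegral_mul_frac gL hL) => <-.
by apply: eq_Rintegral => t _; rewrite back_frac_intE mulrCA.
Qed.

End frac_scalar.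

Section scalar.
Context {R : realType}.
Local Notation lebt := (@lebesgue_measure R).
Local Notation RR := (measurableTypeR R).
Variables (T : R).
Hypothesis T0 : 0 < T.
Local Notation I := (`]0, T[%classic : set R).
Implicit Types g h v y m : R -> R.

Let mI : @measurable _ RR I. Proof. exact: measurable_itv. Qed.

Lemma sqr_Rintegral_le (a b : R) h : a <= b -> `]a, b[ `<=` I -> memL2 lebt I h ->
  (\int[lebt]_(s in `]a, b[) h s) ^+ 2 <= (b - a) * \int[lebt]_(s in I) (h s ^+ 2).
Proof.
move=> ab abI hL; have mJ : @measurable _ RR `]a, b[%classic by exact: measurable_itv.
have h2 := memL2_sqr mI hL.
have h2J : lebt.-integrable `]a, b[ (EFin \o (fun s => h s ^+ 2)).
  exact: (@integrableS _ RR _ lebt I _ _ mI mJ abI h2).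
have hJ : memL2 lebt `]a, b[ h.
  apply/(memL2P _ mJ); split=> //; exact: measurable_funS (memL2_meas mI hL).
have c1 : lebt.-integrable `]a, b[ (EFin \o (fun=> 1 : R)).
  apply: (measurable_bounded_integrable mJ) => //; first exact: lebesgue_measure_oo_lty.
  by exists 1; split; [exact: num_real|move=> M M1 t _; rewrite normr1 ltW].
have oneJ : memL2 lebt `]a, b[ (fun=> 1 : R).
  by apply/(memL2P _ mJ); split=> //; apply: eq_integrable c1 => // s _ /=; rewrite expr1n.
have CS := cauchy_schwarz mJ oneJ hJ.
have {CS} : `|\int[lebt]_(s in `]a, b[) (1 * h s)| ^+ 2 <=
    (normL2 lebt `]a, b[ (fun=> 1) * normL2 lebt `]a, b[ h) ^+ 2.
  by rewrite lerXn2r ?nnegrE ?mulr_ge0 ?normL2_ge0.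
rewrite exprMn !normL2_sqr real_normK ?num_real//.
rewrite (@eq_Rintegral _ _ _ lebt _ h) => [|s _]; last by rewrite mul1r.
move=> H; apply: (le_trans H).
rewrite (@eq_Rintegral _ _ _ lebt _ (fun=> 1)) => [|s _]; last by rewrite expr1n.
rewrite Rintegral_cst_oo// mul1r; apply: ler_wpM2l; first by rewrite subr_ge0.
by apply: le_Rintegral_subset => // s _; exact: sqr_ge0.
Qed.

(** From [C^2 <= 2 y^2 + 2 (y - C)^2], integrated over []a, b[]. *)
Lemma const_avg_le (a b C H : R) y : a < b -> `]a, b[ `<=` I -> memL2 lebt I y -> 0 <= H ->
  {ae lebt, forall t, `]a, b[%classic t -> (y t - C) ^+ 2 <= (b - a) * H} ->
  (b - a) * C ^+ 2 <= 2 * \int[lebt]_(t in `]a, b[) (y t ^+ 2) + 2 * (b - a) ^+ 2 * H.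
Proof.
move=> ab abI yL H0 yC; have mJ : @measurable _ RR `]a, b[%classic by exact: measurable_itv.
have y2 : lebt.-integrable `]a, b[ (EFin \o (fun s => y s ^+ 2)).
  exact: (@integrableS _ RR _ lebt I _ _ mI mJ abI (memL2_sqr mI yL)).
have ci (c : R) : lebt.-integrable `]a, b[ (EFin \o (fun=> c)).
  apply: (measurable_bounded_integrable mJ) => //; first exact: lebesgue_measure_oo_lty.
  by exists `|c|; split; [exact: num_real|move=> M M1 t _; rewrite ltW].
pose f t := 2 * y t ^+ 2 + 2 * ((b - a) * H).
have fi : lebt.-integrable `]a, b[ (EFin \o f).
  by apply: (integrableD_real mJ) (ci _); exact: integrableZ_real.
have -> : (b - a) * C ^+ 2 = \int[lebt]_(t in `]a, b[) (C ^+ 2).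
  by rewrite Rintegral_cst_oo ?(ltW ab)// mulrC.
have -> : 2 * \int[lebt]_(t in `]a, b[) (y t ^+ 2) + 2 * (b - a) ^+ 2 * H = \int[lebt]_(t in `]a, b[) f t.
  rewrite RintegralD//; last exact: integrableZ_real.
  by rewrite RintegralZl// Rintegral_cst_oo ?(ltW ab)//; ring.
(* The lower bound on [f] holds only almost everywhere; the maximum has the same integral and
   satisfies it everywhere. *)
pose f' t := Num.max (f t) (C ^+ 2).
have f'E : \int[lebt]_(t in `]a, b[) f t = \int[lebt]_(t in `]a, b[) f' t.
  apply: (ae_eq_Rintegral mJ); first exact: integrable_real_meas fi.
    by apply: measurable_maxr => //; exact: integrable_real_meas fi.
  apply: ae_mono yC => t + Jt => /(_ Jt) yt; rewrite /f' max_l// /f.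
  by have := sqr_ge0 (2 * y t - C); nra.
rewrite f'E; apply: le_Rintegral => //; last by move=> t _; rewrite /f' le_max lexx orbT.
apply: (ae_integrable_real mJ _ _ fi).
  by apply: measurable_maxr => //; exact: integrable_real_meas fi.
apply: ae_mono yC => t + Jt => /(_ Jt) yt; rewrite /f' max_l// /f.
by have := sqr_ge0 (2 * y t - C); nra.
Qed.

(** On []0, e[] the square of the primitive is at most [e] times the energy of [h]. After division
    by [e], small [e] bounds the constant by averages of [y] near time 0. *)
Lemma const_left_le (C e : R) y h : 0 < e <= T -> memL2 lebt I y -> memL2 lebt I h ->
  {ae lebt, forall t, I t -> y t = C + primitive h t} ->
  e * C ^+ 2 <= 2 * \int[lebt]_(t in `]0, e[) (y t ^+ 2) +
    2 * e ^+ 2 * \int[lebt]_(t in I) (h t ^+ 2).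
Proof.
move=> /andP[e0 eT] yL hL yE; have sub : `]0, e[ `<=` I by apply: subset_itvl; rewrite bnd_simp.
have H0 : 0 <= \int[lebt]_(t in I) (h t ^+ 2) by apply: Rintegral_ge0 => t _; exact: sqr_ge0.
rewrite -{1 3}(subr0 e); apply: const_avg_le => //.
apply: ae_mono yE => t + Jt => /(_ (sub _ Jt)) ->; rewrite addrAC subrr add0r subr0.
move: Jt; rewrite /= in_itv /= => /andP[t0 te].
have sub' : `]0, t[ `<=` I by apply: subset_itvl; rewrite bnd_simp (le_trans (ltW te)).
apply: le_trans (sqr_Rintegral_le (ltW t0) sub' hL) _.
by rewrite subr0 ler_wpM2r// ltW.
Qed.

Lemma const_right_le (C e : R) y h : 0 < e <= T -> memL2 lebt I y -> memL2 lebt I h ->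
  {ae lebt, forall t, I t -> y t = C - \int[lebt]_(s in `]t, T[) h s} ->
  e * C ^+ 2 <= 2 * \int[lebt]_(t in `]T - e, T[) (y t ^+ 2) +
    2 * e ^+ 2 * \int[lebt]_(t in I) (h t ^+ 2).
Proof.
move=> /andP[e0 eT] yL hL yE.
have sub : `]T - e, T[ `<=` I by apply: subset_itvr; rewrite bnd_simp subr_ge0.
have H0 : 0 <= \int[lebt]_(t in I) (h t ^+ 2) by apply: Rintegral_ge0 => t _; exact: sqr_ge0.
have eE : e = T - (T - e) by rewrite subKr.
rewrite {1 3}eE; apply: const_avg_le => //; first by rewrite ltrBlDr ltrDl.
apply: ae_mono yE => t + Jt => /(_ (sub _ Jt)) ->; rewrite addrAC subrr add0r sqrrN -eE.
move: Jt; rewrite /= in_itv /= => /andP[te tT].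
have t0 : 0 <= t by rewrite (le_trans _ (ltW te))// subr_ge0.
have sub' : `]t, T[ `<=` I by apply: subset_itvr; rewrite bnd_simp.
apply: le_trans (sqr_Rintegral_le (ltW tT) sub' hL) _.
by rewrite ler_wpM2r// lerBlDr -lerBlDl ltW.
Qed.

Variable alpha : R.
Hypotheses (a0 : 0 < alpha) (a1 : alpha < 1).

(** Being a primitive, [v] is bounded, so its backward integral is at most a multiple of
    [(T - t)^(1 - alpha)] and tends to 0 at [T]. Averages over a short final interval then force the
    constant to vanish. *)
Lemma back_frac_const (C : R) v m n : memL2 lebt I v -> memL2 lebt I m -> memL2 lebt I n ->
  {ae lebt, forall t, I t -> v t = - \int[lebt]_(s in `]t, T[) m s} ->
  memL2 lebt I (back_frac_int T alpha v) ->
  {ae lebt, forall t, I t -> back_frac_int T alpha v t = C - \int[lebt]_(s in `]t, T[) n s} ->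
  C = 0.
Proof.
move=> vL mL nL vE zL zE; have mi := memL2_integrable mL.
pose N := \int[lebt]_(s in I) `|m s|.
have N0 : 0 <= N by apply: Rintegral_ge0.
have vN : {ae lebt, forall t, I t -> `|v t| <= N}.
  apply: ae_mono vE => t + It => /(_ It) ->; rewrite normrN.
  have mJ : @measurable _ RR `]t, T[%classic by exact: measurable_itv.
  have sub : `]t, T[ `<=` I by apply: subset_itvr; rewrite bnd_simp; move: It; rewrite /= in_itv /= => /andP[/ltW].
  have mJi := @integrableS _ RR _ lebt I _ _ mI mJ sub mi.
  apply: le_trans (le_normr_Rintegral mJ mJi) _.
  apply: le_Rintegral_subset => //; first exact: integrable_norm mJi.
  exact: integrable_norm mi.
pose G := (Gamma (1 - alpha))^-1; have G0 : 0 <= G by rewrite invr_ge0 Gamma_ge0.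
have a1' : 0 < 1 - alpha by rewrite subr_gt0.
have zb t : I t -> `|back_frac_int T alpha v t| <= G * (N * ((T - t) `^ (1 - alpha) / (1 - alpha))).
  move=> It; rewrite back_frac_intE normrM (ger0_norm G0) ler_wpM2l//.
  have mJ : @measurable _ RR `]t, T[%classic by exact: measurable_itv.
  have tT : t < T by move: It; rewrite /= in_itv /= => /andP[].
  have sub : `]t, T[ `<=` I by apply: subset_itvr; rewrite bnd_simp; move: It; rewrite /= in_itv /= => /andP[/ltW].
  have mv : measurable_fun `]t, T[ v by exact: measurable_funS (memL2_meas mI vL).
  have mp : measurable_fun `]t, T[ (fun s => (s - t) `^ (- alpha)).
    apply: (@measurable_funS _ _ _ _ setT) => //.
    by apply: measurableT_comp (@measurable_power R alpha) _; exact: measurable_funB.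
  have mf : measurable_fun `]t, T[ (fun s => (s - t) `^ (- alpha) * v s) := measurable_funM mp mv.
  rewrite -lee_fin; apply: (le_trans (le_abs_Rintegral lebt mJ mf)).
  apply: (@le_trans _ _ (\int[lebt]_(s in `]t, T[) (N%:E * ((s - t) `^ (- alpha))%:E))%E).
    apply: ae_ge0_le_integral => //.
    - by apply/measurable_EFinP; exact: measurableT_comp.
    - by move=> s _; rewrite mule_ge0// lee_fin// powR_ge0.
    - by apply: emeasurable_funM => //; exact/measurable_EFinP.
    - apply: ae_mono vN => s + Js => /(_ (sub _ Js)) vs.
      by rewrite -EFinM lee_fin normrM (ger0_norm (powR_ge0 _ _)) mulrC ler_wpM2r// powR_ge0.
  rewrite ge0_integralZl//; last 2 first.
  - exact/measurable_EFinP.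
  - by move=> s _; rewrite lee_fin powR_ge0.
  rewrite EFinM; apply: lee_wpmul2l; first by rewrite lee_fin.
  exact: integral_power_tail.
have z2i := memL2_sqr mI zL.
pose H := \int[lebt]_(t in I) (n t ^+ 2).
have H0 : 0 <= H by apply: Rintegral_ge0 => t _; exact: sqr_ge0.
pose A := G * (N * (T `^ (1 - alpha) / (1 - alpha))).
have A0 : 0 <= A by rewrite !mulr_ge0// ?powR_ge0// invr_ge0 ltW.
have key e : 0 < e <= 1 -> C ^+ 2 <= (2 * A ^+ 2 + 2 * T * H) * e.
  (* The length of the final interval, chosen so that [d^(1 - alpha) = T^(1 - alpha) e]: the
     backward integral is at most [A e] there, and moreover [d <= T e]. *)
  move=> /andP[e0 e1]; pose d := T * e `^ (1 - alpha)^-1.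
  have ee : e `^ (1 - alpha)^-1 <= e.
    rewrite -[leRHS]powRr1 ?(ltW e0)//; apply: ger_powR; first by rewrite e0.
    by rewrite -[leLHS]invr1 lef_pV2 ?posrE// gerBl ltW.
  have d0 : 0 < d by rewrite mulr_gt0// powR_gt0.
  have dT : d <= T by rewrite ger_pMr// (le_trans ee).
  have dE : d `^ (1 - alpha) = T `^ (1 - alpha) * e.
    by rewrite powRM ?(ltW T0) ?powR_ge0// -powRrM mulVf ?gt_eqF// powRr1 ?(ltW e0).
  have dT' : 0 < d <= T by rewrite d0.
  have := const_right_le dT' zL nL zE; rewrite -/H.
  have mJ : @measurable _ RR `](T - d), T[%classic by exact: measurable_itv.
  have sub : `](T - d), T[ `<=` I by apply: subset_itvr; rewrite bnd_simp subr_ge0.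
  have zz : \int[lebt]_(t in `]T - d, T[) (back_frac_int T alpha v t ^+ 2) <= (A * e) ^+ 2 * d.
    rewrite -[X in _ * X](_ : T - (T - d) = d); last by rewrite subKr.
    rewrite -Rintegral_cst_oo; last by rewrite gerBl ltW.
    apply: le_Rintegral => //.
    - exact: (@integrableS _ RR _ lebt I _ _ mI mJ sub z2i).
    - apply: (measurable_bounded_integrable mJ) => //; first exact: lebesgue_measure_oo_lty.
      by exists `|(A * e) ^+ 2|; split; [exact: num_real|move=> M M1 t _; rewrite ltW].
    - move=> t Jt; rewrite -(real_normK (num_real (back_frac_int T alpha v t))).
      have Ae : 0 <= A * e by rewrite mulr_ge0// ltW.
      rewrite lerXn2r ?nnegrE//.
      apply: le_trans (zb _ (sub _ Jt)) _; rewrite /A -!mulrA ler_wpM2l// ler_wpM2l//.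
      rewrite [leRHS]mulrCA [leRHS]mulrC -dE ler_wpM2r ?invr_ge0 ?(ltW a1')//.
      move: Jt; rewrite /= in_itv /= => /andP[Tdt tT].
      by rewrite ge0_ler_powR ?nnegrE ?(ltW a1') ?subr_ge0 ?(ltW tT) ?(ltW d0)// lerBlDr -lerBlDl ltW.
  move: (\int[lebt]_(t in `]T - d, T[) _) zz => Z zz key.
  have {}key : d * C ^+ 2 <= d * (2 * (A * e) ^+ 2 + 2 * d * H).
    apply: le_trans key _; rewrite (_ : d * _ = 2 * ((A * e) ^+ 2 * d) + 2 * d ^+ 2 * H); last by ring.
    by rewrite lerD2r ler_wpM2l.
  rewrite ler_pM2l// in key; apply: le_trans key _.
  rewrite [leRHS]mulrDl lerD//.
    by rewrite exprMn -[leRHS]mulrA; do 2 (apply: ler_wpM2l; rewrite ?sqr_ge0//); rewrite expr2 ger_pMl.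
  by rewrite [leRHS]mulrAC ler_wpM2r// -[leRHS]mulrA ler_wpM2l// ler_wpM2l ?(ltW T0).
apply/eqP; rewrite -sqrf_eq0; apply: contraT => C0.
have C2 : 0 < C ^+ 2 by rewrite lt_def C0 sqr_ge0.
set B := 2 * A ^+ 2 + 2 * T * H in key.
have B0 : 0 <= B by have T0' := ltW T0; apply: addr_ge0; apply: mulr_ge0; rewrite ?sqr_ge0 ?mulr_ge0.
(* Small enough for [B e <= C^2 / 2], which contradicts [C^2 <= B e]. *)
pose e := Num.min 1 (C ^+ 2 / (2 * (B + 1))).
have e01 : 0 < e <= 1.
  have r0 : 0 < C ^+ 2 / (2 * (B + 1)) by apply: divr_gt0 => //; apply: mulr_gt0 => //; exact: ltr_pwDr.
  by rewrite lt_min ltr01 r0 /= ge_min lexx.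
have eB : B * e <= C ^+ 2 / 2.
  apply: (@le_trans _ _ (B * (C ^+ 2 / (2 * (B + 1))))).
    by rewrite ler_wpM2l// ge_min lexx orbT.
  have B1 : 0 < B + 1 by exact: ltr_pwDr.
  rewrite invfM [leLHS]mulrCA ler_wpM2l ?(ltW C2)// mulrCA ger_pMr ?invr_gt0//.
  by rewrite ler_pdivrMr// mul1r lerDl.
have := le_trans (key e e01) eB; rewrite ler_pdivlMr// ger_pMr//.
by rewrite leNgt ltr1n.
Qed.

(** [primitive h] vanishes at 0, while [v] and its backward integral are primitives vanishing at
    [T]: both terms integrate by parts without boundary contributions, and [- m - q n] is the
    adjoint time operator applied to [v]. *)
Lemma scalar_duality (q : R) h v m n : memL2 lebt I h -> memL2 lebt I v -> memL2 lebt I m ->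
  memL2 lebt I n ->
  {ae lebt, forall t, I t -> v t = - \int[lebt]_(s in `]t, T[) m s} ->
  measurable_fun I (back_frac_int T alpha v) ->
  {ae lebt, forall t, I t -> back_frac_int T alpha v t = - \int[lebt]_(s in `]t, T[) n s} ->
  \int[lebt]_(t in I) ((h t + q * frac_int alpha h t) * v t) =
  \int[lebt]_(t in I) (primitive h t * (- m t - q * n t)).
Proof.
move=> hL vL mL nL vE mz zE.
have [hi vi] := (memL2_integrable hL, memL2_integrable vL).
have [mi ni] := (memL2_integrable mL, memL2_integrable nL).
have hvi := memL2_mul mI hL vL.
have fvi : lebt.-integrable I (EFin \o (fun t => v t * frac_int alpha h t)).
  have := integrableZ_real mI (Gamma (1 - alpha))^-1 (integrable_mul_frac a1 vL hL).
  by apply: eq_integrable => // t _; rewrite /= frac_intE mulrCA.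
have E1 := integration_by_parts_ae hi mi (memL2_meas mI vL) vE.
have E2 := Rintegral_frac_by_parts a1 vL hL nL mz zE.
transitivity (\int[lebt]_(t in I) (h t * v t + q * (v t * frac_int alpha h t))).
  by apply: eq_Rintegral => t _; rewrite mulrDl -mulrA [frac_int _ _ _ * _]mulrC.
rewrite RintegralD//; last exact: integrableZ_real.
rewrite (RintegralZl _ mI fvi) E1 E2.
have pmi := integrable_mul_primitive mi hi.
have pni := integrable_mul_primitive ni hi.
transitivity (\int[lebt]_(t in I) ((-1) * (m t * primitive h t) + (- q) * (n t * primitive h t))).
  rewrite RintegralD//; try exact: integrableZ_real.
  by rewrite (RintegralZl _ mI pmi) (RintegralZl _ mI pni) mulN1r mulrN mulNr.
by apply: eq_Rintegral => t _; ring.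
Qed.

(** The first-order term gives the left-hand side exactly, and the fractional term is nonnegative by
    [frac_positivity]. *)
Lemma scalar_energy (q : R) h : 0 <= q -> memL2 lebt I h ->
  2^-1 * \int[lebt]_(t in I) (primitive h t ^+ 2) <=
  \int[lebt]_(t in I) ((T - t) * ((h t + q * frac_int alpha h t) * primitive h t)).
Proof.
move=> q0 hL; have hi := memL2_integrable hL; have pL := memL2_primitive hi.
have mT : measurable_fun I (fun t : R => T - t) by exact: measurable_funB.
have bT t : I t -> `|T - t| <= T.
  by rewrite /= in_itv /= => /andP[t0 tT]; rewrite ger0_norm ?subr_ge0 ?(ltW tT)// gerBl ltW.
have gL : memL2 lebt I (fun t => (T - t) * primitive h t) := memL2_bounded mI mT bT pL.
have i1 : lebt.-integrable I (EFin \o (fun t => (T - t) * (h t * primitive h t))).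
  have := memL2_mul mI gL hL; apply: eq_integrable => // t _; congr EFin => /=; ring.
have i2 := integrable_mul_frac a1 gL hL.
pose G := (Gamma (1 - alpha))^-1; have G0 : 0 <= G by rewrite invr_ge0 Gamma_ge0.
rewrite -(Rintegral_energy T0 hL).
rewrite [leRHS](_ : _ = \int[lebt]_(t in I) ((T - t) * (h t * primitive h t)) +
  q * G * \int[lebt]_(t in I) ((T - t) * primitive h t * frac_conv alpha h t)).
  by rewrite lerDl !mulr_ge0//; exact: frac_positivity.
rewrite -(RintegralZl _ mI i2) -RintegralD//; last exact: integrableZ_real.
by apply: eq_Rintegral => t _; rewrite frac_intE -/G; ring.
Qed.

End scalar.

(** * Tensor products and Bernstein approximation *)

Lemma is_derive_line (R : realType) (V : normedModType R) (h : V -> R) (x v : V) (k : R) :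
  is_derive (0 : R) (1 : R) (fun t : R => h (t *: v + x)) k <-> is_derive x v h k.
Proof.
have e : (fun s : R => s^-1 *: (((fun t : R => h (t *: v + x)) \o shift (0 : R)) (s *: (1 : R)) -
    (fun t : R => h (t *: v + x)) 0)) =
  (fun s : R => s^-1 *: ((h \o shift x) (s *: v) - h x)).
  by apply/funext => s /=; rewrite addr0 [s *: 1]mulr1 scale0r add0r.
by split=> -[D1 D2]; split; move: D1 D2; rewrite /derivable /derive e.
Qed.

Section tensor.
Context {R : realType} {d : nat}.
Notation E := 'rV[R]_d.
Implicit Types (x y : E) (f g : 'I_d -> R -> R).
Local Notation ei i := (delta_mx ord0 i : E).

Lemma nbhs_box x (U : set E) : nbhs x U <->
  exists2 e : R, 0 < e & forall y, (forall j, `|y ord0 j - x ord0 j| < e) -> U y.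
Proof.
split=> [/nbhs_ballP[e /= e0 eU]|[e e0 eU]].
  exists e => // y yx; apply: eU; rewrite /ball /= /mx_ball.
  by split=> // i j; rewrite ord1 /ball /= distrC.
apply/nbhs_ballP; exists e => //= y; rewrite /ball /= => -[_ yx].
by apply: eU => j; have := yx ord0 j; rewrite /ball /= distrC.
Qed.

Lemma continuous_coord (i : 'I_d) : continuous (fun x : E => x ord0 i).
Proof. exact: coord_continuous. Qed.

Lemma line_coord (i j : 'I_d) (t : R) x :
  (t *: ei i + x) ord0 j = if j == i then t + x ord0 j else x ord0 j.
Proof. by rewrite !mxE eqxx /=; case: eqP => _; rewrite ?mulr1 ?mulr0 ?add0r. Qed.

Definition tens f x : R := \prod_(j < d) f j (x ord0 j).

Definition dtens f (i : 'I_d) : 'I_d -> R -> R :=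
  fun j => if j == i then derive1 (f i) else f j.

Lemma is_derive_tens i f x k : is_derive (x ord0 i) (1 : R) (f i) k ->
  is_derive x (ei i) (tens f) (k * \prod_(j < d | j != i) f j (x ord0 j)).
Proof.
move=> fk; apply/is_derive_line; set P := \prod_(j < d | _) _.
rewrite (_ : (fun t : R => _) = (fun t : R => f i (t + x ord0 i) * P)); last first.
  apply/funext => t; rewrite /tens (bigD1 i)//= line_coord eqxx; congr (_ * _).
  by apply: eq_bigr => j /negPf ji; rewrite line_coord ji.
have h : is_derive (0 : R) (1 : R) (fun t : R => f i (t + x ord0 i)) k.
  have := (@is_derive_line R R (f i) (x ord0 i) 1 k).2 fk.
  by under eq_fun do rewrite [_ *: _]mulr1.
have := is_deriveZ P h; rewrite (_ : P \*: _ = fun t : R => f i (t + x ord0 i) * P).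
  by move=> {}h; apply: is_derive_eq h _; rewrite [P *: k]mulrC.
by apply/funext => t /=; rewrite [_ *: _]mulrC.
Qed.

Lemma tens_dtens f i x :
  tens (dtens f i) x = derive1 (f i) (x ord0 i) * \prod_(j < d | j != i) f j (x ord0 j).
Proof.
rewrite /tens (bigD1 i)//= /dtens eqxx; congr (_ * _).
by apply: eq_bigr => j /negPf ->.
Qed.

Lemma derivable_tens i f x : derivable (f i) (x ord0 i) 1 ->
  derivable (tens f) x (ei i) /\ partial i (tens f) x = tens (dtens f i) x.
Proof.
move=> df; rewrite tens_dtens derive1E.
by have [] := @is_derive_tens i f x _ (derivableP df).
Qed.

Lemma continuous_tens f : (forall j, continuous (f j)) -> continuous (tens f).
Proof.
move=> cf x; rewrite /tens.
elim: (index_enum _) => [|j s ih].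
  rewrite (_ : (fun y : E => _) = fun=> 1); first exact: cst_continuous.
  by apply/funext => y; rewrite big_nil.
rewrite (_ : (fun y : E => _) =
  fun y => f j (y ord0 j) * \prod_(k <- s) f k (y ord0 k)); last first.
  by apply/funext => y; rewrite big_cons.
apply: continuousM ih; apply: (@continuous_comp _ _ _ (fun y : E => y ord0 j) (f j)).
  exact: continuous_coord.
exact: cf.
Qed.

(** A partial derivative of a tensor product is again one, with a single factor differentiated; the
    induction therefore rests on one-variable smoothness alone. *)
Lemma smooth_tens f : (forall j n, Dn n (f j)) -> smooth (tens f).
Proof.
move=> Df k; elim: k f Df => [|k ih] f Df; (split; first by
  apply: continuous_tens => j; exact: continuous_Dn (Df j 0%N)) => //.
have p i x := @derivable_tens i f x (@Dn_derivable _ _ _ (Df i 0%N) (x ord0 i)).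
move=> i; split=> [x|]; first by have [] := p i x.
rewrite (_ : partial i _ = tens (dtens f i)); last by apply/funext => x; have [] := p i x.
by apply: ih => j n; rewrite /dtens; case: eqP => // _; have [] := Df i n.+1.
Qed.

Lemma tensM f g x : tens f x * tens g x = tens (fun j t => f j t * g j t) x.
Proof. by rewrite /tens big_split. Qed.

End tensor.

Section bernstein1.
Context {R : realType}.
Implicit Types (s : R) (n k : nat) (f : nat -> R).

(** The Bernstein basis, generated by Pascal's recursion rather than by binomial coefficients, so
    that the moments follow by induction on [n]. *)
Fixpoint bernp n k : {poly R} :=
  if n is m.+1 then
    (if k is j.+1 then 'X * bernp m j else 0) + (1 - 'X) * bernp m k
  else (k == 0)%:R.

Lemma bernp_ge0 n k s : 0 <= s <= 1 -> 0 <= (bernp n k).[s].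
Proof.
move=> /andP[s0 s1]; have s1' : 0 <= 1 - s by rewrite subr_ge0.
elim: n k => [|n ih] [|k] /=; rewrite ?hornerE ?ler01//.
  by rewrite mulr_ge0.
by rewrite addr_ge0// mulr_ge0.
Qed.

Lemma bernp_gt n k : (n < k)%N -> bernp n k = 0.
Proof.
by elim: n k => [|n ih] [|k]//= nk; rewrite !ih ?mulr0 ?addr0// ltnW.
Qed.

(** The expectation of [f] under the binomial law with parameters [n] and [s]. *)
Definition bernm n f s : R := \sum_(k < n.+1) f k * (bernp n k).[s].

Lemma bernmS n f s :
  bernm n.+1 f s = s * bernm n (fun k => f k.+1) s + (1 - s) * bernm n f s.
Proof.
rewrite /bernm; under eq_bigr => k _ do rewrite /= hornerD mulrDr.
rewrite big_split /=; congr (_ + _).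
  rewrite big_ord_recl /= horner0 mulr0 add0r mulr_sumr.
  by apply: eq_bigr => k _; rewrite /= hornerM hornerX mulrCA.
rewrite big_ord_recr /= bernp_gt// mulr0 horner0 mulr0 addr0 mulr_sumr.
have hX : (1 - 'X : {poly R}).[s] = 1 - s by rewrite !hornerE.
by apply: eq_bigr => k _; rewrite hornerM hX mulrCA.
Qed.

Lemma bernm1 n s : bernm n (fun=> 1) s = 1.
Proof.
elim: n => [|n ih]; last by rewrite bernmS !ih !mulr1 subrKC.
by rewrite /bernm big_ord1 /= !hornerE ?mulr1.
Qed.

Lemma bernmDZ n f g (c : R) s :
  bernm n (fun k => f k + c * g k) s = bernm n f s + c * bernm n g s.
Proof.
rewrite /bernm mulr_sumr -big_split /=.
by apply: eq_bigr => k _; rewrite mulrDl mulrA.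
Qed.

Lemma bernm_id n s : bernm n (fun k => k%:R) s = n%:R * s.
Proof.
elim: n => [|n ih]; first by rewrite /bernm big_ord1 /= !mul0r.
rewrite bernmS (_ : (fun k => k.+1%:R) = fun k => k%:R + 1 * 1); last first.
  by apply/funext => k; rewrite mulr1 -natr1.
by rewrite bernmDZ bernm1 ih -natr1; ring.
Qed.

Lemma bernm_sqr n s : bernm n (fun k => k%:R ^+ 2) s = n%:R * s * (1 - s) + (n%:R * s) ^+ 2.
Proof.
elim: n => [|n ih]; first by rewrite /bernm big_ord1 /= !(mul0r, expr0n, addr0).
rewrite bernmS (_ : (fun k => k.+1%:R ^+ 2) = fun k => (k%:R ^+ 2 + 2 * k%:R) + 1 * 1); last first.
  by apply/funext => k; rewrite -natr1; ring.
by rewrite !bernmDZ bernm1 bernm_id ih -natr1; ring.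
Qed.

(** The exact value is [s (1 - s) / n], the variance of an empirical mean of Bernoulli variables. *)
Lemma bernm_var n s : (0 < n)%N -> 0 <= s <= 1 ->
  bernm n (fun k => (k%:R / n%:R - s) ^+ 2) s <= n%:R^-1.
Proof.
move=> n0 /andP[s0 s1]; have n0' : n%:R != 0 :> R by rewrite pnatr_eq0 -lt0n.
rewrite (_ : (fun k => _) = fun k => n%:R^-2 * k%:R ^+ 2 + (- 2 * s / n%:R) * k%:R + s ^+ 2 * 1); last first.
  by apply/funext => k; field.
rewrite !bernmDZ bernm1 bernm_id (_ : bernm _ (fun k => n%:R ^- 2 * k%:R ^+ 2) s =
    n%:R^-2 * (n%:R * s * (1 - s) + (n%:R * s) ^+ 2)); last first.
  by rewrite -bernm_sqr /bernm mulr_sumr; apply: eq_bigr => k _; rewrite -mulrA.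
rewrite (_ : _ + _ = n%:R^-1 * (s * (1 - s))); last by field.
by rewrite ger_pMr ?invr_gt0 ?ltr0n// mulr_ile1 ?subr_ge0// gerBl.
Qed.

End bernstein1.

Section bernstein.
Context {R : realType} {d : nat}.
Notation E := 'rV[R]_d.

Definition cube (M : R) : set E := [set x | forall j, `|x ord0 j| <= M].

Lemma compact_cube M : compact (cube M).
Proof.
have := @rV_compact R d (fun=> `[-M, M]%classic) (fun=> @segment_compact R _ _).
congr compact; apply/seteqP; split => x /= H j; have := H j;
  by rewrite in_itv /= ler_norml.
Qed.

Lemma uniform_continuity (K : set E) (D : E -> R) (e : R) : compact K ->
  (forall x, K x -> {for x, continuous D}) -> 0 < e ->
  exists2 del, 0 < del & forall x y : E, K x ->
    (forall j, `|y ord0 j - x ord0 j| < del) -> `|D x - D y| < e.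
Proof.
move=> /compact_near_coveringP cK cD e0.
pose P (del : R) (x : E) := forall y : E, (forall j, `|y ord0 j - x ord0 j| < del) -> `|D x - D y| < e.
have H : \forall del \near (0 : R)^'+, K `<=` P del.
  apply: cK => x Kx.
  have e2 : 0 < e / 2 by rewrite divr_gt0.
  have /cvgrPdist_lt/(_ _ e2)/nbhs_box[r r0 Hr] := cD x Kx.
  have r2 : 0 < r / 2 by rewrite divr_gt0.
  exists ([set y : E | forall j, `|y ord0 j - x ord0 j| < r / 2], [set t | t < r / 2]).
    split; first by apply/nbhs_box; exists (r / 2).
    by apply: nbhs_right_lt.
  move=> [y t] /= [yx tr] z zy.
  rewrite (splitr e) -[D y](subrK (D x)) -addrA.
  apply: le_lt_trans (ler_normD _ _) _; apply: ltrD.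
    rewrite distrC; apply: Hr => j; apply: lt_trans (yx j) _.
    by rewrite ltr_pdivrMr// ltr_pMr// ltr1n.
  apply: Hr => j; rewrite -(subrK (y ord0 j) (z ord0 j)) -addrA (splitr r).
  apply: le_lt_trans (ler_normD _ _) _; apply: ltrD => //.
  exact: lt_trans (zy j) tr.
near (0 : R)^'+ => del; exists del => [//|x y Kx]; apply: (_ : K `<=` P del) => //.
by near: del.
Unshelve. all: by end_near. Qed.

Definition tensb (n : nat) (k : {ffun 'I_d -> 'I_n.+1}) (y : E) : R :=
  \prod_(j < d) (bernp n (k j)).[y ord0 j].

Definition grid (n : nat) (k : {ffun 'I_d -> 'I_n.+1}) : E := \row_j ((k j)%:R / n%:R).

Lemma sum_tensb n y : \sum_k @tensb n k y = 1.
Proof.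
rewrite /tensb -(bigA_distr_bigA (fun j (k : 'I_n.+1) => (bernp n k).[y ord0 j])) /=.
apply: big1 => j _; rewrite -[RHS](bernm1 n (y ord0 j)).
by apply: eq_bigr => k _; rewrite mul1r.
Qed.

(** The weights are products of one-variable weights that each sum to 1; summing out the other
    coordinates leaves the one-dimensional law. *)
Lemma sum_tensb_coord n (y : E) (j : 'I_d) (h : nat -> R) :
  \sum_(k : {ffun 'I_d -> 'I_n.+1}) h (k j) * tensb k y = bernm n h (y ord0 j).
Proof.
pose F (l : 'I_d) (k : 'I_n.+1) : R := (if l == j then h k else 1) * (bernp n k).[y ord0 l].
transitivity (\prod_l \sum_k F l k).
  rewrite bigA_distr_bigA /=; apply: eq_bigr => k _.
  by rewrite /F big_split /= -big_mkcond /= big_pred1_eq.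
rewrite (bigD1 j)//= [X in _ * X]big1 ?mulr1 => [|l /negPf lj].
  by apply: eq_bigr => k _; rewrite /F eqxx.
rewrite -[RHS](bernm1 n (y ord0 l)).
by apply: eq_bigr => k _; rewrite /F lj.
Qed.

Lemma tensb_ge0 n k (y : E) : (forall j, 0 <= y ord0 j <= 1) -> 0 <= @tensb n k y.
Proof. by move=> y01; apply: prodr_ge0 => j _; exact: bernp_ge0. Qed.

(** Bernstein's probabilistic argument: uniform continuity handles grid points close to [y], and
    elsewhere the squared distance is at least [del^2], so that Chebyshev's inequality and the
    variance bound in each coordinate make the contribution small. *)
Lemma bernstein_cvg (D : E -> R) (e : R) : continuous D -> 0 < e ->
  exists n, forall y : E, (forall j, 0 <= y ord0 j <= 1) ->
    `|D y - \sum_k D (@grid n k) * tensb k y| <= e.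
Proof.
move=> cD e0; have e2 : 0 < e / 2 by rewrite divr_gt0.
have [del del0 Hdel] := @uniform_continuity (cube 1) D (e / 2) (@compact_cube 1) (fun x _ => cD x) e2.
have [M M0 DM] : exists2 M, 0 < M & forall y, cube 1 y -> `|D y| <= M.
  have cD' : {within cube 1, continuous D} by exact: continuous_subspaceT.
  have /compact_bounded[M [_ HM]] := continuous_compact cD' (@compact_cube 1).
  exists (Num.max M 0 + 1) => [|y y1]; first by rewrite ltr_wpDl// le_max lexx orbT.
  by apply: (HM (Num.max M 0 + 1)); [rewrite ltr_pwDr// le_max lexx|exists y].
(* [C] times a squared gap of at least [del^2] reaches [2 M], the trivial bound for
   [|D y - D z|]. *)
pose C := 2 * M / del ^+ 2; have C0 : 0 < C by rewrite divr_gt0 ?mulr_gt0 ?exprn_gt0.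
have key y z : cube 1 y -> cube 1 z ->
    `|D y - D z| <= e / 2 + C * \sum_j (z ord0 j - y ord0 j) ^+ 2.
  move=> y1 z1; have S0 : 0 <= \sum_j (z ord0 j - y ord0 j) ^+ 2 by apply: sumr_ge0 => j _; exact: sqr_ge0.
  have [H|/existsNP[j /negP]] := pselect (forall j, `|z ord0 j - y ord0 j| < del).
    by apply: le_trans (ltW (Hdel _ _ y1 H)) _; rewrite lerDl mulr_ge0// ltW.
  rewrite -leNgt => delj; apply: (@le_trans _ _ (2 * M)).
    by apply: le_trans (ler_normB _ _) _; rewrite mulr_natl mulr2n lerD ?DM.
  apply: (@le_trans _ _ (C * \sum_j (z ord0 j - y ord0 j) ^+ 2)); last by rewrite lerDr ltW.
  rewrite /C -[leRHS]mulrA -[leLHS]mulr1; apply: ler_wpM2l; first by rewrite mulr_ge0// ltW.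
  rewrite ler_pdivlMl ?exprn_gt0// mulr1 (bigD1 j)//=.
  apply: (@le_trans _ _ ((z ord0 j - y ord0 j) ^+ 2)).
    by rewrite -[leRHS]real_normK ?num_real// lerXn2r ?nnegrE// ltW.
  by rewrite lerDl; apply: sumr_ge0 => l _; exact: sqr_ge0.
(* Makes [C d / n], which bounds [C] times the sum of the coordinate variances, at most [e / 2]. *)
pose n := (Num.truncn (C * d%:R / (e / 2))).+1.
have n0 : 0 < n%:R :> R by rewrite ltr0n.
exists n => y y01.
have cy : cube 1 y by move=> j; have /andP[y0 y1] := y01 j; rewrite ger0_norm.
have cg k : cube 1 (@grid n k).
  move=> j; rewrite mxE ger0_norm ?divr_ge0// ler_pdivrMr// mul1r ler_nat.
  by rewrite -ltnS ltn_ord.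
rewrite -[D y]mulr1 -(sum_tensb n y) mulr_sumr -sumrB.
apply: le_trans (ler_norm_sum _ _ _) _.
apply: (@le_trans _ _ (\sum_k (e / 2 * @tensb n k y +
    C * \sum_j ((k j)%:R / n%:R - y ord0 j) ^+ 2 * tensb k y))).
  apply: ler_sum => k _; rewrite -mulrBl normrM (ger0_norm (tensb_ge0 _ y01)).
  rewrite -mulr_suml mulrA -mulrDl ler_wpM2r ?tensb_ge0//.
  apply: le_trans (key y (grid k) cy (cg k)) _.
  by under eq_bigr do rewrite mxE.
rewrite big_split /= -mulr_sumr sum_tensb mulr1 [leRHS]splitr lerD2l.
rewrite -mulr_sumr exchange_big /=.
apply: (@le_trans _ _ (C * \sum_(j < d) n%:R^-1)).
  apply: ler_wpM2l; first exact: ltW.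
  apply: ler_sum => j _.
  by rewrite (@sum_tensb_coord n y j (fun k => (k%:R / n%:R - y ord0 j) ^+ 2)) bernm_var.
rewrite sumr_const card_ord -[_ *+ d]mulr_natl mulrA ler_pdivrMr// [leRHS]mulrC -ler_pdivrMr//.
by rewrite ltW// truncnS_gt.
Qed.

End bernstein.

Lemma is_derive_path (R : realType) (V : normedModType R) (h : V -> R) (x v : V) (t k : R) :
  is_derive (t *: v + x) v h k -> is_derive t (1 : R) (fun s : R => h (s *: v + x)) k.
Proof.
move=> /is_derive_line H; apply/is_derive_line.
have -> : (fun s : R => (fun s : R => h (s *: v + x)) (s *: (1 : R) + t)) =
    (fun s : R => h (s *: v + (t *: v + x))).
  by apply/funext => s /=; rewrite [s *: 1]mulr1 scalerDl addrA.
exact: H.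
Qed.

Lemma poly_antiderivative (R : realType) (p : {poly R}) (a : R) :
  exists q : {poly R}, q^`() = p /\ q.[a] = 0.
Proof.
pose q := \poly_(i < (size p).+1) (p`_i.-1 / i%:R).
exists (q - (q.[a])%:P); split; last by rewrite !hornerE subrr.
rewrite derivB derivC subr0; apply/polyP => i; rewrite coef_deriv coef_poly ltnS.
case: ltnP => [ip|pi]; last by rewrite mul0rn nth_default.
by rewrite -[LHS]mulr_natr /= divfK// pnatr_eq0.
Qed.

Lemma derive1_horner (R : realType) (p : {poly R}) : derive1 (horner p) = horner p^`().
Proof. by apply/funext => t; rewrite derive1E derive_val. Qed.

Lemma Dn_horner (R : realType) (p : {poly R}) n : Dn n (horner p).
Proof.
elim: n p => [|n ih] p; split => //; try by move=> t; exact: derivable_horner.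
by rewrite derive1_horner.
Qed.

Section tensor_approximation.
Context {R : realType} {d : nat}.
Notation E := 'rV[R]_d.
Local Notation ei i := (delta_mx ord0 i : E).

Lemma is_derive_sum_fun (J : finType) (x v : E) (h : J -> E -> R) (dh : J -> R) :
  (forall k, is_derive x v (h k) (dh k)) ->
  is_derive x v (fun y => \sum_k h k y) (\sum_k dh k).
Proof.
move=> H; rewrite (_ : (fun y => _) = \sum_k h k); last by rewrite fct_sumE.
by elim/big_ind2 : _ => // [|] *; [exact: is_derive_cst|exact: is_deriveD].
Qed.

(** The mean value theorem along the [i]-th direction, starting from the face where [g] vanishes:
    the segment has length at most [2 M] and stays in the cube. *)
Lemma path_bound (g : E -> R) (dg : E -> R) (i : 'I_d) (M e : R) (x : E) :
  (forall y, is_derive y (ei i) g (dg y)) -> (forall y, cube M y -> `|dg y| <= e) ->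
  (forall y : E, y ord0 i = - M -> g y = 0) -> cube M x -> `|g x| <= 2 * M * e.
Proof.
move=> dgE dge g0 xM; have M0 : 0 <= M by exact: le_trans (xM i).
have e0 : 0 <= e by exact: le_trans (dge x xM).
have /andP[Mx xM'] : - M <= x ord0 i <= M by rewrite -ler_norml; exact: xM.
pose a := - M - x ord0 i; have a0 : a <= 0 by rewrite subr_le0.
have D t : is_derive t (1 : R) (fun s : R => g (s *: ei i + x)) (dg (t *: ei i + x)).
  by apply: is_derive_path; exact: dgE.
have cg : {within `[a, 0], continuous (fun s : R => g (s *: ei i + x))}.
  apply: continuous_subspaceT => t; apply: differentiable_continuous.
  by apply/derivable1_diffP; have [] := D t.
have [c ca] := MVT_segment a0 (fun t _ => D t) cg.
rewrite scale0r add0r [g (a *: _ + _)]g0; last by rewrite line_coord eqxx /a subrK.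
rewrite subr0 => ->; rewrite sub0r normrM mulrC.
apply: ler_pM => //; first by rewrite normrN ler0_norm// /a; lra.
apply: dge => j; rewrite line_coord; case: eqP => [->|_]; last exact: xM.
by move: ca; rewrite in_itv /= /a => /andP[]; rewrite ler_norml; lra.
Qed.

(** The derivative is approximated first and integrated afterwards: closeness of derivatives passes
    to antiderivatives, but not conversely. Integrating in the [i]-th variable alone keeps the
    tensor form. *)
Lemma tens_approx (i : 'I_d) (Psi D : E -> R) (M e : R) : 0 < M -> 0 < e ->
  continuous D -> (forall x, is_derive x (ei i) Psi (D x)) ->
  (forall x : E, x ord0 i = - M -> Psi x = 0) ->
  exists (J : finType) (f : J -> 'I_d -> R -> R), (forall k j m, Dn m (f k j)) /\
    forall x, cube M x -> `|D x - \sum_k tens (dtens (f k) i) x| <= e /\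
      `|Psi x - \sum_k tens (f k) x| <= 2 * M * e.
Proof.
move=> M0 e0 cD PsiD Psi0.
(* An affine change of variables from the unit cube, where the Bernstein polynomials approximate, to
   [cube M]; [Y] below is its inverse in one coordinate. *)
pose D' (y : E) := D ((2 * M) *: y - const_mx M).
have cD' : continuous D'.
  move=> y; apply: (@continuous_comp _ _ _ (fun y : E => (2 * M) *: y - const_mx M) D); last exact: cD.
  move=> U /nbhs_box[r r0 rU]; apply/nbhs_box.
  have M2 : 0 < 2 * M by rewrite mulr_gt0.
  exists (r / (2 * M)) => [|z zy]; first exact: divr_gt0.
  apply: rU => j; rewrite !mxE opprB addrA subrK -mulrBr normrM (gtr0_norm M2).
  by rewrite mulrC -ltr_pdivlMr.
have [n Hn] := bernstein_cvg cD' e0.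
pose Y : {poly R} := (2 * M)^-1 *: 'X + (2^-1)%:P.
have YE t : Y.[t] = (t + M) / (2 * M).
  by rewrite /Y !hornerE; field; rewrite gt_eqF.
pose P k : {poly R} := bernp n k \Po Y.
have [q qP] := choice (fun k => poly_antiderivative (P k) (- M)).
pose c (k : {ffun 'I_d -> 'I_n.+1}) := D' (grid k).
pose f (k : {ffun 'I_d -> 'I_n.+1}) (j : 'I_d) : R -> R :=
  if j == i then horner (c k *: q (k j)) else horner (P (k j)).
have Df k j m : Dn m (f k j) by rewrite /f; case: eqP => _; exact: Dn_horner.
exists {ffun 'I_d -> 'I_n.+1}, f; split=> //.
have dE x k : tens (dtens (f k) i) x = c k * \prod_j (P (k j)).[x ord0 j].
  rewrite tens_dtens [in RHS](bigD1 i)//= mulrA; congr (_ * _).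
    by rewrite /f eqxx derive1_horner derivZ (qP _).1 hornerZ.
  by apply: eq_bigr => j /negPf ji; rewrite /f ji.
have b1 x : cube M x -> `|D x - \sum_k tens (dtens (f k) i) x| <= e.
  move=> xM; pose y : E := \row_j ((x ord0 j + M) / (2 * M)).
  have M2 : 0 < 2 * M by rewrite mulr_gt0.
  have y01 j : 0 <= y ord0 j <= 1.
    rewrite mxE; have := xM j; rewrite ler_norml => /andP[Mx xM'].
    by rewrite divr_ge0 ?(ltW M2) -?lerBlDr ?sub0r//= ler_pdivrMr// mul1r; lra.
  have := Hn _ y01; rewrite {1}/D' (_ : (2 * M) *: y - const_mx M = x); last first.
    by apply/rowP => j; rewrite !mxE mulrC divfK ?addrK// gt_eqF.
  congr (`|_ - _| <= e); apply: eq_bigr => k _; rewrite dE; congr (_ * _).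
  by apply: eq_bigr => j _; rewrite horner_comp YE mxE.
move=> x xM; split; first exact: b1.
apply: (@path_bound (fun x => Psi x - \sum_k tens (f k) x)
  (fun x => D x - \sum_k tens (dtens (f k) i) x) i) => // [y|y y_i].
  apply: is_deriveB (PsiD y) _; apply: is_derive_sum_fun => k; rewrite tens_dtens.
  apply: is_derive_tens; rewrite derive1E; apply: derivableP.
  exact: (Dn_derivable (Df k i 0%N)).
rewrite Psi0// sub0r big1 ?oppr0// => k _.
by rewrite /tens (bigD1 i)//= /f eqxx hornerZ y_i (qP _).2 mulr0 mul0r.
Qed.

End tensor_approximation.

(** * Borel sets of the coordinate space *)

Section rV_measurability.
Context {R : realType} {d : nat}.
Notation E := 'rV[R]_d.
Local Notation leb := (lebesgue_rV d).

Lemma measurable_rV_box (B : 'I_d -> set R) : (forall i, measurable (B i : set (measurableTypeR R))) ->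
  measurable [set x : E | forall i, B i (x ord0 i)].
Proof.
move=> mB; rewrite (_ : mkset _ = \bigcap_(i in [set: 'I_d]) ((fun x : E => x ord0 i) @^-1` B i)).
  apply: fin_bigcap_measurable => // i _.
  by have := @measurable_coord R d i measurableT _ (mB i); rewrite setTI.
by apply/seteqP; split => x /= Bx i; [move=> _|]; exact: Bx.
Qed.

(** The sigma-algebra is the one generated by the coordinates, so [U] is exhibited as a countable
    union of boxes with rational centres and sides determined by an integer. *)
Lemma measurable_open (U : set E) : open U -> measurable U.
Proof.
move=> oU; pose b (q : {ffun 'I_d -> rat}) (n : nat) : set E :=
  [set x | forall i, `](ratr (q i) - n.+1%:R^-1), (ratr (q i) + n.+1%:R^-1)[%classic (x ord0 i)].
pose F (k : nat) : set E := if @unpickle ({ffun 'I_d -> rat} * nat)%type k is Some (q, n)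
  then (if `[< b q n `<=` U >] then b q n else set0) else set0.
rewrite (_ : U = \bigcup_k F k).
  apply: bigcupT_measurable => k; rewrite /F; case: unpickle => [[q n]|//].
  by case: ifP => // _; apply: (@measurable_rV_box (fun i => `](ratr (q i) - n.+1%:R^-1), (ratr (q i) + n.+1%:R^-1)[%classic)) => i; exact: measurable_itv.
apply/seteqP; split => [x Ux|x [k _]]; last first.
  by rewrite /F; case: unpickle => [[q n]|//]; case: ifP => // /asboolP; exact.
have /nbhs_box[e e0 eU] : nbhs x U by exact: open_nbhs_nbhs.
pose n := Num.truncn (2 / e).
have n0 : 0 < n.+1%:R^-1 :> R by rewrite invr_gt0.
have ne : n.+1%:R^-1 + n.+1%:R^-1 <= e.
  rewrite -mulr2n -[X in X <= _]mulr_natl ler_pdivrMr// -ler_pdivrMl// mulrC.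
  by rewrite ltW// truncnS_gt.
have /choice[q qx] : forall i, exists q : rat, x ord0 i - n.+1%:R^-1 < ratr q < x ord0 i + n.+1%:R^-1.
  move=> i; have lt : x ord0 i - n.+1%:R^-1 < x ord0 i + n.+1%:R^-1.
    by rewrite ltrBlDr -addrA ltrDl addr_gt0.
  have [q] := rat_in_itvoo lt.
  by rewrite in_itv /= => ?; exists q.
pose q' : {ffun 'I_d -> rat} := [ffun i => q i].
have bx : b q' n x.
  by move=> i; rewrite /= in_itv /= ffunE; have := qx i; move: (n.+1%:R^-1) => c; lra.
exists (pickle (q', n)) => //; rewrite /F pickleK ifT//.
apply/asboolP => y yb; apply: eU => j; have := yb j; have := bx j.
rewrite /= !in_itv /= ltr_norml; move: (n.+1%:R^-1) ne => c.
by move: (ratr (q' j)) => z; lra.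
Qed.

Lemma measurable_continuous_on (D : set E) (f : E -> R) : open D ->
  (forall x, D x -> {for x, continuous f}) -> measurable_fun D f.
Proof.
move=> oD cf; apply: (measurability _ (RGenOpens.measurableE R)).
move=> _ [_ [a [b ->] <-]]; apply: measurable_open; rewrite openE => x [Dx fx].
apply: filterI; first exact: open_nbhs_nbhs.
by apply: (cf x Dx); apply: open_nbhs_nbhs; split=> //; exact: interval_open.
Qed.

Lemma bounded_cube (B : set E) : bounded_set B -> exists2 M, 0 < M & B `<=` cube M.
Proof.
move=> [M [_ HM]]; exists (Num.max M 0 + 1) => [|x Bx j].
  by rewrite ltr_wpDl// le_max lexx orbT.
apply: (@le_trans _ _ `|x|).
  have /mapP[k Hk ->] : `|x ord0 j| \in [seq `|x i.1 i.2| | i : 'I_1 * 'I_d].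
    by apply/mapP; exists (ord0, j) => //=; rewrite mem_enum.
  by rewrite [leRHS]/Num.norm /= mx_normrE; apply/bigmax_geP; right => /=; exists k.
by apply: HM => //; rewrite ltr_pwDr// le_max lexx.
Qed.

Lemma lebesgue_cube_lty (B : set E) M : measurable B -> B `<=` cube M -> (leb B < +oo)%E.
Proof.
move=> mB BM.
have mI i : measurable ((fun=> `[-M, M]%classic) i : set (measurableTypeR R)) by exact: measurable_itv.
have E1 : cube M = [set x : E | forall i : 'I_d, `[-M, M]%classic (x ord0 i)].
  by apply/seteqP; split => x /= H j; have := H j; rewrite in_itv /= ler_norml.
apply: (@le_lt_trans _ _ (leb (cube M))).
  apply: le_measure; rewrite ?inE// E1; exact: (@measurable_rV_box (fun=> `[-M, M]%classic)).
rewrite E1 (@lebesgue_rV_box R d (fun=> `[-M, M]%classic))//.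
set P := (\prod_(i < d) _)%E; suff /andP[] : (0 <= P < +oo)%E by []; rewrite /P.
elim/big_ind : _ => [|x y /andP[x0 xlt] /andP[y0 ylt]|i _]; first by rewrite lee01 ltry.
  by rewrite mule_ge0//= lte_mul_pinfty// ge0_fin_numE.
by rewrite measure_ge0 /=; apply: compact_finite_measure; exact: segment_compact.
Qed.

Lemma compact_bounded_fun (K : set E) (f : E -> R) : compact K -> {within K, continuous f} ->
  exists2 M, 0 < M & forall x, K x -> `|f x| <= M.
Proof.
move=> cK cf; have /compact_bounded[M [_ HM]] := continuous_compact cf cK.
exists (Num.max M 0 + 1) => [|x Kx]; first by rewrite ltr_wpDl// le_max lexx orbT.
by apply: (HM (Num.max M 0 + 1)); [rewrite ltr_pwDr// le_max lexx|exists x].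
Qed.

End rV_measurability.

(** * The product rule for weak derivatives *)

Section cutoff.
Import finmap.
Context {R : realType} {d : nat}.
Notation E := 'rV[R]_d.
Implicit Types (x y : E) (r : R).
Local Notation ei i := (delta_mx ord0 i : E).

Definition bumpI (c r t : R) : R := Ebump 1 (1 * t + (r - c)) * Ebump 1 ((-1) * t + (c + r)).

Lemma Dn_bumpI c r n : Dn n (bumpI c r).
Proof. by apply: DnM; exact: Dn_affine (Dn_Ebump _ _). Qed.

Lemma bumpI_ge0 c r t : 0 <= bumpI c r t.
Proof.
by apply: mulr_ge0; rewrite /Ebump; case: ifP => // _; rewrite hornerC mul1r expR_ge0.
Qed.

Lemma bumpI_neq0 c r t : (bumpI c r t != 0) = (`|t - c| < r).
Proof.
have E1 (s : R) : (Ebump 1 s != 0) = (0 < s).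
  rewrite /Ebump; case: ifP => _; last by rewrite eqxx.
  by rewrite hornerC mul1r gt_eqF ?expR_gt0.
rewrite /bumpI mulf_eq0 negb_or !E1 mul1r mulN1r ltr_norml.
by apply/andP/andP => -[]; lra.
Qed.

Definition boxbump (r : E -> R) x : 'I_d -> R -> R := fun j => bumpI (x ord0 j) (r x).

Lemma boxbump_neq0 (r : E -> R) x y : tens (boxbump r x) y != 0 ->
  forall j, `|y ord0 j - x ord0 j| < r x.
Proof.
move=> + j; rewrite -bumpI_neq0; apply: contra => /eqP b0.
by rewrite /tens (bigD1 j)//= /boxbump b0 mul0r.
Qed.

Lemma boxbump_gt0 (r : E -> R) x : 0 < r x -> 0 < tens (boxbump r x) x.
Proof.
move=> r0; rewrite /tens; apply: prodr_gt0 => j _.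
by rewrite lt_def bumpI_ge0 bumpI_neq0 subrr normr0 r0.
Qed.

Lemma boxbump_ge0 (r : E -> R) x y : 0 <= tens (boxbump r x) y.
Proof. by apply: prodr_ge0 => j _; exact: bumpI_ge0. Qed.

Lemma closed_support_sub (f : E -> R) (C : set E) : closed C ->
  (forall x, f x != 0 -> C x) -> closure [set x | f x != 0] `<=` C.
Proof.
by move=> cC fC; rewrite (closure_id C).1//; apply: closure_subset => x /fC.
Qed.

Lemma compact_box x r : compact [set y : E | forall j, `|y ord0 j - x ord0 j| <= r].
Proof.
have := @rV_compact R d (fun j => `[x ord0 j - r, x ord0 j + r]%classic) (fun=> @segment_compact R _ _).
congr compact; apply/seteqP; split => y /= H j; have := H j;
  by rewrite in_itv /= ler_norml => /andP[? ?]; lra.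
Qed.

Lemma closed_box x r : closed [set y : E | forall j, `|y ord0 j - x ord0 j| <= r].
Proof. by have := compact_closed (@norm_hausdorff R E) (@compact_box x r). Qed.

(** Finitely many bumps on boxes inside [Omega] cover [K]. Their sum is the cut-off, but they are
    kept apart: each is a tensor product, and so is its product with another tensor product, which
    is thus a test function. *)
Lemma cutoff (Omega K : set E) : open Omega -> compact K -> K `<=` Omega ->
  exists (J : finType) (b : J -> 'I_d -> R -> R),
  [/\ forall l j m, Dn m (b l j),
      forall l f, (forall j m, Dn m (f j)) -> test_fun Omega (tens (fun j t => b l j t * f j t)),
      forall l y, 0 <= tens (b l) y &
      forall y, K y -> 0 < \sum_l tens (b l) y].
Proof.
move=> oO cK KO.
have /choice[r Hr] : forall x, exists r : R, K x ->
    0 < r /\ forall y, (forall j, `|y ord0 j - x ord0 j| <= r) -> Omega y.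
  move=> x; have [Kx|nKx] := pselect (K x); last by exists 0.
  have /nbhs_box[e e0 eO] : nbhs x Omega by apply: open_nbhs_nbhs; split=> //; exact: KO.
  exists (e / 2) => _; split=> [|y yx]; first exact: divr_gt0.
  by apply: eO => j; apply: le_lt_trans (yx j) _; rewrite ltr_pdivrMr// ltr_pMr// ltr1n.
have sm x j m : Dn m (boxbump r x j) := Dn_bumpI _ _ _.
have := cK; rewrite compact_cover => /(_ E K (fun x => [set y | tens (boxbump r x) y != 0])).
case=> [x Kx|x Kx|D DK Dcov].
- have ct : continuous (tens (boxbump r x)) by apply: continuous_tens => j; exact: continuous_Dn (sm x j 0%N).
  rewrite (_ : mkset _ = tens (boxbump r x) @^-1` [set t | t != 0]) //.
  by apply: open_comp => [y _|]; [exact: ct|exact: open_neq].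
- by exists x => //=; rewrite gt_eqF// boxbump_gt0//; exact: (Hr x Kx).1.
pose z (l : 'I_(size (finmap.enum_fset D))) : E := nth 0 (finmap.enum_fset D) l.
have zD l : z l \in D by exact: mem_nth.
exists 'I_(size (finmap.enum_fset D)), (fun l => boxbump r (z l)); split.
- by move=> l j m; exact: sm.
- move=> l f Df; have Kl : K (z l) by exact: set_mem (DK _ (zD l)).
  have [r0 rO] := Hr _ Kl.
  have sub : closure [set x | tens (fun j t => boxbump r (z l) j t * f j t) x != 0] `<=`
      [set y : E | forall j, `|y ord0 j - (z l) ord0 j| <= r (z l)].
    apply: closed_support_sub; first exact: closed_box.
    by move=> y; rewrite -tensM mulf_eq0 negb_or => /andP[/boxbump_neq0 H _] j; exact/ltW/H.
  split.
  + by apply: smooth_tens => j m; apply: DnM; [exact: sm|exact: Df].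
  + apply: subclosed_compact sub; [exact: closed_closure|exact: compact_box].
  + by move=> y /sub /rO.
- by move=> l y; exact: boxbump_ge0.
- move=> y /Dcov[x xD /= xy].
  have xD' : (index x (finmap.enum_fset D) < size (finmap.enum_fset D))%N by rewrite index_mem.
  have zx : z (Ordinal xD') = x by rewrite /z /= nth_index.
  rewrite (bigD1 (Ordinal xD'))//= zx; apply: ltr_pwDl.
    by rewrite lt_def xy boxbump_ge0.
  by apply: sumr_ge0 => l _; exact: boxbump_ge0.
Qed.

End cutoff.

Lemma eq0_eps (R : realFieldType) (z C : R) : 0 <= C -> (forall e, 0 < e -> `|z| <= e * C) -> z = 0.
Proof.
move=> C0 H; apply/eqP; apply: contraT => z0.
have z1 : 0 < `|z| by rewrite normr_gt0.
have C1 : 0 < C + 1 by rewrite ltr_wpDl.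
have := H (`|z| / (C + 1)) (divr_gt0 z1 C1).
by rewrite mulrAC -mulrA ler_pMr// ler_pdivlMr// mul1r leNgt ltrDl ltr01.
Qed.

Section weak_product.
Context {R : realType} {d : nat}.
Notation E := 'rV[R]_d.
Implicit Types (x y : E).
Local Notation ei i := (delta_mx ord0 i : E).
Local Notation leb := (lebesgue_rV d).

Lemma is_derive_quot (f g : E -> R) x v (df dg : R) : g x != 0 ->
  is_derive x v f df -> is_derive x v g dg ->
  is_derive x v (fun y => f y / g y) (df / g x - f x * dg / g x ^+ 2).
Proof.
move=> gx fD gD.
have iD : is_derive x v (fun y => (g y)^-1) (- (g x) ^- 2 *: dg).
  by split; [apply: derivableV => //; case: gD|rewrite deriveV//; case: gD => _ ->].
apply: is_derive_eq (is_deriveM fD iD) _.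
rewrite /GRing.scale /=; field => //.
Qed.

Lemma Dn_dtens (f : 'I_d -> R -> R) i : (forall j m, Dn m (f j)) -> forall j m, Dn m (dtens f i j).
Proof. by move=> Df j m; rewrite /dtens; case: eqP => // _; have [] := Df i m.+1. Qed.

Lemma continuous_sum_tens (J : finType) (f : J -> 'I_d -> R -> R) :
  (forall k j m, Dn m (f k j)) -> continuous (fun x => \sum_k tens (f k) x).
Proof.
move=> Df x; elim: (index_enum J) => [|j s ih].
  rewrite (_ : (fun y : E => _) = fun=> 0); first exact: cst_continuous.
  by apply/funext => y; rewrite big_nil.
rewrite (_ : (fun y : E => _) = fun y => tens (f j) y + \sum_(k <- s) tens (f k) y); last first.
  by apply/funext => y; rewrite big_cons.
apply: continuousD ih; apply: continuous_tens => l.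
exact: continuous_Dn (Df j l 0%N).
Qed.

Lemma is_derive_tensE (f : 'I_d -> R -> R) i x : (forall j m, Dn m (f j)) ->
  is_derive x (ei i) (tens f) (tens (dtens f i) x).
Proof.
move=> Df; have [d1 d2] := @derivable_tens R d i f x (@Dn_derivable _ _ _ (Df i 0%N) (x ord0 i)).
by split.
Qed.

Variable Omega : set E.
Hypotheses (oO : open Omega) (bO : bounded_set Omega).

Let mO : measurable Omega. Proof. exact: measurable_open. Qed.

Lemma lebesgue_Omega_lty : (leb Omega < +oo)%E.
Proof. by have [M _ OM] := bounded_cube bO; exact: lebesgue_cube_lty OM. Qed.

Lemma memL2_bounded_Omega (f : E -> R) M : measurable_fun Omega f ->
  (forall x, Omega x -> `|f x| <= M) -> memL2 leb Omega f.
Proof.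
move=> mf fM; apply/(memL2P _ mO); split=> //.
apply: (measurable_bounded_integrable mO lebesgue_Omega_lty).
  exact: measurable_funX.
exists (M ^+ 2); split; first exact: num_real.
move=> N MN x Ox; rewrite /= ger0_norm ?sqr_ge0// (le_trans _ (ltW MN))//.
rewrite -real_normK ?num_real// lerXn2r ?nnegrE ?fM//.
by apply: le_trans (fM _ Ox).
Qed.

Lemma memL2_continuous (f : E -> R) : continuous f -> memL2 leb Omega f.
Proof.
move=> cf; have [M M0 OM] := bounded_cube bO.
have [B B0 fB] := @compact_bounded_fun R d _ f (@compact_cube R d M) (continuous_subspaceT cf).
apply: (@memL2_bounded_Omega _ B) => [|x /OM]; last exact: fB.
by apply: measurable_continuous_on => // x _; exact: cf.
Qed.

(** Both sides are continuous in [phi] and [dphi] for uniform convergence on the bounded set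
    [Omega], and the identity is available for the approximations [S p]: the defect is at most [e]
    times a constant independent of [e]. *)
Lemma weak_partial_C1 (i : 'I_d) (f k phi dphi : E -> R) (K : set E) :
  is_weak_partial Omega i f k -> compact K -> K `<=` Omega ->
  (forall x, ~ K x -> phi x = 0) -> (forall x, is_derive x (ei i) phi (dphi x)) ->
  continuous phi -> continuous dphi ->
  \int[leb]_(x in Omega) (f x * dphi x) = - \int[leb]_(x in Omega) (k x * phi x).
Proof.
move=> [fL kL fk] cK KO phi0 phiD cphi cdphi.
have nbhsK x : ~ K x -> \near x, phi x = 0.
  move=> nKx; have cKK : closed K by exact: compact_closed (@norm_hausdorff R E) cK.
  have : nbhs x (~` K) by apply: open_nbhs_nbhs; split=> //; exact: closed_openC.
  by apply: filterS => y; exact: phi0.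
have dphi0 x : ~ K x -> dphi x = 0.
  move=> nKx; have [_ <-] := phiD x.
  have c0 : is_derive x (ei i) (fun=> 0 : R) 0 by exact: is_derive_cst.
  have H : \near x, (fun=> 0 : R) x = phi x by apply: filterS (nbhsK _ nKx) => y ->.
  by have [_ ->] := near_eq_is_derive H c0.
have [J [b [Db bT b0 bS]]] := cutoff oO cK KO.
pose S x := \sum_l tens (b l) x; pose Si x := \sum_l tens (dtens (b l) i) x.
have SD x : is_derive x (ei i) S (Si x).
  by apply: is_derive_sum_fun => l; exact: is_derive_tensE.
have cS : continuous S by exact: continuous_sum_tens.
have cSi : continuous Si by apply: continuous_sum_tens => l; exact: Dn_dtens.
(* Outside [K] the cut-off may vanish, but so do [phi] and [dphi], and both expressions are 0 near
   such points whatever [S] is. *)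
pose Psi x := phi x / S x; pose D x := dphi x / S x - phi x * Si x / S x ^+ 2.
have PsiD x : is_derive x (ei i) Psi (D x).
  have [Kx|nKx] := pselect (K x).
    by apply: is_derive_quot => //; rewrite gt_eqF// bS.
  rewrite /D phi0// dphi0// !mul0r subr0.
  apply: near_eq_is_derive (is_derive_cst 0 x (ei i)).
  by apply: filterS (nbhsK x nKx) => y /= y0; rewrite /Psi y0 mul0r.
have cD : continuous D.
  move=> x; have [Kx|nKx] := pselect (K x).
    have Sx : S x != 0 by rewrite gt_eqF// bS.
    have iS : {for x, continuous (fun y => (S y)^-1)} := continuousV Sx (cS x).
    have h1 : {for x, continuous (fun y => dphi y / S y)} := continuousM (cdphi x) iS.
    have h2 : {for x, continuous (fun y => phi y * Si y)} := continuousM (cphi x) (cSi x).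
    have h3 : {for x, continuous (fun y => S y ^+ 2)} := continuousM (cS x) (cS x).
    have h4 : {for x, continuous (fun y => (S y ^+ 2)^-1)}.
      by apply: continuousV h3; rewrite expf_neq0.
    exact: (continuousB h1 (continuousM h2 h4)).
  have Dx : D x = 0 by rewrite /D phi0// dphi0// !mul0r subr0.
  have Z : \forall y \near x, D y = 0.
    have cKK : closed K by exact: compact_closed (@norm_hausdorff R E) cK.
    have : nbhs x (~` K) by apply: open_nbhs_nbhs; split=> //; exact: closed_openC.
    by apply: filterS => y nKy; rewrite /D phi0// dphi0// !mul0r subr0.
  move=> U; rewrite Dx => nU; change (nbhs x (D @^-1` U)); apply: filterS Z => y Dy.
  by rewrite /= Dy; exact: nbhs_singleton.
have [M0 M00 OM] := bounded_cube bO.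
(* Enlarging the cube by 1 keeps its faces away from [Omega], so that [Psi] vanishes on the face
   [x_i = -M] where the antiderivatives start. *)
pose M := M0 + 1; have M1 : 0 < M by rewrite ltr_wpDl// ltW.
have OM' : Omega `<=` cube M by move=> x /OM + j => /(_ j) /le_trans; apply; rewrite lerDl.
have Psi0 x : x ord0 i = - M -> Psi x = 0.
  move=> xi; rewrite /Psi phi0 ?mul0r// => /KO /OM /(_ i); rewrite xi normrN ger0_norm; last exact: ltW.
  by rewrite leNgt /M ltrDl ltr01.
have [B0 B00 SB] := @compact_bounded_fun R d _ S (@compact_cube R d M) (continuous_subspaceT cS).
have [B1 B10 SiB] := @compact_bounded_fun R d _ Si (@compact_cube R d M) (continuous_subspaceT cSi).
have ig (g h : E -> R) : memL2 leb Omega g -> continuous h -> leb.-integrable Omega (EFin \o (fun x => g x * h x)).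
  by move=> gL ch; apply: memL2_mul => //; exact: memL2_continuous.
have one : continuous ((fun=> 1) : E -> R) by exact: cst_continuous.
have ii (g : E -> R) : memL2 leb Omega g -> leb.-integrable Omega (EFin \o g).
  by move=> gL; have := ig g _ gL one; apply: eq_integrable_real => // x _; rewrite mulr1.
have nf : leb.-integrable Omega (EFin \o (fun x => `|f x|)) by exact: integrable_norm (ii _ fL).
have nk : leb.-integrable Omega (EFin \o (fun x => `|k x|)) by exact: integrable_norm (ii _ kL).
(* The weak identity for [S p], by expanding both sums into tensor products, each of which is a test
   function. *)
have weak_p (I : finType) (h : I -> 'I_d -> R -> R) : (forall n j m, Dn m (h n j)) ->
  \int[leb]_(x in Omega) (f x * (Si x * (\sum_n tens (h n) x) + S x * \sum_n tens (dtens (h n) i) x)) =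
  - \int[leb]_(x in Omega) (k x * (S x * \sum_n tens (h n) x)).
  move=> Dh.
  pose F (ln : J * I) x := tens (fun j t => b ln.1 j t * h ln.2 j t) x.
  have DF ln j m : Dn m (fun t => b ln.1 j t * h ln.2 j t) by apply: DnM.
  have cF ln : continuous (F ln) by apply: continuous_tens => j; exact: continuous_Dn (DF ln j 0%N).
  pose F' (ln : J * I) x := tens (dtens (fun j t => b ln.1 j t * h ln.2 j t) i) x.
  have cF' ln : continuous (F' ln).
    by apply: continuous_tens => j; exact: continuous_Dn (Dn_dtens i (DF ln) j 0%N).
  have FE ln x : F' ln x = tens (dtens (b ln.1) i) x * tens (h ln.2) x + tens (b ln.1) x * tens (dtens (h ln.2) i) x.
    rewrite /F'; have [_ <-] := is_derive_tensE i x (DF ln).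
    rewrite (_ : tens _ = tens (b ln.1) * tens (h ln.2)); last by apply/funext => y; rewrite -tensM.
    have [_ ->] := is_deriveM (is_derive_tensE i x (Db ln.1)) (is_derive_tensE i x (Dh ln.2)).
    by rewrite /GRing.scale /= addrC [_ * tens (dtens (b _) _) _]mulrC.
  transitivity (\int[leb]_(x in Omega) \sum_ln (f x * F' ln x)).
    apply: eq_Rintegral => x _; rewrite -mulr_sumr; congr (_ * _).
    rewrite /Si /S !big_distrlr /= !pair_big /= -big_split /=.
    by apply: eq_bigr => -[l n] _; rewrite FE.
  rewrite (Rintegral_sum mO)//; last by move=> ln; exact: ig.
  rewrite (_ : \int[leb]_(x in Omega) (k x * _) = \sum_ln \int[leb]_(x in Omega) (k x * F ln x)); last first.
    rewrite -(Rintegral_sum mO)//; last by move=> ln; exact: ig.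
    apply: eq_Rintegral => x _; rewrite -mulr_sumr; congr (_ * _).
    rewrite /S big_distrlr /= pair_big /=.
    by apply: eq_bigr => -[l n] _; rewrite tensM.
  rewrite -sumrN; apply: eq_bigr => ln _; rewrite -fk; last exact: bT.
  apply: eq_Rintegral => x _; congr (_ * _).
  by rewrite /F' /partial; have [_ ->] := is_derive_tensE i x (DF ln).
have phiE x : Omega x -> phi x = S x * Psi x.
  move=> Ox; have [Kx|nKx] := pselect (K x); last by rewrite /Psi phi0// mul0r mulr0.
  by rewrite /Psi mulrC divfK// gt_eqF// bS.
have dphiE x : Omega x -> dphi x = Si x * Psi x + S x * D x.
  move=> Ox; have [Kx|nKx] := pselect (K x).
    have Sx : S x != 0 by rewrite gt_eqF// bS.
    by rewrite /Psi /D; field.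
  by rewrite /Psi /D phi0// dphi0// !mul0r subr0 !mulr0 addr0.
apply/eqP; rewrite -addr_eq0; apply/eqP.
pose Nf := \int[leb]_(x in Omega) `|f x|; pose Nk := \int[leb]_(x in Omega) `|k x|.
have Nf0 : 0 <= Nf by exact: Rintegral_ge0.
have Nk0 : 0 <= Nk by exact: Rintegral_ge0.
(* The constant combines [|Si| <= B1] and [|S| <= B0] with an error [e] on [D] and an error [2 M e]
   on [Psi]. *)
apply: (@eq0_eps _ _ ((B1 * (2 * M) + B0) * Nf + (B0 * (2 * M)) * Nk)).
  by rewrite !(addr_ge0, mulr_ge0)// ltW.
move=> e e0; have [I [h [Dh Hh]]] := tens_approx M1 e0 cD PsiD Psi0.
pose p x := \sum_n tens (h n) x; pose pi x := \sum_n tens (dtens (h n) i) x.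
have cp : continuous p by exact: continuous_sum_tens.
have cpi : continuous pi by apply: continuous_sum_tens => n; exact: Dn_dtens.
have Hp x : Omega x -> `|D x - pi x| <= e /\ `|Psi x - p x| <= 2 * M * e by move=> /OM'; exact: Hh.
have cq1 : continuous (fun x => Si x * p x + S x * pi x).
  by move=> x; exact: (continuousD (continuousM (cSi x) (cp x)) (continuousM (cS x) (cpi x))).
have cq2 : continuous (fun x => S x * p x) by move=> x; exact: (continuousM (cS x) (cp x)).
have W := weak_p I h Dh; rewrite -/p -/pi in W.
have i1 := ig f _ fL cdphi; have i2 := ig f _ fL cq1.
have i3 := ig k _ kL cphi; have i4 := ig k _ kL cq2.
rewrite (_ : _ + _ = \int[leb]_(x in Omega) (f x * dphi x - f x * (Si x * p x + S x * pi x)) +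
   \int[leb]_(x in Omega) (k x * phi x - k x * (S x * p x))); last first.
  rewrite (RintegralB mO i1 i2) (RintegralB mO i3 i4) W.
  by move: (Rintegral _ _ _) (Rintegral _ _ _) (Rintegral _ _ _) => z1 z2 z3; ring.
have i5 : leb.-integrable Omega (EFin \o (fun x => ((B1 * (2 * M) + B0) * e) * `|f x|)) by exact: integrableZ_real.
have i6 : leb.-integrable Omega (EFin \o (fun x => ((B0 * (2 * M)) * e) * `|k x|)) by exact: integrableZ_real.
have M2 : 0 <= 2 * M by rewrite mulr_ge0// ltW.
rewrite (_ : e * _ = ((B1 * (2 * M) + B0) * e) * Nf + ((B0 * (2 * M)) * e) * Nk); last first.
  by move: Nf Nk {Nf0 Nk0} => z1 z2; ring.
rewrite /Nf /Nk -(RintegralZl _ mO nf) -(RintegralZl _ mO nk).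
have i12 := integrableB_real mO i1 i2; have i34 := integrableB_real mO i3 i4.
apply: le_trans (ler_normD _ _) _; apply: lerD.
  apply: le_trans (le_normr_Rintegral mO i12) _; apply: le_Rintegral => //; first exact: integrable_norm i12.
  move=> x Ox; have [H1 H2] := Hp x Ox; have xM := OM' x Ox.
  rewrite -mulrBr normrM mulrC ler_wpM2r// dphiE//.
  rewrite (_ : _ - _ = Si x * (Psi x - p x) + S x * (D x - pi x)); last by ring.
  apply: le_trans (ler_normD _ _) _; rewrite !normrM mulrDl lerD//.
    by rewrite -mulrA; apply: ler_pM => //; exact: SiB.
  by apply: ler_pM => //; exact: SB.
apply: le_trans (le_normr_Rintegral mO i34) _; apply: le_Rintegral => //; first exact: integrable_norm i34.
move=> x Ox; have [_ H2] := Hp x Ox; have xM := OM' x Ox.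
rewrite -mulrBr normrM mulrC ler_wpM2r// phiE// -mulrBr normrM -mulrA.
by apply: ler_pM => //; exact: SB.
Qed.

End weak_product.

Section product_rule.
Context {R : realType} {d : nat}.
Notation E := 'rV[R]_d.
Implicit Types (x y : E) (a f g h k : E -> R).
Local Notation ei i := (delta_mx ord0 i : E).
Local Notation leb := (lebesgue_rV d).

Variable Omega : set E.
Hypotheses (oO : open Omega) (bO : bounded_set Omega).

Let mO : measurable Omega. Proof. exact: measurable_open. Qed.

Lemma compact_closure_Omega : compact (closure Omega).
Proof.
have [M _ OM] := bounded_cube bO; apply: subclosed_compact (@compact_cube R d M) _.
  exact: closed_closure.
have cC : closed (cube M : set E) by exact: compact_closed (@norm_hausdorff R E) (@compact_cube R d M).
by rewrite (closure_id (cube M)).1//; exact: closure_subset.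
Qed.

Lemma within_closure_bounded h : {within closure Omega, continuous h} ->
  [/\ forall x, Omega x -> {for x, continuous h}, measurable_fun Omega h &
      exists M, forall x, Omega x -> `|h x| <= M].
Proof.
move=> ch; have hc x : Omega x -> {for x, continuous h}.
  move=> Ox; have : {within Omega, continuous h} by apply: continuous_subspaceW ch; exact: subset_closure.
  by rewrite (continuous_open_subspace h oO) => H; apply: H; exact: mem_set.
split=> //; first exact: measurable_continuous_on.
have [M _ HM] := compact_bounded_fun compact_closure_Omega ch.
by exists M => x Ox; apply: HM; exact: subset_closure.
Qed.

Lemma test_fun_smooth phi i : test_fun Omega phi ->
  [/\ continuous phi, forall x, is_derive x (ei i) phi (partial i phi x) & continuous (partial i phi)].
Proof.
move=> [sphi _ _]; have [cphi /(_ i)[dphi [cd _]]] := sphi 1%N.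
by split=> // x; exact: derivableP.
Qed.

Lemma integrable_test f phi : memL2 leb Omega f -> continuous phi ->
  leb.-integrable Omega (EFin \o (fun x => f x * phi x)).
Proof. by move=> fL cphi; apply: memL2_mul => //; exact: memL2_continuous. Qed.

(** The factor [a] is moved onto the test function: [a phi] is C^1 on the whole space because [phi]
    has compact support in [Omega], and [weak_partial_C1] accepts it. The derivative found is
    [h f + a k], with [h] the classical derivative of [a]. *)
Lemma weak_partial_mul i a f k : is_C1_closure Omega a -> is_weak_partial Omega i f k ->
  has_weak_partial Omega i (fun x => a x * f x).
Proof.
move=> [ca da /(_ i)[h [ch hE]]] fk; have [fL kL _] := fk.
have [cxa ma [Ma aM]] := within_closure_bounded ca.
have [cxh mh [Mh hM]] := within_closure_bounded ch.
have afL := memL2_bounded mO ma aM fL.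
have hfL := memL2_bounded mO mh hM fL.
have akL := memL2_bounded mO ma aM kL.
exists (fun x => h x * f x + a x * k x); split=> //; first exact: memL2D.
move=> phi phiT; have [cphi dphi cdphi] := test_fun_smooth i phiT.
have [_ cK KO] := phiT; set K := closure _ in cK KO.
have phi0 x : ~ K x -> phi x = 0.
  by move=> nKx; apply/eqP; apply: contraT => px; exfalso; apply: nKx; exact: subset_closure.
have nbhsK x : ~ K x -> \near x, ~ K x.
  move=> nKx; apply: open_nbhs_nbhs; split=> //; apply: closed_openC; exact: closed_closure.
have dphi0 x : ~ K x -> partial i phi x = 0.
  move=> nKx; have [_ <-] := dphi x.
  have c0 : is_derive x (ei i) (fun=> 0 : R) 0 by exact: is_derive_cst.
  have H : \near x, (fun=> 0 : R) x = phi x.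
    by apply: filterS (nbhsK _ nKx) => y /phi0 ->.
  by have [_ ->] := near_eq_is_derive H c0.
pose D x := h x * phi x + a x * partial i phi x.
have D0 x : ~ K x -> D x = 0 by move=> nKx; rewrite /D phi0// dphi0// !mulr0 addr0.
have near0 (g : E -> R) x : (forall y, ~ K y -> g y = 0) -> ~ K x -> {for x, continuous g}.
  move=> g0 nKx U; rewrite (g0 x nKx) => nU; change (nbhs x (g @^-1` U)).
  by apply: filterS (nbhsK _ nKx) => y /g0 /= ->; exact: nbhs_singleton.
have aphiD x : is_derive x (ei i) (fun y => a y * phi y) (D x).
  have [Kx|nKx] := pselect (K x).
    have Ox := KO x Kx.
    have aD : is_derive x (ei i) a (h x) by rewrite hE//; apply: derivableP; exact: da.
    by apply: is_derive_eq (is_deriveM aD (dphi x)) _; rewrite /D /GRing.scale /= addrC [_ * h x]mulrC.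
  rewrite D0//; apply: near_eq_is_derive (is_derive_cst 0 x (ei i)).
  by apply: filterS (nbhsK x nKx) => y /= /phi0 ->; rewrite mulr0.
have caphi : continuous (fun y => a y * phi y).
  move=> x; have [Kx|nKx] := pselect (K x).
    exact: (continuousM (cxa x (KO x Kx)) (cphi x)).
  by apply: near0 => // y /phi0 ->; rewrite mulr0.
have cD : continuous D.
  move=> x; have [Kx|nKx] := pselect (K x); last exact: near0.
  exact: (continuousD (continuousM (cxh x (KO x Kx)) (cphi x)) (continuousM (cxa x (KO x Kx)) (cdphi x))).
have aphi0 x : ~ K x -> a x * phi x = 0 by move=> /phi0 ->; rewrite mulr0.
have W := weak_partial_C1 oO bO fk cK KO aphi0 aphiD caphi cD.
have i1 := integrable_test afL cdphi; have i2 := integrable_test hfL cphi.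
have i3 := integrable_test akL cphi.
have E1 : \int[leb]_(x in Omega) (f x * D x) =
    \int[leb]_(x in Omega) (h x * f x * phi x) + \int[leb]_(x in Omega) (a x * f x * partial i phi x).
  by rewrite -RintegralD//; apply: eq_Rintegral => x _; rewrite /D; ring.
have E2 : \int[leb]_(x in Omega) (k x * (a x * phi x)) = \int[leb]_(x in Omega) (a x * k x * phi x).
  by apply: eq_Rintegral => x _; ring.
have E3 : \int[leb]_(x in Omega) ((h x * f x + a x * k x) * phi x) =
    \int[leb]_(x in Omega) (h x * f x * phi x) + \int[leb]_(x in Omega) (a x * k x * phi x).
  by rewrite -RintegralD//; apply: eq_Rintegral => x _; ring.
move: W; rewrite E1 E2 E3.
move: (Rintegral _ _ _) (Rintegral _ _ _) (Rintegral _ _ _) => z1 z2 z3 W.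
by rewrite opprD -W addrA addNr add0r.
Qed.

Lemma weak_partialP i f : has_weak_partial Omega i f ->
  is_weak_partial Omega i f (weak_partial Omega i f).
Proof. by move=> [h hP]; exact: (xgetPex (cst 0)) (ex_intro _ h hP). Qed.

Lemma weak_partial_sum i (F : 'I_d -> E -> R) :
  (forall j, has_weak_partial Omega i (F j)) ->
  has_weak_partial Omega i (fun x => \sum_j F j x).
Proof.
move=> /choice[k kP]; exists (fun x => \sum_j k j x); split.
- by apply: memL2_sum => // j; have [] := kP j.
- by apply: memL2_sum => // j; have [] := kP j.
move=> phi phiT; have [cphi dphi cdphi] := test_fun_smooth i phiT.
transitivity (\int[leb]_(x in Omega) \sum_j (F j x * partial i phi x)).
  by apply: eq_Rintegral => x _; rewrite mulr_suml.
rewrite (Rintegral_sum mO)//; last by move=> j; apply: integrable_test => //; have [] := kP j.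
rewrite [X in - X](_ : _ = \int[leb]_(x in Omega) \sum_j (k j x * phi x)); last first.
  by apply: eq_Rintegral => x _; rewrite mulr_suml.
rewrite (Rintegral_sum mO)//; last by move=> j; apply: integrable_test => //; have [] := kP j.
by rewrite -sumrN; apply: eq_bigr => j _; have [_ _ ->] := kP j.
Qed.

End product_rule.

(** * Green's formula *)

Lemma memLinfty d (X : measurableType d) (R : realType) (mu : {measure set X -> \bar R})
    (D : set X) (f : X -> R) : measurable D -> memLp mu +oo%E D f ->
  measurable_fun D f /\ exists2 M, 0 <= M & {ae mu, forall x, D x -> `|f x| <= M}.
Proof.
move=> mD; rewrite /memLp inE => /andP[mf nf].
split; first by apply/(measurable_restrictT _ mD); rewrite inE in mf.
have H : (forall x, x \in D -> (f \_ D) x = f x) by move=> x xD; rewrite patchE xD.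
have : ('N[mu]_+oo[EFin \o (f \_ D)] < +oo)%E by move: nf; rewrite inE.
(* The norm is an essential supremum only when the measure is nonzero; for the zero measure any
   bound holds almost everywhere. *)
rewrite unlock /=; case: ifPn => [_|mu0 _]; last first.
  exists 0 => //; exists setT; split=> //.
  by apply/eqP; rewrite eq_le measure_ge0 andbT leNgt.
have := ess_sup_inf.ess_sup_ge mu (abse \o (EFin \o (f \_ D))).
case: (ess_sup_inf.ess_sup _ _) => [r| |] fr // _.
- exists (Num.max r 0); first by rewrite le_max lexx orbT.
  apply: ae_mono fr => x /= + Dx; rewrite H ?inE// lee_fin => /le_trans; apply.
  by rewrite le_max lexx.
- by exists 0 => //; apply: ae_mono fr => x /=; rewrite leeNy_eq.
Qed.

Lemma Rintegral_ae_ge0 d (X : measurableType d) (R : realType) (mu : {measure set X -> \bar R})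
    (D : set X) (f : X -> R) : measurable D -> measurable_fun D f ->
  {ae mu, forall x, D x -> 0 <= f x} -> 0 <= \int[mu]_(x in D) f x.
Proof.
move=> mD mf f0; rewrite (@ae_eq_Rintegral _ _ _ mu D mD f (fun x => `|f x|)) //.
- exact: Rintegral_ge0.
- exact: measurableT_comp.
- by apply: ae_mono f0 => x + Dx => /(_ Dx) x0; rewrite ger0_norm.
Qed.

Lemma quad_formE (R : comNzRingType) d (M : 'M[R]_d) (p q : 'I_d -> R) :
  \sum_i \sum_j M i j * p j * p i - \sum_i \sum_j M i j * p j * q i -
  (\sum_i \sum_j M i j * q j * p i - \sum_i \sum_j M i j * q j * q i) =
  ((\row_j (p j - q j)) *m M *m (\row_j (p j - q j))^T) ord0 ord0.
Proof.
rewrite -!sumrB mxE; under [RHS]eq_bigr => j _ do rewrite !mxE mulr_suml.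
rewrite exchange_big /=; apply: eq_bigr => i _; rewrite -!sumrB.
by apply: eq_bigr => j _; rewrite !mxE; ring.
Qed.

(* Otherwise comparing two distinct weak derivatives unfolds [xget] and the
   integrals inside it, and conversion diverges. *)
Local Opaque weak_partial.

Section green.
Context {R : realType} {d : nat}.
Notation E := 'rV[R]_d.
Implicit Types (x y : E) (f g w : E -> R).
Local Notation leb := (lebesgue_rV d).

Variables (Omega : set E) (A : E -> 'M[R]_d) (c : E -> R).
Hypotheses (oO : open Omega) (bO : bounded_set Omega) (coeffs : elliptic_coeffs Omega A c).

Let mO : measurable Omega. Proof. exact: measurable_open. Qed.

(** For the test functions approximating [w] in H^1 this is the definition of the weak derivative of
    [F]; by Cauchy-Schwarz both sides pass to the limit. *)
Lemma weak_green i (F w : E -> R) : has_weak_partial Omega i F -> memH10 Omega w ->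
  \int[leb]_(x in Omega) (F x * weak_partial Omega i w x) =
  - \int[leb]_(x in Omega) (weak_partial Omega i F x * w x).
Proof.
move=> /weak_partialP[FL kL Fk] [[wL wi] [phi [phiT phi0 phi1]]].
set k := weak_partial Omega i F in kL Fk *.
have [_ wiL _] := weak_partialP (wi i); set w' := weak_partial Omega i w in wiL *.
have p0L n : memL2 leb Omega (phi n).
  by apply: memL2_continuous => //; have [] := test_fun_smooth i (phiT n).
have p1L n : memL2 leb Omega (partial i (phi n)).
  by apply: memL2_continuous => //; have [] := test_fun_smooth i (phiT n).
apply/eqP; rewrite -addr_eq0; apply/eqP.
apply: (@eq0_eps _ _ (normL2 leb Omega F + normL2 leb Omega k)).
  by rewrite addr_ge0// normL2_ge0.
move=> e e0.
have [n [n0 n1]] : exists n, normL2 leb Omega (w \- phi n) < e /\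
    normL2 leb Omega (w' \- partial i (phi n)) < e.
  have /cvgrPdist_lt/(_ e e0) H0 := phi0; have /cvgrPdist_lt/(_ e e0) H1 := phi1 i.
  near \oo => n; exists n; split.
    have : `|0 - normL2 leb Omega (w \- phi n)| < e by near: n.
    by rewrite sub0r normrN ger0_norm ?normL2_ge0.
  have : `|0 - normL2 leb Omega (weak_partial Omega i w \- partial i (phi n))| < e by near: n.
  by rewrite sub0r normrN ger0_norm ?normL2_ge0.
have b0 := cauchy_schwarz mO kL (memL2B mO wL (p0L n)).
have b1 := cauchy_schwarz mO FL (memL2B mO wiL (p1L n)).
rewrite (_ : _ + _ = \int[leb]_(x in Omega) (F x * (w' x - partial i (phi n) x)) +
    \int[leb]_(x in Omega) (k x * (w x - phi n x))); last first.
  under [X in _ = X + _]eq_Rintegral do rewrite mulrBr.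
  under [X in _ = _ + X]eq_Rintegral do rewrite mulrBr.
  rewrite RintegralB//; try exact: memL2_mul.
  rewrite RintegralB//; try exact: memL2_mul.
  rewrite Fk//; move: (Rintegral _ _ _) (Rintegral _ _ _) (Rintegral _ _ _) => z1 z2 z3; ring.
apply: le_trans (ler_normD _ _) _; rewrite mulrDr lerD//.
  apply: le_trans b1 _; rewrite mulrC; apply: ler_wpM2r; [exact: normL2_ge0|exact: ltW].
by apply: le_trans b0 _; rewrite mulrC; apply: ler_wpM2r; [exact: normL2_ge0|exact: ltW].
Unshelve. all: by end_near. Qed.

Definition energy_form f w x : R :=
  \sum_(i < d) \sum_(j < d) A x i j * weak_partial Omega j f x * weak_partial Omega i w x
  + c x * f x * w x.

Lemma memH1_partial f i : memH1 Omega f -> memL2 leb Omega (weak_partial Omega i f).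
Proof. by move=> [_ /(_ i)/weak_partialP[]]. Qed.

Lemma coeff_bounded i j : measurable_fun Omega (fun x => A x i j) /\
  exists M, forall x, Omega x -> `|A x i j| <= M.
Proof.
have [/(_ i j)[ca _ _] _ _ _ _] := coeffs.
by have [_ ? ?] := within_closure_bounded oO bO ca.
Qed.

Lemma memL2_coeff i j f : memL2 leb Omega f -> memL2 leb Omega (fun x => A x i j * f x).
Proof.
by move=> fL; have [mA [M AM]] := coeff_bounded i j; exact: (memL2_bounded mO mA AM fL).
Qed.

Lemma memL2_potential f : memL2 leb Omega f -> memL2 leb Omega (fun x => c x * f x).
Proof.
move=> fL; have [_ _ _ /(memLinfty mO)[mc [M M0 cM]] _] := coeffs.
(* [c] is bounded only almost everywhere; the truncation is bounded everywhere and agrees with it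
   almost everywhere. *)
pose c' x := Num.max (- M) (Num.min (c x) M).
have mc' : measurable_fun Omega c'.
  by apply: measurable_maxr => //; apply: measurable_minr.
have c'M x : Omega x -> `|c' x| <= M.
  move=> _; rewrite /c' ler_norml le_max lexx /= ge_max ge_min lexx orbT andbT.
  by rewrite -subr_ge0 opprK addr_ge0.
apply: (ae_memL2 mO _ _ (memL2_bounded mO mc' c'M fL)).
  by apply: measurable_funM => //; exact: memL2_meas fL.
apply: ae_mono cM => x + Ox => /(_ Ox); rewrite ler_norml => /andP[c1 c2].
by rewrite /c' min_l// max_r.
Qed.

(** Otherwise the derivative of the flux in [elliptic_op] could be the default value 0 of
    [weak_partial]; the product rule with C^1 coefficients excludes this. *)
Lemma flux_weak_partial f i : memH2 Omega f ->
  has_weak_partial Omega i (fun y => \sum_(j < d) A y i j * weak_partial Omega j f y).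
Proof.
move=> [_ fH]; apply: weak_partial_sum => // j.
have [caij _ _ _ _] := coeffs; have [_ /(_ i) [k kP]] := fH j.
exact: (weak_partial_mul oO bO (caij i j) kP).
Qed.

Lemma memL2_elliptic f : memH2 Omega f -> memL2 leb Omega (elliptic_op Omega A c f).
Proof.
move=> fH; apply: memL2D => //; last by apply: memL2_potential; case: fH => -[].
apply: memL2N => //; apply: memL2_sum => // i.
by have [_ kL _] := weak_partialP (flux_weak_partial i fH).
Qed.

Lemma integrable_energy f w : memH1 Omega f -> memH1 Omega w ->
  leb.-integrable Omega (EFin \o energy_form f w).
Proof.
move=> fH wH; have [[fL _] [wL _]] := (fH, wH).
apply: integrableD_real => //; last by apply: memL2_mul => //; exact: memL2_potential.
apply: integrable_sum_real => // i _; apply: integrable_sum_real => // j _.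
by apply: memL2_mul => //; [apply: memL2_coeff; exact: memH1_partial|exact: memH1_partial].
Qed.

Lemma green f w : memH2 Omega f -> memH10 Omega w ->
  \int[leb]_(x in Omega) (elliptic_op Omega A c f x * w x) =
  \int[leb]_(x in Omega) energy_form f w x.
Proof.
move=> fH wH; have [[fL fi] _] := fH; have [[wL wi] _] := wH.
pose F i y := \sum_(j < d) A y i j * weak_partial Omega j f y.
have FL i : memL2 leb Omega (F i) by have [] := flux_weak_partial i fH => k [].
have kL i : memL2 leb Omega (weak_partial Omega i (F i)).
  by have [_ ? _] := weak_partialP (flux_weak_partial i fH).
have wiL i : memL2 leb Omega (weak_partial Omega i w) by exact: memH1_partial.
have cfL := memL2_potential fL.
transitivity (\int[leb]_(x in Omega) ((\sum_(i < d) (- 1) * (weak_partial Omega i (F i) x * w x)) + c x * f x * w x)).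
  apply: eq_Rintegral => x _; rewrite /elliptic_op mulrDl; congr (_ + _).
  by rewrite -mulr_sumr mulN1r mulNr mulr_suml.
have ikw i : leb.-integrable Omega (EFin \o (fun x => (- 1) * (weak_partial Omega i (F i) x * w x))).
  by apply: integrableZ_real => //; exact: memL2_mul.
have iFw i : leb.-integrable Omega (EFin \o (fun x => F i x * weak_partial Omega i w x)).
  exact: memL2_mul.
have icw : leb.-integrable Omega (EFin \o (fun x => c x * f x * w x)) by exact: memL2_mul.
rewrite RintegralD//; last exact: integrable_sum_real.
rewrite (Rintegral_sum mO)//.
transitivity (\int[leb]_(x in Omega) ((\sum_(i < d) F i x * weak_partial Omega i w x) + c x * f x * w x)); last first.
  by apply: eq_Rintegral => x _; congr (_ + _); apply: eq_bigr => i _; rewrite mulr_suml.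
rewrite RintegralD//; last exact: integrable_sum_real.
rewrite (Rintegral_sum mO)//; congr (_ + _); apply: eq_bigr => i _.
rewrite RintegralZl//; last exact: memL2_mul.
by rewrite mulN1r (weak_green (flux_weak_partial i fH) wH).
Qed.

Lemma energy_formC f w x : Omega x -> energy_form f w x = energy_form w f x.
Proof.
move=> Ox; have [_ AT _ _ _] := coeffs; have {}AT := AT x (subset_closure Ox).
have AE i j : A x j i = A x i j by have /matrixP/(_ i j) := AT; rewrite mxE.
rewrite /energy_form [c x * w x * _]mulrAC; congr (_ + _).
rewrite exchange_big /=; apply: eq_bigr => i _; apply: eq_bigr => j _.
by rewrite (AE i j); exact: mulrAC.
Qed.

Lemma elliptic_sym f w : memH2 Omega f -> memH10 Omega f -> memH2 Omega w -> memH10 Omega w ->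
  \int[leb]_(x in Omega) (elliptic_op Omega A c f x * w x) =
  \int[leb]_(x in Omega) (f x * elliptic_op Omega A c w x).
Proof.
move=> f2 f0 w2 w0; rewrite green//.
transitivity (\int[leb]_(x in Omega) energy_form w f x).
  by apply: eq_Rintegral => x; rewrite inE; exact: energy_formC.
by rewrite -green//; apply: eq_Rintegral => x _; rewrite mulrC.
Qed.

(** The four terms expand the form at [f - g]. That function is not formed, because the
    representative selected for its weak derivative need not be the difference of those of [f] and
    [g]. *)
Lemma energy_form_ge0 f g : {ae leb, forall x, Omega x ->
  0 <= energy_form f f x - energy_form f g x - (energy_form g f x - energy_form g g x)}.
Proof.
have [_ _ Apos _ c0] := coeffs; apply: ae_mono c0 => x + Ox => /(_ Ox) cx.
pose xi : 'rV[R]_d := \row_j (weak_partial Omega j f x - weak_partial Omega j g x).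
rewrite (_ : _ - _ - _ = (xi *m A x *m xi^T) ord0 ord0 + c x * (f x - g x) ^+ 2).
  apply: addr_ge0; last by apply: mulr_ge0 => //; exact: sqr_ge0.
  have [->|xi0] := eqVneq xi 0; first by rewrite !mul0mx mxE.
  by rewrite ltW// Apos//; exact: subset_closure.
rewrite -quad_formE /energy_form; move: (\sum_i _) (\sum_i _) (\sum_i _) (\sum_i _) => s1 s2 s3 s4.
by ring.
Qed.

Lemma elliptic_monotone f g : memH2 Omega f -> memH10 Omega f -> memH2 Omega g -> memH10 Omega g ->
  0 <= \int[leb]_(x in Omega)
    ((elliptic_op Omega A c f x - elliptic_op Omega A c g x) * (f x - g x)).
Proof.
move=> f2 f0 g2 g0; have [f1 _] := f2; have [g1 _] := g2.
have [fL _] := f1; have [gL _] := g1.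
have LfL := memL2_elliptic f2; have LgL := memL2_elliptic g2.
have i1 := memL2_mul mO LfL fL; have i2 := memL2_mul mO LfL gL.
have i3 := memL2_mul mO LgL fL; have i4 := memL2_mul mO LgL gL.
have e1 := integrable_energy f1 f1; have e2 := integrable_energy f1 g1.
have e3 := integrable_energy g1 f1; have e4 := integrable_energy g1 g1.
rewrite (_ : \int[leb]_(x in Omega) _ = \int[leb]_(x in Omega)
  (energy_form f f x - energy_form f g x - (energy_form g f x - energy_form g g x))); last first.
  rewrite RintegralB//; try exact: integrableB_real.
  rewrite RintegralB// RintegralB// -!green//.
  rewrite -RintegralB// -RintegralB// -RintegralB//; try exact: integrableB_real.
  by apply: eq_Rintegral => x _; ring.
apply: Rintegral_ae_ge0 => //; last exact: energy_form_ge0.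
by apply: (@integrable_real_meas _ _ _ leb); do 2 apply: integrableB_real => //.
Qed.

End green.

(** * Functions on the space-time cylinder *)

(** The integral of a nonnegative function is a supremum over the simple functions below it, hence
    monotone on arbitrary functions. This matters for the Bochner spaces, whose definition does not
    state that the norm of [u(.,t)] is measurable in [t]. *)
Lemma ge0_le_integral_sup d (X : measurableType d) (R : realType) (mu : {measure set X -> \bar R})
    (D : set X) (f g : X -> \bar R) : (forall x, D x -> (0 <= f x)%E) ->
  (forall x, D x -> (f x <= g x)%E) ->
  (\int[mu]_(x in D) f x <= \int[mu]_(x in D) g x)%E.
Proof.
move=> f0 fg; rewrite !(integral_mkcond D).
have fD0 x : (0 <= (f \_ D) x)%E by exact: erestrict_ge0.
have fgD x : ((f \_ D) x <= (g \_ D) x)%E by exact: lee_restrict.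
rewrite ge0_integralTE//.
rewrite ge0_integralTE; last by move=> x; exact: le_trans (fgD x).
apply: le_ereal_sup => _ [h hf <-]; exists h => // x.
exact: le_trans (hf x) (fgD x).
Qed.

Lemma ae_ge0_le_integral_sup d (X : measurableType d) (R : realType) (mu : {measure set X -> \bar R})
    (D : set X) (f g : X -> \bar R) : measurable D -> measurable_fun D f ->
  (forall x, D x -> (0 <= f x)%E) -> (forall x, D x -> (0 <= g x)%E) ->
  {ae mu, forall x, D x -> (f x <= g x)%E} ->
  (\int[mu]_(x in D) f x <= \int[mu]_(x in D) g x)%E.
Proof.
move=> mD mf f0 g0 [N [mN N0 fgN]].
pose f' x := (f x * (\1_(~` N) x)%:E)%E.
have mI : measurable_fun D (fun x => (\1_(~` N) x : R)%:E).
  by apply/measurable_EFinP; apply: measurable_indic; exact: measurableC.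
have -> : (\int[mu]_(x in D) f x = \int[mu]_(x in D) f' x)%E.
  apply: ae_eq_integral => //; first exact: emeasurable_funM.
  exists N; split=> // x /= /not_implyP[Dx]; apply: contra_notP => nNx.
  by rewrite /f' indicE mem_set//= mule1.
apply: ge0_le_integral_sup => x Dx.
  by apply: mule_ge0; [exact: f0|rewrite lee_fin].
rewrite /f' indicE; case: (boolP (x \in ~` N)) => [|_]; last by rewrite mule0 g0.
rewrite inE mule1 => nNx; apply: contrapT => H; apply: nNx; apply: fgN => /=.
by move/(_ Dx).
Qed.

Section cylinder.
Context {R : realType} {d : nat}.
Notation E := 'rV[R]_d.
Local Notation leb := (lebesgue_rV d).
Local Notation lebt := (@lebesgue_measure R).
Local Notation RR := (measurableTypeR R).
Variables (T : R) (Omega : set E).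
Hypothesis mO : measurable Omega.
Local Notation I := (`]0, T[%classic : set R).
Let mI : @measurable _ RR I. Proof. exact: measurable_itv. Qed.

(** By Tonelli's theorem the integral over time of the squared norms is an integral over the
    cylinder; from here on Bochner spaces give way to ordinary square integrability. *)
Lemma memL2L2_cylinder (u : E -> R -> R) : memL2L2 T Omega u ->
  memL2 (leb \x lebt)%E (cylinder Omega T) (fun p => u p.1 p.2).
Proof.
move=> [mu [uV _ ub]]; have mC : measurable (cylinder Omega T) by exact: measurableX.
apply/(@memL2P _ (E * RR)%type R (leb \x lebt)%E _ mC); split => //; apply/integrableP; split.
  by apply/measurable_EFinP; exact: measurable_funX.
have mu2 : measurable_fun (Omega `*` I) (fun p => (u p.1 p.2) ^+ 2) by exact: measurable_funX.
have u2 : forall p, (Omega `*` I) p -> 0 <= (u p.1 p.2) ^+ 2 by move=> p _; exact: sqr_ge0.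
under eq_integral do rewrite /= ger0_norm ?sqr_ge0//.
rewrite (tonelli2 leb lebt mO mI mu2 u2).
apply: le_lt_trans ub; apply: ae_ge0_le_integral_sup => //.
- exact: (measurable_tonelli2 leb mO mI mu2 u2).
- by move=> t _; apply: integral_ge0 => x _; rewrite lee_fin sqr_ge0.
- by move=> t _; rewrite lee_fin sqr_ge0.
- apply: ae_mono uV => t + It; rewrite inE => /(_ It) uL.
  have u2i := memL2_sqr mO uL.
  by rewrite normL2_sqr /Rintegral fineK//; exact: integrable_fin_num u2i.
Qed.

End cylinder.

Section tensor_L2.
Context {d1 d2 : measure_display} {X : measurableType d1} {Y : measurableType d2} {R : realType}.
Variables (m1 : {sigma_finite_measure set X -> \bar R}) (m2 : {sigma_finite_measure set Y -> \bar R}).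
Variables (D1 : set X) (D2 : set Y).
Hypotheses (mD1 : measurable D1) (mD2 : measurable D2).

Lemma measurable_fst_on (f : X -> R) : measurable_fun D1 f ->
  measurable_fun (D1 `*` D2) (fun p => f p.1).
Proof.
move=> mf mD B mB; rewrite (_ : _ `&` _ = (D1 `&` f @^-1` B) `*` D2).
  by apply: measurableX => //; exact: mf.
by apply/seteqP; split => -[x y] /=; [move=> [[? ?] ?]|move=> [[? ?] ?]].
Qed.

Lemma measurable_snd_on (g : Y -> R) : measurable_fun D2 g ->
  measurable_fun (D1 `*` D2) (fun p => g p.2).
Proof.
move=> mg mD B mB; rewrite (_ : _ `&` _ = D1 `*` (D2 `&` g @^-1` B)).
  by apply: measurableX => //; exact: mg.
by apply/seteqP; split => -[x y] /=; [move=> [[? ?] ?]|move=> [? [? ?]]].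
Qed.

Lemma memL2_tensor (f : X -> R) (g : Y -> R) : memL2 m1 D1 f -> memL2 m2 D2 g ->
  memL2 (m1 \x m2)%E (D1 `*` D2) (fun p => f p.1 * g p.2).
Proof.
move=> /(memL2P _ mD1)[mf fi] /(memL2P _ mD2)[mg gi].
have mD : measurable (D1 `*` D2) by exact: measurableX.
have mfg : measurable_fun (D1 `*` D2) (fun p => f p.1 * g p.2).
  by apply: measurable_funM; [exact: measurable_fst_on|exact: measurable_snd_on].
have mfg2 : measurable_fun (D1 `*` D2) (fun p => (f p.1 * g p.2) ^+ 2) by exact: measurable_funX.
apply/(@memL2P _ _ R (m1 \x m2)%E _ mD); split => //; apply/integrableP; split; first exact/measurable_EFinP.
under eq_integral do rewrite /= ger0_norm ?sqr_ge0//.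
rewrite (tonelli1 m1 m2 mD1 mD2 mfg2) => [|p _]; last exact: sqr_ge0.
have gfin : (\int[m2]_(y in D2) (g y ^+ 2)%:E)%E \is a fin_num by exact: integrable_fin_num gi.
have ffin : (\int[m1]_(x in D1) (f x ^+ 2)%:E)%E \is a fin_num by exact: integrable_fin_num fi.
rewrite (_ : integral _ _ _ = (\int[m1]_(x in D1) ((f x ^+ 2)%:E * \int[m2]_(y in D2) (g y ^+ 2)%:E))%E).
  rewrite ge0_integralZr//; last 2 first.
  - by move=> x _; rewrite lee_fin sqr_ge0.
  - by apply: integral_ge0 => y _; rewrite lee_fin sqr_ge0.
  - by rewrite -(fineK gfin) -(fineK ffin) -EFinM ltry.
  - by apply/measurable_EFinP; exact: measurable_funX.
apply: eq_integral => x _; rewrite -ge0_integralZl//; last 3 first.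
- by apply/measurable_EFinP; exact: measurable_funX.
- by move=> y _; rewrite lee_fin sqr_ge0.
- by rewrite lee_fin sqr_ge0.
by apply: eq_integral => y _; rewrite -EFinM /= exprMn.
Qed.

End tensor_L2.

Section time_representation.
Context {R : realType} {d : nat}.
Notation E := 'rV[R]_d.
Local Notation leb := (lebesgue_rV d).
Local Notation lebt := (@lebesgue_measure R).
Local Notation RR := (measurableTypeR R).
Variables (T : R) (Omega : set E).
Hypotheses (T0 : 0 < T) (mO : measurable Omega).
Local Notation I := (`]0, T[%classic : set R).
Let mI : @measurable _ RR I. Proof. exact: measurable_itv. Qed.
Implicit Types (u h : E -> R -> R).
Local Notation L2cyl u := (memL2 (leb \x lebt)%E (Omega `*` I) (fun p => u p.1 p.2)).

Lemma ae_memL2_section u : L2cyl u -> {ae leb, forall x, Omega x -> memL2 lebt I (u x)}.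
Proof. exact: (ae_memL2_section1 (m1 := leb) (m2 := lebt) mO mI). Qed.

Lemma weak_dt_primitive u h : L2cyl u -> L2cyl h ->
  (forall phi, time_test_fun T phi -> {ae leb, forall x, Omega x ->
     \int[lebt]_(t in I) (u x t * derive1 phi t) = - \int[lebt]_(t in I) (h x t * phi t)}) ->
  {ae leb, forall x, Omega x -> exists C : R, {ae lebt, forall t, I t -> u x t = C + primitive (h x) t}}.
Proof.
move=> uL hL uh.
(* The weak identity against the k-th member of the family [dbr_fun]. There are countably many, so
   they hold together outside a single null set of [x]. *)
pose P (k : nat) (x : E) := if @unpickle ((rat * rat) * (nat * nat))%type k is Some ((q, q'), (n, n'))
  then 0 < (ratr q : R) < T -> 0 < (ratr q' : R) < T -> Omega x ->
    let f := dbr_fun T (ratr q) (ratr q') n n' in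
    \int[lebt]_(t in I) (u x t * f t) =
    - \int[lebt]_(t in I) (h x t * \int[lebt]_(s in `]0, t[) f s)
  else True.
have : {ae leb, forall x, forall k, P k x}.
  apply: ae_foralln => k; rewrite /P; case: unpickle => [[[q q'] [n n']]|]; last first.
    by apply: (@ae_mono _ _ _ leb (fun x : E => Omega x -> memL2 lebt I (u x))) (ae_memL2_section uL).
  have [qT|qT] := boolP (0 < (ratr q : R) < T); last first.
    by apply: (@ae_mono _ _ _ leb (fun x : E => Omega x -> memL2 lebt I (u x))) (ae_memL2_section uL) => ? ?.
  have [q'T|q'T] := boolP (0 < (ratr q' : R) < T); last first.
    by apply: (@ae_mono _ _ _ leb (fun x : E => Omega x -> memL2 lebt I (u x))) (ae_memL2_section uL) => ? ? ?.
  have [phi [phiT phiE phiI]] := dbr_test_fun n n' qT q'T.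
  apply: ae_mono (uh phi phiT) => x + _ _ Ox => /(_ Ox); rewrite phiE => ->; congr (- _).
  by apply: eq_Rintegral => t; rewrite inE => It; rewrite phiI.
move=> HP; have uS := ae_memL2_section uL; have hS := ae_memL2_section hL.
apply: ae_mono2 (ae_conj uS hS) HP => x + HPx Ox => /(_ Ox)[ux hx].
apply: (du_bois_reymond T0 (memL2_integrable ux) (memL2_integrable hx)) => q q' n n' qT q'T.
by have := HPx (pickle ((q, q'), (n, n'))); rewrite /P pickleK; exact.
Qed.

Lemma le_ae_Rintegral d' (X : measurableType d') (mu : {measure set X -> \bar R}) (D : set X) (f g : X -> R) :
  measurable D -> mu.-integrable D (EFin \o f) -> mu.-integrable D (EFin \o g) ->
  {ae mu, forall x, D x -> f x <= g x} -> \int[mu]_(x in D) f x <= \int[mu]_(x in D) g x.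
Proof.
move=> mD fi gi fg; rewrite -subr_ge0 -(RintegralB mD gi fi).
apply: Rintegral_ae_ge0 => //; first exact: integrable_real_meas (integrableB_real mD gi fi).
by apply: ae_mono fg => x + Dx => /(_ Dx); rewrite subr_ge0.
Qed.

(** [C] may come from a pointwise selection that is not measurable in [x], so its square is not
    integrated. It is bounded instead by the infimum of measurable functions [F n], which has zero
    integral since some [F n] have arbitrarily small ones. *)
Lemma ae_const_eq0 (y : E -> R -> R) (H : E -> R) (lo hi : nat -> R) (C : E -> R) :
  L2cyl y -> leb.-integrable Omega (EFin \o H) -> (forall x, 0 <= H x) ->
  (forall n, lo n < hi n) -> (forall n, `]lo n, hi n[ `<=` I) ->
  (forall e, 0 < e -> exists n, hi n - lo n <= e /\
     {ae lebt, forall t, `]lo n, hi n[%classic t -> \int[leb]_(x in Omega) (y x t ^+ 2) <= e}) ->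
  {ae leb, forall x, Omega x -> forall n, (hi n - lo n) * C x ^+ 2 <=
     2 * \int[lebt]_(t in `]lo n, hi n[) (y x t ^+ 2) + 2 * (hi n - lo n) ^+ 2 * H x} ->
  {ae leb, forall x, Omega x -> C x = 0}.
Proof.
move=> yL Hi H0 lohi sub small Cb.
have mJ n : @measurable _ RR `]lo n, hi n[%classic by exact: measurable_itv.
have mC : measurable (Omega `*` I : set (E * RR)) by exact: measurableX.
have mCJ n : measurable (Omega `*` `]lo n, hi n[ : set (E * RR)) by exact: measurableX.
have y2 := @memL2_sqr _ (E * RR)%type R (leb \x lebt)%E _ mC _ yL.
have y2J n : (leb \x lebt)%E.-integrable (Omega `*` `]lo n, hi n[) (EFin \o (fun p : E * RR => y p.1 p.2 ^+ 2)).
  apply: (@integrableS _ (E * RR)%type R (leb \x lebt)%E (Omega `*` I)) => //.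
  by move=> [x t] [/= Ox Jt]; split=> //; exact: (sub n).
pose F n x := 2 * (hi n - lo n)^-1 * (\int[lebt]_(t in `]lo n, hi n[) (y x t ^+ 2)) + 2 * (hi n - lo n) * H x.
have F1i n : leb.-integrable Omega (EFin \o (fun x => \int[lebt]_(t in `]lo n, hi n[) (y x t ^+ 2))).
  exact: (integrable_Rintegral1 mO (mJ n) (y2J n)).
have Fi n : leb.-integrable Omega (EFin \o F n).
  by apply: integrableD_real => //; exact: integrableZ_real.
have e0 n : 0 < hi n - lo n by rewrite subr_gt0.
have F0 n x : 0 <= F n x.
  apply: addr_ge0; apply: mulr_ge0 => //; rewrite ?mulr_ge0 ?invr_ge0 ?(ltW (e0 n))//.
  by apply: Rintegral_ge0 => t _; exact: sqr_ge0.
pose G x := einfs (fun n => (F n x)%:E) 0%N.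
have GF n x : (G x <= (F n x)%:E)%E by apply: ereal_inf_lbound; exists n.
have G0 x : (0 <= G x)%E by apply: le_ereal_inf_tmp => _ [n _ <-]; rewrite lee_fin.
have mG : measurable_fun Omega G.
  by apply: measurable_fun_einfs => n; exact: measurable_int (Fi n).
have IH0 : 0 <= \int[leb]_(x in Omega) H x by apply: Rintegral_ge0.
have IF e : 0 < e -> (\int[leb]_(x in Omega) G x <= (2 * e + 2 * e * \int[leb]_(x in Omega) H x)%:E)%E.
  move=> e_gt0; have [n [ne yn]] := small e e_gt0.
  apply: (@le_trans _ _ (\int[leb]_(x in Omega) (F n x)%:E)%E).
    by apply: ge0_le_integral => //; exact: measurable_int (Fi n).
  rewrite -(fineK (integrable_fin_num mO (Fi n))) lee_fin -/(Rintegral leb Omega (F n)).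
  rewrite /F RintegralD//; try exact: integrableZ_real.
  rewrite (RintegralZl _ mO (F1i n)) (RintegralZl _ mO Hi); apply: lerD; last first.
    by apply: ler_wpM2r => //; apply: ler_wpM2l.
  rewrite -mulrA; apply: ler_wpM2l => //; rewrite ler_pdivrMl//.
  rewrite -(Rintegral_fubini1 mO (mJ n) (y2J n)) (Rintegral_fubini2 mO (mJ n) (y2J n)).
  rewrite [leRHS]mulrC -(Rintegral_cst_oo e (ltW (lohi n))).
  apply: le_ae_Rintegral => //; first exact: (integrable_Rintegral2 mO (mJ n) (y2J n)).
  apply: (measurable_bounded_integrable (mJ n)) => //; first exact: lebesgue_measure_oo_lty.
  by exists `|e|; split; [exact: num_real|move=> M M1 t _; rewrite ltW].
have IG : (\int[leb]_(x in Omega) `|G x| = 0)%E.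
  under eq_integral do rewrite gee0_abs//.
  apply/eqP; rewrite eq_le integral_ge0 ?andbT => [|x _]; last exact: G0.
  apply/lee_addgt0Pr => e e_gt0; rewrite add0e.
  pose K := 2 + 2 * \int[leb]_(x in Omega) H x.
  have K0 : 0 < K by rewrite ltr_pwDl// mulr_ge0.
  apply: le_trans (IF (e / K) (divr_gt0 e_gt0 K0)) _; rewrite lee_fin.
  rewrite (_ : _ + _ = e / K * K); first by rewrite divfK// gt_eqF.
  by rewrite /K; move: (Rintegral _ _ _) => z; ring.
have /(ae_eq_integral_abs leb mO mG) Gae := IG.
apply: ae_mono2 Gae Cb => x /= Gx Cx Ox; apply/eqP; rewrite -sqrf_eq0 eq_le sqr_ge0 andbT.
suff : ((C x ^+ 2)%:E <= G x)%E by rewrite (Gx Ox) lee_fin.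
apply: le_ereal_inf_tmp => _ [n _ <-]; rewrite lee_fin /F.
have := Cx Ox n; move: (Rintegral _ _ _) => z.
rewrite -ler_pdivlMl// => /le_trans; apply.
rewrite mulrDr; apply: lerD; first by rewrite mulrA [_^-1 * 2]mulrC.
have := e0 n; move: (hi n - lo n) (H x) => r k r0.
by rewrite (_ : r^-1 * _ = 2 * r * k)//; field; rewrite gt_eqF.
Qed.

End time_representation.

Section time_value.
Context {R : realType} {d : nat}.
Notation E := 'rV[R]_d.
Local Notation leb := (lebesgue_rV d).
Local Notation lebt := (@lebesgue_measure R).
Local Notation RR := (measurableTypeR R).
Variables (T : R) (Omega : set E).
Hypotheses (T0 : 0 < T) (mO : measurable Omega).
Local Notation I := (`]0, T[%classic : set R).
Let mI : @measurable _ RR I. Proof. exact: measurable_itv. Qed.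
Implicit Types (u h : E -> R -> R).
Local Notation L2cyl u := (memL2 (leb \x lebt)%E (Omega `*` I) (fun p => u p.1 p.2)).

Let mC : measurable (Omega `*` I : set (E * RR)). Proof. exact: measurableX. Qed.

Lemma memL2_one : memL2 lebt I (fun=> 1 : R).
Proof. by apply: (memL2_bounded_fun (M := 1)) => // t _; rewrite normr1. Qed.

Lemma memL2_sub_fst u (b : E -> R) : L2cyl u -> memL2 leb Omega b ->
  memL2 (leb \x lebt)%E (Omega `*` I) (fun p => u p.1 p.2 - b p.1).
Proof.
move=> uL bL; have bL' : memL2 (leb \x lebt)%E (Omega `*` I) (fun p : E * RR => b p.1).
  apply: (@eq_memL2 _ (E * RR)%type R (leb \x lebt)%E _ mC (fun p => b p.1 * 1)).
    by move=> p _; rewrite mulr1.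
  exact: (memL2_tensor mO mI bL memL2_one).
by apply: (@memL2B _ (E * RR)%type R (leb \x lebt)%E _ mC).
Qed.

(** The time value is defined through the continuous representative, which agrees with [u] at almost
    every [t]; its continuity at [t0] becomes smallness of [u - b] at almost all times near [t0]. *)
Lemma time_value_small u (t0 : R) b (e : R) : t0 \in `[0, T] -> L2cyl u -> memL2 leb Omega b ->
  has_time_value T Omega u t0 b -> 0 < e ->
  exists2 del, 0 < del & {ae lebt, forall t, I t -> `|t - t0| < del ->
    \int[leb]_(x in Omega) ((u x t - b x) ^+ 2) <= e}.
Proof.
move=> t0T uL bL [w [wL wc wu wb]] e0.
(* A norm below 1 dominates its own square, which is then at most [e]. *)
pose k := Num.min 1 e; have k0 : 0 < k by rewrite lt_min ltr01.
have /cvgrPdist_lt/(_ k k0) := wc t0 t0T.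
rewrite near_withinE => /nbhs_ballP[del /= del0 Hdel].
exists del => //.
have uS := ae_memL2_section2 (m1 := leb) (m2 := lebt) mO mI uL.
apply: ae_mono2 uS wu => t uS wu It tdel; have {}uS := uS It.
have tT : t \in `[0, T].
  by move: It; rewrite /= !in_itv /= => /andP[/ltW-> /ltW->].
have {}wu : \forall x \ae leb, Omega x -> w t x = u x t.
  by apply: wu; move: It; rewrite /= in_itv.
have := Hdel t _ tT; rewrite /ball /= distrC => /(_ tdel).
rewrite sub0r normrN ger0_norm ?normL2_ge0// => wk.
have -> : \int[leb]_(x in Omega) ((u x t - b x) ^+ 2) = \int[leb]_(x in Omega) ((w t x - w t0 x) ^+ 2).
  apply: (ae_eq_Rintegral mO).
  - by apply: measurable_funX; apply: memL2_meas (memL2B mO uS bL).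
  - by apply: measurable_funX; apply: memL2_meas (memL2B mO (wL t tT) (wL t0 t0T)).
  - by apply: ae_mono2 wu wb => x wx bx Ox; rewrite wx// bx.
have N0 := normL2_ge0 leb Omega (w t \- w t0).
rewrite -(normL2_sqr leb Omega (w t \- w t0)).
move: (normL2 _ _ _) N0 wk => z z0; rewrite lt_min => /andP[z1 ze].
apply: le_trans (ltW ze); rewrite expr2 ler_piMl// ltW//.
Qed.

Let repr u h : L2cyl u -> L2cyl h ->
  (forall phi, time_test_fun T phi -> {ae leb, forall x, Omega x ->
     \int[lebt]_(t in I) (u x t * derive1 phi t) = - \int[lebt]_(t in I) (h x t * phi t)}) ->
  exists C : E -> R, {ae leb, forall x, Omega x -> {ae lebt, forall t, I t -> u x t = C x + primitive (h x) t}}.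
Proof.
move=> uL hL uh; have H := weak_dt_primitive T0 mO uL hL uh.
exists (fun x => xget 0 [set C : R | {ae lebt, forall t, I t -> u x t = C + primitive (h x) t}]).
apply: ae_mono H => x H Ox.
exact: (@xgetPex _ 0 [set C : R | {ae lebt, forall t, I t -> u x t = C + primitive (h x) t}] (H Ox)).
Qed.

Let sqr_section h : L2cyl h ->
  leb.-integrable Omega (EFin \o (fun x => \int[lebt]_(t in I) (h x t ^+ 2))).
Proof.
move=> hL; have h2 := @memL2_sqr _ (E * RR)%type R (leb \x lebt)%E _ mC _ hL.
exact: (integrable_Rintegral1 mO mI h2).
Qed.

Let len (n : nat) := T / n.+1%:R.

Let len_gt0 n : 0 < len n. Proof. by rewrite divr_gt0. Qed.

Let len_le n : len n <= T.
Proof. by rewrite ler_pdivrMr// ler_peMr ?(ltW T0)// ler1n. Qed.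

Let len_small e : 0 < e -> exists n, len n <= e.
Proof.
move=> e0; exists (Num.truncn (T / e)); rewrite /len ler_pdivrMr// mulrC -ler_pdivrMr//.
by rewrite ltW// truncnS_gt.
Qed.

(** The constant of integration is compared with [b] on intervals shrinking to 0: [const_left_le]
    bounds the difference by averages of [u - b], and the time value makes these small. *)
Lemma time_primitive_left u h b : L2cyl u -> L2cyl h -> memL2 leb Omega b ->
  (forall phi, time_test_fun T phi -> {ae leb, forall x, Omega x ->
     \int[lebt]_(t in I) (u x t * derive1 phi t) = - \int[lebt]_(t in I) (h x t * phi t)}) ->
  has_time_value T Omega u 0 b ->
  {ae leb, forall x, Omega x -> {ae lebt, forall t, I t -> u x t = b x + primitive (h x) t}}.
Proof.
move=> uL hL bL uh ub; have [C HC] := repr uL hL uh.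
have uS := ae_memL2_section mO uL; have hS := ae_memL2_section mO hL.
suff C0 : {ae leb, forall x, Omega x -> C x - b x = 0}.
  apply: ae_mono2 C0 HC => x C0 HC Ox; have /eqP := C0 Ox; rewrite subr_eq0 => /eqP <-.
  exact: HC.
apply: (@ae_const_eq0 R d T Omega mO (fun x t => u x t - b x)
  (fun x => \int[lebt]_(t in I) (h x t ^+ 2)) (fun=> 0) len (fun x => C x - b x)).
- exact: memL2_sub_fst.
- exact: sqr_section.
- by move=> x; apply: Rintegral_ge0 => t _; exact: sqr_ge0.
- by move=> n; exact: len_gt0.
- by move=> n; apply: subset_itvl; rewrite bnd_simp.
- move=> e e0; have z0 : 0 \in `[0, T] by rewrite in_itv /= lexx ltW.
  have [del del0 Hdel] := time_value_small z0 uL bL ub e0.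
  have m0 : 0 < Num.min e del by rewrite lt_min e0.
  have [n ne] := len_small m0.
  exists n; rewrite subr0; move: (ne); rewrite le_min => /andP[ne1 ne2]; split=> //.
  apply: ae_mono Hdel => t; rewrite subr0 /= !in_itv /= => Hdel /andP[t0 tn].
  by apply: Hdel; [rewrite t0 (lt_le_trans tn)|rewrite gtr0_norm// (lt_le_trans tn)].
- apply: ae_mono2 (ae_conj uS hS) HC => x uhx HC Ox n.
  have [ux hx] := uhx Ox; rewrite !subr0.
  have yx : memL2 lebt I (fun t => u x t - b x).
    apply: memL2B => //; apply: (memL2_bounded_fun (M := `|b x|)) => //.
  apply: (const_left_le (T := T) (y := fun t => u x t - b x)) => //; first by rewrite len_gt0 len_le.
  by apply: ae_mono (HC Ox) => t + It => /(_ It) ->; rewrite addrAC.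
Qed.

Lemma time_primitive_right u h b : L2cyl u -> L2cyl h -> memL2 leb Omega b ->
  (forall phi, time_test_fun T phi -> {ae leb, forall x, Omega x ->
     \int[lebt]_(t in I) (u x t * derive1 phi t) = - \int[lebt]_(t in I) (h x t * phi t)}) ->
  has_time_value T Omega u T b ->
  {ae leb, forall x, Omega x -> {ae lebt, forall t, I t -> u x t = b x - \int[lebt]_(s in `]t, T[) h x s}}.
Proof.
move=> uL hL bL uh ub; have [C HC] := repr uL hL uh.
have uS := ae_memL2_section mO uL; have hS := ae_memL2_section mO hL.
(* The constant of integration as seen from [T] instead of 0. *)
pose C' x := C x + \int[lebt]_(t in I) h x t.
have {}HC : {ae leb, forall x, Omega x -> {ae lebt, forall t, I t -> u x t = C' x - \int[lebt]_(s in `]t, T[) h x s}}.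
  apply: ae_mono2 HC hS => x HC hx Ox; have hi := memL2_integrable (hx Ox).
  apply: ae_mono (HC Ox) => t + It => /(_ It) ->; rewrite /C' /primitive.
  rewrite (Rintegral_itv_split It hi).
  by move: (Rintegral _ _ _) (Rintegral _ _ _) => z1 z2; ring.
suff C0 : {ae leb, forall x, Omega x -> C' x - b x = 0}.
  apply: ae_mono2 C0 HC => x C0 HC Ox; have /eqP := C0 Ox; rewrite subr_eq0 => /eqP <-.
  exact: HC.
apply: (@ae_const_eq0 R d T Omega mO (fun x t => u x t - b x)
  (fun x => \int[lebt]_(t in I) (h x t ^+ 2)) (fun n => T - len n) (fun=> T) (fun x => C' x - b x)).
- exact: memL2_sub_fst.
- exact: sqr_section.
- by move=> x; apply: Rintegral_ge0 => t _; exact: sqr_ge0.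
- by move=> n; rewrite ltrBlDr ltrDl len_gt0.
- by move=> n; apply: subset_itvr; rewrite bnd_simp subr_ge0.
- move=> e e0; have z0 : T \in `[0, T] by rewrite in_itv /= lexx ltW.
  have [del del0 Hdel] := time_value_small z0 uL bL ub e0.
  have m0 : 0 < Num.min e del by rewrite lt_min e0.
  have [n ne] := len_small m0.
  exists n; rewrite subKr; move: (ne); rewrite le_min => /andP[ne1 ne2]; split=> //.
  apply: ae_mono Hdel => t; rewrite /= !in_itv /= => Hdel /andP[tn tT].
  have Tn : 0 <= T - len n by rewrite subr_ge0.
  apply: Hdel; first by rewrite tT (le_lt_trans Tn).
  rewrite ltr0_norm ?subr_lt0// opprB ltrBlDr -ltrBlDl (le_lt_trans _ tn)//.
  by rewrite lerB.
- apply: ae_mono2 (ae_conj uS hS) HC => x uhx HC Ox n.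
  have [ux hx] := uhx Ox; rewrite !subKr.
  have yx : memL2 lebt I (fun t => u x t - b x).
    apply: memL2B => //; apply: (memL2_bounded_fun (M := `|b x|)) => //.
  apply: (const_right_le (T := T) (y := fun t => u x t - b x)) => //; first by rewrite len_gt0 len_le.
  by apply: ae_mono (HC Ox) => t + It => /(_ It) ->; rewrite addrAC.
Qed.

(** Applied to the backward integral, for which no time value is prescribed: the constant remains,
    to be removed by [back_frac_const]. *)
Lemma time_primitive_repr u h : L2cyl u -> L2cyl h ->
  (forall phi, time_test_fun T phi -> {ae leb, forall x, Omega x ->
     \int[lebt]_(t in I) (u x t * derive1 phi t) = - \int[lebt]_(t in I) (h x t * phi t)}) ->
  {ae leb, forall x, Omega x -> exists C : R, {ae lebt, forall t, I t -> u x t = C - \int[lebt]_(s in `]t, T[) h x s}}.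
Proof.
move=> uL hL uh; have [C HC] := repr uL hL uh; have hS := ae_memL2_section mO hL.
apply: ae_mono2 HC hS => x HC hx Ox; have hi := memL2_integrable (hx Ox).
exists (C x + \int[lebt]_(t in I) h x t).
apply: ae_mono (HC Ox) => t + It => /(_ It) ->; rewrite /primitive (Rintegral_itv_split It hi).
by move: (Rintegral _ _ _) (Rintegral _ _ _) => z1 z2; ring.
Qed.

End time_value.

(** * The fractional diffusion equation *)

Section scalar_product.
Context {R : realType}.
Local Notation lebt := (@lebesgue_measure R).
Local Notation RR := (measurableTypeR R).
Variables (T alpha : R).
Hypotheses (T0 : 0 < T) (a1 : alpha < 1).
Local Notation I := (`]0, T[%classic : set R).
Implicit Types h y K : R -> R.
Let mI : @measurable _ RR I. Proof. exact: measurable_itv. Qed.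

(** The 1 bounds the product with [h], the remainder the product with the fractional integral
    through Schur's test. *)
Definition frac_source_const (q : R) : R := 1 + q * (Gamma (1 - alpha))^-1 * frac_const alpha T.

(** [K] will be the source minus the elliptic term, known only through the equation. Replacing it by
    the time operator makes its product with [y] integrable, with a bound quadratic in [y] and [h]
    that can be integrated over [x]. *)
Lemma frac_source_le (q : R) h y K : 0 <= q -> memL2 lebt I h -> memL2 lebt I y ->
  measurable_fun I K -> {ae lebt, forall t, I t -> h t + q * frac_int alpha h t = K t} ->
  lebt.-integrable I (EFin \o (fun t => K t * y t)) /\
  \int[lebt]_(t in I) `|K t * y t| <= frac_source_const q *
    (\int[lebt]_(t in I) (y t ^+ 2) + \int[lebt]_(t in I) (h t ^+ 2)).
Proof.
move=> q0 hL yL mK KE.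
pose G := (Gamma (1 - alpha))^-1; have G0 : 0 <= G by rewrite invr_ge0 Gamma_ge0.
have i1 := memL2_mul mI hL yL; have i2 := integrable_mul_frac a1 yL hL.
have i12 : lebt.-integrable I (EFin \o (fun t => h t * y t + (q * G) * (y t * frac_conv alpha h t))).
  by apply: integrableD_real => //; exact: integrableZ_real.
have my := memL2_meas mI yL.
have mKy : measurable_fun I (fun t => K t * y t) by exact: measurable_funM.
have KyE : {ae lebt, forall t, I t -> h t * y t + (q * G) * (y t * frac_conv alpha h t) = K t * y t}.
  by apply: ae_mono KE => t + It => /(_ It) <-; rewrite frac_intE -/G; ring.
have iK : lebt.-integrable I (EFin \o (fun t => K t * y t)) by exact: ae_integrable_real i12.
split=> //.
have n1 := integrable_norm i1; have n2 := integrable_norm i2.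
have y2 := memL2_sqr mI yL; have h2 := memL2_sqr mI hL.
apply: (@le_trans _ _ (\int[lebt]_(t in I) (`|h t * y t| + (q * G) * `|y t * frac_conv alpha h t|))).
  apply: le_ae_Rintegral => //; first exact: integrable_norm iK.
    by apply: integrableD_real => //; exact: integrableZ_real.
  apply: ae_mono KyE => t + It => /(_ It) <-; apply: le_trans (ler_normD _ _) _.
  by rewrite lerD2l normrM ger0_norm// mulr_ge0.
rewrite RintegralD//; last exact: integrableZ_real.
rewrite (RintegralZl _ mI n2) /frac_source_const mulrDl mul1r; apply: lerD.
  rewrite -(RintegralD mI y2 h2); apply: le_Rintegral => //; first exact: integrableD_real.
  by move=> t _; rewrite normrM -(real_normK (num_real (y t))) -(real_normK (num_real (h t))); nra.
rewrite -[leRHS]mulrA; apply: ler_wpM2l; first exact: mulr_ge0.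
have := mul_frac_le a1 yL hL; rewrite -(fineK (integrable_fin_num mI n2)) lee_fin.
by [].
Qed.

Lemma measurable_frac_source (q : R) h y : memL2 lebt I h -> memL2 lebt I y ->
  measurable_fun I (fun t => (h t + q * frac_int alpha h t) * y t).
Proof.
move=> hL yL.
have i1 := memL2_mul mI hL yL; have i2 := integrable_mul_frac a1 yL hL.
have := integrable_real_meas (integrableD_real mI i1 (integrableZ_real mI (q * (Gamma (1 - alpha))^-1) i2)).
by apply: eq_measurable_fun => t _; rewrite frac_intE; ring.
Qed.

End scalar_product.

Section cylinder_identities.
Context {R : realType} {d : nat}.
Notation E := 'rV[R]_d.
Local Notation leb := (lebesgue_rV d).
Local Notation lebt := (@lebesgue_measure R).
Local Notation RR := (measurableTypeR R).
Variables (T alpha q : R) (Omega : set E).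
Hypotheses (T0 : 0 < T) (a0 : 0 < alpha) (a1 : alpha < 1) (q0 : 0 <= q) (mO : measurable Omega).
Local Notation I := (`]0, T[%classic : set R).
Let mI : @measurable _ RR I. Proof. exact: measurable_itv. Qed.
Local Notation cyl := (Omega `*` I : set (E * RR)).
Local Notation lebc := (leb \x lebt)%E.
Local Notation L2cyl u := (memL2 lebc cyl (fun p => u p.1 p.2)).
Let mC : measurable cyl. Proof. exact: measurableX. Qed.
Implicit Types (h y K w v m n S : E -> R -> R).

Let sqr_section y : L2cyl y ->
  leb.-integrable Omega (EFin \o (fun x => \int[lebt]_(t in I) (y x t ^+ 2))).
Proof.
move=> yL; have y2 := @memL2_sqr _ (E * RR)%type R lebc _ mC _ yL.
exact: (integrable_Rintegral1 mO mI y2).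
Qed.

Let memL2_sections y1 y2 : L2cyl y1 -> L2cyl y2 ->
  {ae leb, forall x, Omega x -> memL2 lebt I (y1 x) /\ memL2 lebt I (y2 x)}.
Proof.
by move=> y1L y2L; exact: (ae_conj (ae_memL2_section mO y1L) (ae_memL2_section mO y2L)).
Qed.

(** Tonelli's theorem, from the bounds of [frac_source_le] at almost every [x], whose right-hand
    sides are integrable over [Omega]. *)
Lemma integrable_frac_source h y K : L2cyl h -> L2cyl y -> measurable_fun cyl (fun p => K p.1 p.2) ->
  {ae leb, forall x, Omega x -> {ae lebt, forall t, I t -> h x t + q * frac_int alpha (h x) t = K x t}} ->
  lebc.-integrable cyl (EFin \o (fun p : E * RR => K p.1 p.2 * y p.1 p.2)).
Proof.
move=> hL yL mK KE; have my := memL2_meas mC yL.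
have mKy : measurable_fun cyl (fun p : E * RR => K p.1 p.2 * y p.1 p.2) by exact: measurable_funM.
apply/integrableP; split; first exact/measurable_EFinP.
have mKn : measurable_fun cyl (fun p : E * RR => `|K p.1 p.2 * y p.1 p.2|) by exact: measurableT_comp.
under eq_integral do rewrite /=.
rewrite (tonelli1 leb lebt mO mI mKn) => [|p _]; last exact: normr_ge0.
pose B x := frac_source_const T alpha q * (\int[lebt]_(t in I) (y x t ^+ 2) + \int[lebt]_(t in I) (h x t ^+ 2)).
have Bi : leb.-integrable Omega (EFin \o B).
  by apply: integrableZ_real => //; apply: integrableD_real => //; exact: sqr_section.
have Bfin := integrable_fin_num mO Bi.
apply: (@le_lt_trans _ _ (\int[leb]_(x in Omega) (B x)%:E)%E); last first.
  by move: Bfin; rewrite fin_numElt => /andP[].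
have c0 : 0 <= frac_source_const T alpha q.
  rewrite /frac_source_const; apply: addr_ge0 => //; apply: mulr_ge0; last exact: (frac_const_ge0 T a1).
  by apply: mulr_ge0 => //; rewrite invr_ge0; exact: Gamma_ge0.
have B0 x : 0 <= B x.
  by apply: mulr_ge0 => //; apply: addr_ge0; apply: Rintegral_ge0 => t _; exact: sqr_ge0.
apply: ae_ge0_le_integral => //.
- by move=> x _; apply: integral_ge0 => t _; rewrite lee_fin.
- by apply: (measurable_tonelli1 lebt mO mI mKn) => p _; exact: normr_ge0.
- by move=> x _; rewrite lee_fin.
- exact: measurable_int Bi.
apply: ae_mono2 (memL2_sections hL yL) KE => x hyx Kx Ox.
have [hx yx] := hyx Ox.
have mKx : measurable_fun I (K x) by exact: (measurable_section1 mO mI mK Ox).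
have [iK bK] := frac_source_le a1 q0 hx yx mKx (Kx Ox).
have niK := integrable_norm iK.
by rewrite -(fineK (integrable_fin_num mI niK)) lee_fin.
Qed.

Lemma Rintegral_cyl_ae (f g : E * RR -> R) : lebc.-integrable cyl (EFin \o f) ->
  lebc.-integrable cyl (EFin \o g) ->
  {ae leb, forall x, Omega x -> \int[lebt]_(t in I) f (x, t) = \int[lebt]_(t in I) g (x, t)} ->
  \int[lebc]_(p in cyl) f p = \int[lebc]_(p in cyl) g p.
Proof.
move=> fi gi fg; rewrite (Rintegral_fubini1 mO mI fi) (Rintegral_fubini1 mO mI gi).
apply: (ae_eq_Rintegral mO) => //.
- exact: integrable_real_meas (integrable_Rintegral1 mO mI fi).
- exact: integrable_real_meas (integrable_Rintegral1 mO mI gi).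
Qed.

(** This is [scalar_duality] at almost every [x], integrated over [Omega]; the almost everywhere
    identities substitute [K], [w] and [S] for the expressions in [h], [m] and [n]. *)
Lemma cylinder_duality h w v m n K S : L2cyl h -> L2cyl w -> L2cyl v -> L2cyl m -> L2cyl n -> L2cyl S ->
  measurable_fun cyl (fun p => K p.1 p.2) ->
  {ae leb, forall x, Omega x -> {ae lebt, forall t, I t -> w x t = primitive (h x) t}} ->
  {ae leb, forall x, Omega x -> {ae lebt, forall t, I t -> h x t + q * frac_int alpha (h x) t = K x t}} ->
  {ae leb, forall x, Omega x -> {ae lebt, forall t, I t -> v x t = - \int[lebt]_(s in `]t, T[) m x s}} ->
  {ae leb, forall x, Omega x -> measurable_fun I (back_frac_int T alpha (v x)) /\
     {ae lebt, forall t, I t -> back_frac_int T alpha (v x) t = - \int[lebt]_(s in `]t, T[) n x s}} ->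
  {ae leb, forall x, Omega x -> {ae lebt, forall t, I t -> - m x t - q * n x t = S x t}} ->
  \int[lebc]_(p in cyl) (K p.1 p.2 * v p.1 p.2) = \int[lebc]_(p in cyl) (w p.1 p.2 * S p.1 p.2).
Proof.
move=> hL wL vL mL nL SL mK wE KE vE zE SE.
apply: Rintegral_cyl_ae.
- exact: integrable_frac_source KE.
- exact: (@memL2_mul _ (E * RR)%type R lebc _ mC _ _ wL SL).
have H1 : {ae leb, forall x, Omega x -> [/\ memL2 lebt I (h x), memL2 lebt I (v x),
    memL2 lebt I (m x), memL2 lebt I (n x) & memL2 lebt I (w x) /\ memL2 lebt I (S x)]}.
  apply: ae_mono2 (ae_conj (memL2_sections hL vL) (memL2_sections mL nL)) (memL2_sections wL SL).
  by move=> x /= H1 H2 Ox; have [[? ?] [? ?]] := H1 Ox; have := H2 Ox.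
have H2 : {ae leb, forall x, Omega x -> {ae lebt, forall t, I t -> w x t = primitive (h x) t} /\
    {ae lebt, forall t, I t -> h x t + q * frac_int alpha (h x) t = K x t}}.
  exact: ae_conj wE KE.
have H3 : {ae leb, forall x, Omega x -> {ae lebt, forall t, I t -> v x t = - \int[lebt]_(s in `]t, T[) m x s} /\
    {ae lebt, forall t, I t -> - m x t - q * n x t = S x t}}.
  exact: ae_conj vE SE.
have H4 : {ae leb, forall x, Omega x -> \int[lebt]_(t in I) ((h x t + q * frac_int alpha (h x) t) * v x t) =
    \int[lebt]_(t in I) (primitive (h x) t * (- m x t - q * n x t))}.
  apply: ae_mono2 (ae_conj H1 H3) zE => x H zE' Ox; have [[hx vx mx nx _] [vE' _]] := H Ox; have [mz zE''] := zE' Ox.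
  exact: (scalar_duality a1 q hx vx mx nx vE' mz zE'').
apply: ae_mono2 (ae_conj H1 H2) (ae_conj H3 H4) => x H12 H34 Ox; have [[hx vx mx nx [wx Sx]] [wE' KE']] := H12 Ox.
have [[vE' SE'] H4'] := H34 Ox.
have mKx : measurable_fun I (K x) by exact: (measurable_section1 mO mI mK Ox).
have mhv := measurable_frac_source a1 q hx vx.
rewrite -(ae_eq_Rintegral mI mhv (measurable_funM mKx (memL2_meas mI vx))); last first.
  by apply: ae_mono KE' => t + It => /(_ It) ->.
rewrite H4'; apply: (ae_eq_Rintegral mI).
- apply: measurable_funM; first exact: (memL2_meas mI (memL2_primitive (memL2_integrable hx))).
  by apply: (memL2_meas (mu := lebt) mI); apply: memL2B => //; [exact: memL2N|exact: memL2Z].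
- exact: (measurable_funM (memL2_meas mI wx) (memL2_meas mI Sx)).
- by apply: ae_mono2 wE' SE' => t + + It => /(_ It) -> /(_ It) ->.
Qed.

Lemma cylinder_energy h w K : L2cyl h -> L2cyl w ->
  measurable_fun cyl (fun p => K p.1 p.2) ->
  {ae leb, forall x, Omega x -> {ae lebt, forall t, I t -> w x t = primitive (h x) t}} ->
  {ae leb, forall x, Omega x -> {ae lebt, forall t, I t -> h x t + q * frac_int alpha (h x) t = K x t}} ->
  let y x t := (T - t) * w x t in
  [/\ L2cyl y, lebc.-integrable cyl (EFin \o (fun p : E * RR => K p.1 p.2 * y p.1 p.2)) &
    2^-1 * \int[lebc]_(p in cyl) (w p.1 p.2 ^+ 2) <= \int[lebc]_(p in cyl) (K p.1 p.2 * y p.1 p.2)].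
Proof.
move=> hL wL mK wE KE y.
have mTt : measurable_fun I (fun t : R => T - t) by exact: measurable_funB.
have mT : measurable_fun cyl (fun p : E * RR => T - p.2) by exact: (measurable_snd_on mO mI mTt).
have yL : L2cyl y.
  apply: (@memL2_bounded _ (E * RR)%type R lebc _ mC T) => // -[x t] [_] /=; rewrite in_itv /= => /andP[t0 tT].
  by rewrite ger0_norm ?subr_ge0 ?(ltW tT)// gerBl ltW.
have yi := integrable_frac_source hL yL mK KE; split=> //.
have w2 := @memL2_sqr _ (E * RR)%type R lebc _ mC _ wL.
have w2' : lebc.-integrable cyl (EFin \o (fun p : E * RR => 2^-1 * w p.1 p.2 ^+ 2)).
  exact: (@integrableZ_real _ (E * RR)%type R lebc _ mC).
rewrite -(RintegralZl _ mC w2) (Rintegral_fubini1 mO mI w2') (Rintegral_fubini1 mO mI yi).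
apply: le_ae_Rintegral => //.
- exact: (integrable_Rintegral1 mO mI w2').
- exact: (integrable_Rintegral1 mO mI yi).
apply: ae_mono2 (ae_conj (memL2_sections hL wL) (memL2_sections yL yL)) (ae_conj wE KE) => x /= H1 H2 Ox; have [[hx wx] [yx _]] := H1 Ox; have [wE' KE'] := H2 Ox.
have pL := memL2_primitive (memL2_integrable hx).
have mKx : measurable_fun I (K x) by exact: (measurable_section1 mO mI mK Ox).
have w2x := memL2_sqr mI wx.
rewrite (RintegralZl _ mI w2x).
rewrite (ae_eq_Rintegral mI (measurable_funX 2 (memL2_meas mI wx)) (measurable_funX 2 (memL2_meas mI pL))); last first.
  by apply: ae_mono wE' => t + It => /(_ It) ->.
have E1 := scalar_energy T0 a0 a1 q0 hx; apply: (le_trans E1).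
rewrite le_eqVlt; apply/orP; left; apply/eqP.
have mhp := measurable_frac_source a1 q hx pL.
apply: (ae_eq_Rintegral mI).
- exact: measurable_funM.
- exact: (measurable_funM mKx (memL2_meas mI yx)).
- apply: ae_mono2 wE' KE' => t + + It => /(_ It) w1 /(_ It) K1.
  by rewrite /y w1 -K1; ring.
Qed.

End cylinder_identities.

Local Opaque weak_dt.

Section solutions.
Context {R : realType} {d : nat}.
Notation E := 'rV[R]_d.
Local Notation leb := (lebesgue_rV d).
Local Notation lebt := (@lebesgue_measure R).
Local Notation RR := (measurableTypeR R).
Variables (T q alpha : R) (Omega : set E) (A : E -> 'M[R]_d) (c : E -> R).
Hypotheses (T0 : 0 < T) (a0 : 0 < alpha) (a1 : alpha < 1).
Hypotheses (oO : open Omega).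
Local Notation I := (`]0, T[%classic : set R).
Let mO : measurable Omega. Proof. exact: measurable_open. Qed.
Let mI : @measurable _ RR I. Proof. exact: measurable_itv. Qed.
Local Notation cyl := (Omega `*` I : set (E * RR)).
Local Notation lebc := (leb \x lebt)%E.
Local Notation L2cyl u := (memL2 lebc cyl (fun p => u p.1 p.2)).
Let mC : measurable cyl. Proof. exact: measurableX. Qed.
Implicit Types (u v w h m n : E -> R -> R).

Lemma primitiveB (h1 h2 : R -> R) t : lebt.-integrable I (EFin \o h1) ->
  lebt.-integrable I (EFin \o h2) -> I t ->
  primitive (fun s => h1 s - h2 s) t = primitive h1 t - primitive h2 t.
Proof.
move=> i1 i2 It; have mJ : @measurable _ RR `]0, t[%classic by exact: measurable_itv.
have sub : `]0, t[ `<=` I.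
  by apply: subset_itvl; rewrite bnd_simp; move: It; rewrite /= in_itv /= => /andP[_ /ltW].
by rewrite /primitive (RintegralB mJ) //; exact: (@integrableS _ RR _ lebt I _ _ mI mJ sub).
Qed.

Lemma weak_dt_spec u : memH1L2 T Omega u ->
  [/\ L2cyl u, L2cyl (weak_dt T Omega u) &
    forall phi, time_test_fun T phi -> {ae leb, forall x, Omega x ->
     \int[lebt]_(t in I) (u x t * derive1 phi t) = - \int[lebt]_(t in I) (weak_dt T Omega u x t * phi t)}].
Proof.
move=> [h hP]; have [uL hL uh] : is_weak_dt T Omega u (weak_dt T Omega u).
  exact: (@xgetPex _ (fun _ _ => 0) [set h | is_weak_dt T Omega u h] (ex_intro _ h hP)).
by split => //; exact: memL2L2_cylinder.
Qed.

(** The common initial value cancels, so the difference is a primitive without constant. [h] is the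
    difference of the two weak time derivatives and [Aw] that of the two elliptic terms. *)
Lemma forward_difference rho (a g0 g1 : E -> R) u0 u1 : memL2 leb Omega a ->
  forward_solution Omega A c T q alpha a rho g0 u0 ->
  forward_solution Omega A c T q alpha a rho g1 u1 ->
  exists h Aw, [/\ [/\ L2cyl u0, L2cyl u1, L2cyl h & measurable_fun cyl (fun p => Aw p.1 p.2)],
    {ae lebt, forall t, I t -> [/\ memH2 Omega (u1 ^~ t) /\ memH10 Omega (u1 ^~ t),
      memH2 Omega (u0 ^~ t) /\ memH10 Omega (u0 ^~ t) &
      {ae leb, forall x, Omega x ->
         Aw x t = elliptic_op Omega A c (u1 ^~ t) x - elliptic_op Omega A c (u0 ^~ t) x}]},
    {ae leb, forall x, Omega x -> {ae lebt, forall t, I t -> u1 x t - u0 x t = primitive (h x) t}} &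
    {ae leb, forall x, Omega x -> {ae lebt, forall t, I t ->
       h x t + q * frac_int alpha (h x) t = rho t * (g1 x - g0 x) - Aw x t}}].
Proof.
move=> aL [[_ [u0V _ _]] u0H u0a [A0 [mA0 A0E] eq0]] [[_ [u1V _ _]] u1H u1a [A1 [mA1 A1E] eq1]].
have [u0L h0L u0h] := weak_dt_spec u0H; have [u1L h1L u1h] := weak_dt_spec u1H.
set h0 := weak_dt T Omega u0 in h0L u0h; set h1 := weak_dt T Omega u1 in h1L u1h.
pose h x t := h1 x t - h0 x t.
have hS : {ae leb, forall x, Omega x -> memL2 lebt I (h0 x) /\ memL2 lebt I (h1 x)}.
  exact: ae_conj (ae_memL2_section mO h0L) (ae_memL2_section mO h1L).
exists h, (fun x t => A1 x t - A0 x t); split.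
- split => //; last exact: measurable_funB.
  exact: (@memL2B _ (E * RR)%type R lebc _ mC _ _ h1L h0L).
- apply: ae_mono2 (ae_conj u0V u1V)
    (ae_conj A0E A1E) => t H1 H2 It.
  have [H1a H1b] := H1 It; have [H2a H2b] := H2 It; split; [exact: H1b|exact: H1a|].
  by apply: ae_mono2 H2a H2b => x B0 B1 Ox; rewrite B0// B1.
- have P0 := time_primitive_left T0 mO u0L h0L aL u0h u0a.
  have P1 := time_primitive_left T0 mO u1L h1L aL u1h u1a.
  apply: ae_mono2 hS (ae_conj P0 P1) => x H1 H2 Ox.
  have [h0x h1x] := H1 Ox; have [P0x P1x] := H2 Ox.
  apply: ae_mono2 P0x P1x => t B0 B1 It.
  rewrite B0// B1// (primitiveB (memL2_integrable h1x) (memL2_integrable h0x) It).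
  by move: (primitive _ _) (primitive _ _) => z0 z1; ring.
- have := ae_section1 (ae_conj eq0 eq1).
  move=> eqs; apply: ae_mono2 hS eqs => x H1 H2 Ox.
  have [h0x h1x] := H1 Ox.
  apply: ae_mono2 H2 (ae_frac_convB a1 h1x h0x) => t B F It.
  have [e0 e1] := B (conj Ox It).
  rewrite mulrBr -e0 -e1 /= /caputo !frac_intE (F It) -/h0 -/h1 /h.
  move: (frac_conv _ _ _) (frac_conv _ _ _) (h0 x t) (h1 x t) (Gamma _) => z0 z1 z2 z3 z4.
  by move: (A0 x t) (A1 x t) => z5 z6; ring.
Qed.

Lemma adjoint_spec (F : E -> R -> R) v :
  adjoint_solution Omega A c T q alpha F v -> measurable_fun cyl (fun p => F p.1 p.2) ->
  exists m n Av, [/\ [/\ L2cyl v, L2cyl m, L2cyl n & L2cyl (fun x t => F x t - Av x t)],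
    {ae lebt, forall t, I t -> [/\ memH2 Omega (v ^~ t), memH10 Omega (v ^~ t) &
      {ae leb, forall x, Omega x -> Av x t = elliptic_op Omega A c (v ^~ t) x}]},
    {ae leb, forall x, Omega x -> {ae lebt, forall t, I t -> v x t = - \int[lebt]_(s in `]t, T[) m x s}},
    {ae leb, forall x, Omega x -> measurable_fun I (back_frac_int T alpha (v x)) /\
      {ae lebt, forall t, I t -> back_frac_int T alpha (v x) t = - \int[lebt]_(s in `]t, T[) n x s}} &
    {ae leb, forall x, Omega x -> {ae lebt, forall t, I t -> - m x t - q * n x t = F x t - Av x t}}].
Proof.
move=> [[_ [vV _ _]] vH vT zH [Av [mAv AvE] eqv]] mF.
have [vL mL vm] := weak_dt_spec vH; have [zL nL zn] := weak_dt_spec zH.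
set m := weak_dt T Omega v in mL vm; set z := fun x => back_frac_int T alpha (v x) in zL nL zn.
set n := weak_dt T Omega z in nL zn.
have zeroL : memL2 leb Omega (cst 0 : E -> R) by exact: memL2_0.
have V := time_primitive_right T0 mO vL mL zeroL vm vT.
have Z := time_primitive_repr T0 mO zL nL zn.
have {}V : {ae leb, forall x, Omega x -> {ae lebt, forall t, I t -> v x t = - \int[lebt]_(s in `]t, T[) m x s}}.
  apply: ae_mono V => x + Ox => /(_ Ox) H.
  by apply: ae_mono H => t + It => /(_ It) ->; rewrite sub0r.
have eqv' : {ae lebc, forall p, cyl p -> - m p.1 p.2 - q * n p.1 p.2 = F p.1 p.2 - Av p.1 p.2}.
  apply: ae_mono eqv => p + Cp => /(_ Cp) <-; rewrite /back_RL -/m -/z -/n.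
  by move: (m _ _) (n _ _) (Av _ _) => z0 z1 z2; ring.
clearbody m n; exists m, n, Av; split; [| |exact: V| |].
(* The equation itself makes [F - Av] square integrable: it equals [- m - q n] almost everywhere. *)
- split; [exact: vL|exact: mL|exact: nL|]; apply: (@ae_memL2 _ (E * RR)%type R lebc _ mC _ _ _ eqv').
    exact: measurable_funB.
  apply: (@memL2B _ (E * RR)%type R lebc _ mC); last exact: (@memL2Z _ (E * RR)%type R lebc _ mC).
  exact: (@memL2N _ (E * RR)%type R lebc _ mC).
- by apply: ae_mono2 vV AvE => t H1 H2 It; have [? ?] := H1 It; split => //; exact: H2.
- have S1 := ae_conj (ae_memL2_section mO vL) (ae_memL2_section mO mL).
  have S2 := ae_conj (ae_memL2_section (u := z) mO zL) (ae_memL2_section mO nL).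
  apply: ae_mono2 (ae_conj S1 S2)
    (ae_conj V Z) => x H1 H2 Ox.
  have [[vx mx] [zx nx]] := H1 Ox; have [Vx [C Cx]] := H2 Ox.
  split; first exact: (memL2_meas mI zx).
  have C0 := back_frac_const T0 a0 a1 vx mx nx Vx zx Cx.
  by apply: ae_mono Cx => t + It => /(_ It) ->; rewrite C0 sub0r.
- apply: ae_mono (ae_section1 eqv') => x H Ox.
  by apply: ae_mono H => t H' It; exact: H' (conj Ox It).
Qed.

End solutions.

Local Opaque elliptic_op.

Section source_identities.
Context {R : realType} {d : nat}.
Notation E := 'rV[R]_d.
Local Notation leb := (lebesgue_rV d).
Local Notation lebt := (@lebesgue_measure R).
Local Notation RR := (measurableTypeR R).
Variables (T q alpha : R) (Omega : set E) (A : E -> 'M[R]_d) (c : E -> R).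
Hypotheses (T0 : 0 < T) (a0 : 0 < alpha) (a1 : alpha < 1) (q0 : 0 <= q).
Hypotheses (oO : open Omega) (bO : bounded_set Omega) (coeffs : elliptic_coeffs Omega A c).
Local Notation I := (`]0, T[%classic : set R).
Let mO : measurable Omega. Proof. exact: measurable_open. Qed.
Let mI : @measurable _ RR I. Proof. exact: measurable_itv. Qed.
Local Notation cyl := (Omega `*` I : set (E * RR)).
Local Notation lebc := (leb \x lebt)%E.
Local Notation L2cyl u := (memL2 lebc cyl (fun p => u p.1 p.2)).
Local Notation L := (elliptic_op Omega A c).
Let mC : measurable cyl. Proof. exact: measurableX. Qed.

Lemma elliptic_symB (f g w : E -> R) :
  memH2 Omega f /\ memH10 Omega f -> memH2 Omega g /\ memH10 Omega g ->
  memH2 Omega w -> memH10 Omega w ->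
  \int[leb]_(x in Omega) ((L f x - L g x) * w x) = \int[leb]_(x in Omega) ((f x - g x) * L w x).
Proof.
move=> [f2 f0] [g2 g0] w2 w0.
have [[fL _] _] := f2; have [[gL _] _] := g2; have [[wL _] _] := w2.
have LfL := memL2_elliptic oO bO coeffs f2; have LgL := memL2_elliptic oO bO coeffs g2.
have LwL := memL2_elliptic oO bO coeffs w2.
have i1 := memL2_mul mO LfL wL; have i2 := memL2_mul mO LgL wL.
have i3 := memL2_mul mO fL LwL; have i4 := memL2_mul mO gL LwL.
transitivity (\int[leb]_(x in Omega) (L f x * w x - L g x * w x)).
  by apply: eq_Rintegral => x _; rewrite mulrBl.
rewrite (RintegralB mO i1 i2) (elliptic_sym oO bO coeffs f2 f0 w2 w0) (elliptic_sym oO bO coeffs g2 g0 w2 w0).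
by rewrite -(RintegralB mO i3 i4); apply: eq_Rintegral => x _; rewrite mulrBl.
Qed.

Variables (D Aw h u0 u1 : E -> R -> R).
Let w x t := u1 x t - u0 x t.
Hypotheses (u0L : L2cyl u0) (u1L : L2cyl u1) (hL : L2cyl h) (DL : L2cyl D).
Hypotheses (mAw : measurable_fun cyl (fun p => Aw p.1 p.2)).
Hypothesis AwE : {ae lebt, forall t, I t -> [/\ memH2 Omega (u1 ^~ t) /\ memH10 Omega (u1 ^~ t),
  memH2 Omega (u0 ^~ t) /\ memH10 Omega (u0 ^~ t) &
  {ae leb, forall x, Omega x -> Aw x t = L (u1 ^~ t) x - L (u0 ^~ t) x}]}.
Hypothesis wE : {ae leb, forall x, Omega x -> {ae lebt, forall t, I t -> w x t = primitive (h x) t}}.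
Hypothesis KE : {ae leb, forall x, Omega x -> {ae lebt, forall t, I t ->
  h x t + q * frac_int alpha (h x) t = D x t - Aw x t}}.

Let wL : L2cyl w.
Proof. exact: (@memL2B _ (E * RR)%type R lebc _ mC _ _ u1L u0L). Qed.

Let mK : measurable_fun cyl (fun p => D p.1 p.2 - Aw p.1 p.2).
Proof. by apply: measurable_funB => //; exact: (@memL2_meas _ (E * RR)%type R lebc _ mC _ DL). Qed.

Let section_t (y : E -> R -> R) t : measurable_fun cyl (fun p => y p.1 p.2) -> I t ->
  measurable_fun Omega (y ^~ t).
Proof. by move=> my It; exact: (measurable_section2 mO mI my It). Qed.

(** [cylinder_duality] relates [D - Aw] against [v] to [w] against [F - Av]; what remains is the
    symmetry of the elliptic operator at almost every [t]. *)
Lemma source_identity (F v m n Av : E -> R -> R) :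
  L2cyl v -> L2cyl m -> L2cyl n -> L2cyl F -> L2cyl (fun x t => F x t - Av x t) ->
  {ae lebt, forall t, I t -> [/\ memH2 Omega (v ^~ t), memH10 Omega (v ^~ t) &
      {ae leb, forall x, Omega x -> Av x t = L (v ^~ t) x}]} ->
  {ae leb, forall x, Omega x -> {ae lebt, forall t, I t -> v x t = - \int[lebt]_(s in `]t, T[) m x s}} ->
  {ae leb, forall x, Omega x -> measurable_fun I (back_frac_int T alpha (v x)) /\
      {ae lebt, forall t, I t -> back_frac_int T alpha (v x) t = - \int[lebt]_(s in `]t, T[) n x s}} ->
  {ae leb, forall x, Omega x -> {ae lebt, forall t, I t -> - m x t - q * n x t = F x t - Av x t}} ->
  \int[lebc]_(p in cyl) (D p.1 p.2 * v p.1 p.2) = \int[lebc]_(p in cyl) (w p.1 p.2 * F p.1 p.2).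
Proof.
move=> vL mL nL FL SL AvE vE zE SE.
have dual := cylinder_duality a1 q0 mO hL wL vL mL nL SL mK wE KE vE zE SE.
have iKv := integrable_frac_source a1 q0 mO hL vL mK KE.
have iDv := @memL2_mul _ (E * RR)%type R lebc _ mC _ _ DL vL.
have iwF := @memL2_mul _ (E * RR)%type R lebc _ mC _ _ wL FL.
have iwS := @memL2_mul _ (E * RR)%type R lebc _ mC _ _ wL SL.
have iX := @integrableB_real _ (E * RR)%type R lebc _ mC _ _ iDv iKv.
have iY := @integrableB_real _ (E * RR)%type R lebc _ mC _ _ iwF iwS.
(* The elliptic terms [Aw v] and [w Av] are written as differences because their integrability over
   the cylinder is known through that of the two parts. *)
suff XY : \int[lebc]_(p in cyl) (D p.1 p.2 * v p.1 p.2 - (D p.1 p.2 - Aw p.1 p.2) * v p.1 p.2) =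
    \int[lebc]_(p in cyl) (w p.1 p.2 * F p.1 p.2 - w p.1 p.2 * (F p.1 p.2 - Av p.1 p.2)).
  move: XY; rewrite (RintegralB mC iDv iKv) (RintegralB mC iwF iwS) dual.
  by move/addIr.
rewrite (Rintegral_fubini2 mO mI iX) (Rintegral_fubini2 mO mI iY).
apply: (ae_eq_Rintegral mI).
- exact: integrable_real_meas (integrable_Rintegral2 mO mI iX).
- exact: integrable_real_meas (integrable_Rintegral2 mO mI iY).
have mFAv : measurable_fun cyl (fun p => F p.1 p.2 - Av p.1 p.2) := @memL2_meas _ (E * RR)%type R lebc _ mC _ SL.
have mF := @memL2_meas _ (E * RR)%type R lebc _ mC _ FL.
have mAv : measurable_fun cyl (fun p => Av p.1 p.2).
  apply: (eq_measurable_fun (fun p => F p.1 p.2 - (F p.1 p.2 - Av p.1 p.2))); last exact: measurable_funB.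
  by move=> p _; rewrite subKr.
apply: ae_mono2 AwE AvE => t H1 H2 It /=.
have [u1H u0H AwEt] := H1 It; have [v2 v0 AvEt] := H2 It.
have [[[u1t _] _] _] := u1H; have [[[u0t _] _] _] := u0H; have [[vt _] _] := v2.
have LL := memL2B mO (memL2_elliptic oO bO coeffs u1H.1) (memL2_elliptic oO bO coeffs u0H.1).
have Lv := memL2_elliptic oO bO coeffs v2.
transitivity (\int[leb]_(x in Omega) (Aw x t * v x t)).
  by apply: eq_Rintegral => x _; ring.
transitivity (\int[leb]_(x in Omega) ((L (u1 ^~ t) x - L (u0 ^~ t) x) * v x t)).
  apply: (ae_eq_Rintegral mO).
  - exact: (measurable_funM (section_t mAw It) (memL2_meas mO vt)).
  - exact: (measurable_funM (memL2_meas mO LL) (memL2_meas mO vt)).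
  - by apply: ae_mono AwEt => x + Ox => /(_ Ox) ->.
rewrite (elliptic_symB u1H u0H v2 v0).
rewrite [RHS](_ : _ = \int[leb]_(x in Omega) ((u1 x t - u0 x t) * Av x t)); last first.
  by apply: eq_Rintegral => x _ /=; rewrite /w; ring.
apply: (ae_eq_Rintegral mO).
- exact: (measurable_funM (memL2_meas mO (memL2B mO u1t u0t)) (memL2_meas mO Lv)).
- exact: (measurable_funM (memL2_meas mO (memL2B mO u1t u0t)) (section_t mAv It)).
- by apply: ae_mono AvEt => x + Ox => /(_ Ox) ->.
Qed.

(** Monotonicity of the elliptic operator, with the nonnegative weight [T - t], removes [Aw] from
    the energy inequality. Then [D (T - t) w <= w^2 / 4 + T^2 D^2], and the quarter is absorbed by
    the half on the left. *)
Lemma source_stability :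
  \int[lebc]_(p in cyl) (w p.1 p.2 ^+ 2) <= 4 * T ^+ 2 * \int[lebc]_(p in cyl) (D p.1 p.2 ^+ 2).
Proof.
have [yL iKy energy] := cylinder_energy T0 a0 a1 q0 mO hL wL mK wE KE.
set y := fun x t => (T - t) * w x t in yL iKy energy.
have iDy := @memL2_mul _ (E * RR)%type R lebc _ mC _ _ DL yL.
have iX := @integrableB_real _ (E * RR)%type R lebc _ mC _ _ iDy iKy.
have D2 := @memL2_sqr _ (E * RR)%type R lebc _ mC _ DL.
have w2 := @memL2_sqr _ (E * RR)%type R lebc _ mC _ wL.
have X0 : 0 <= \int[lebc]_(p in cyl) (D p.1 p.2 * y p.1 p.2 - (D p.1 p.2 - Aw p.1 p.2) * y p.1 p.2).
  rewrite (Rintegral_fubini2 mO mI iX); apply: Rintegral_ae_ge0 => //.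
    exact: integrable_real_meas (integrable_Rintegral2 mO mI iX).
  apply: ae_mono AwE => t H1 It /=; have [u1H u0H AwEt] := H1 It.
  have [[[u1t _] _] _] := u1H; have [[[u0t _] _] _] := u0H.
  have LL := memL2B mO (memL2_elliptic oO bO coeffs u1H.1) (memL2_elliptic oO bO coeffs u0H.1).
  have ww := memL2B mO u1t u0t.
  rewrite (_ : \int[leb]_(x in Omega) _ = \int[leb]_(x in Omega) ((T - t) * (Aw x t * (u1 x t - u0 x t)))); last first.
    by apply: eq_Rintegral => x _ /=; rewrite /y /w; ring.
  have mAww : measurable_fun Omega (fun x => Aw x t * (u1 x t - u0 x t)).
    exact: (measurable_funM (section_t mAw It) (memL2_meas mO ww)).
  rewrite (@RintegralZl_measurable _ _ _ leb _ mO _ _ mAww); apply: mulr_ge0.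
    by move: It; rewrite /= in_itv /= subr_ge0 => /andP[_ /ltW].
  rewrite (_ : \int[leb]_(x in Omega) _ = \int[leb]_(x in Omega) ((L (u1 ^~ t) x - L (u0 ^~ t) x) * (u1 x t - u0 x t))).
    exact: (elliptic_monotone oO bO coeffs u1H.1 u1H.2 u0H.1 u0H.2).
  apply: (ae_eq_Rintegral mO) => //; first exact: (measurable_funM (memL2_meas mO LL) (memL2_meas mO ww)).
  by apply: ae_mono AwEt => x + Ox => /(_ Ox) ->.
rewrite (RintegralB mC iDy iKy) subr_ge0 in X0.
have {X0} le1 := le_trans energy X0.
have iB : lebc.-integrable cyl (EFin \o (fun p : E * RR => 4^-1 * w p.1 p.2 ^+ 2 + T ^+ 2 * D p.1 p.2 ^+ 2)).
  by apply: (@integrableD_real _ (E * RR)%type R lebc _ mC); exact: (@integrableZ_real _ (E * RR)%type R lebc _ mC).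
have : \int[lebc]_(p in cyl) (D p.1 p.2 * y p.1 p.2) <=
    \int[lebc]_(p in cyl) (4^-1 * w p.1 p.2 ^+ 2 + T ^+ 2 * D p.1 p.2 ^+ 2).
  apply: le_Rintegral => // -[x t] [_] /=; rewrite in_itv /= => /andP[t0 tT]; rewrite /y.
  move: (D x t) (w x t) => Dx wx.
  have Tt : (T - t) ^+ 2 <= T ^+ 2 by rewrite lerXn2r ?nnegrE ?subr_ge0 ?(ltW tT) ?(ltW T0)// gerBl ltW.
  have := sqr_ge0 (2^-1 * wx - (T - t) * Dx); have := sqr_ge0 Dx.
  move: (T - t) Tt => s Tt D0 H.
  have : s ^+ 2 * Dx ^+ 2 <= T ^+ 2 * Dx ^+ 2 by rewrite ler_wpM2r.
  by move: (T ^+ 2 * Dx ^+ 2) => z; nra.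
have w2' := @integrableZ_real _ (E * RR)%type R lebc _ mC (4^-1) _ w2.
have D2' := @integrableZ_real _ (E * RR)%type R lebc _ mC (T ^+ 2) _ D2.
rewrite (RintegralD mC w2' D2') (RintegralZl _ mC w2) (RintegralZl _ mC D2).
move: le1; move: (Rintegral _ _ _) (Rintegral _ _ _) (Rintegral _ _ _) (T ^+ 2) => z1 z2 z3 z4.
by nra.
Qed.

End source_identities.

(** * The cost functional *)

Lemma memL2_patch d (X : measurableType d) (R : realType) (mu : {measure set X -> \bar R})
    (D D' : set X) (f : X -> R) : D `<=` D' -> memL2 mu D f -> memL2 mu D' (f \_ D).
Proof.
move=> DD'; rewrite /memL2 /memLp => fL; rewrite (_ : (f \_ D) \_ D' = f \_ D)//.
apply/funext => x; rewrite !patchE; case: ifPn => // xD'; rewrite ifF//.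
by apply/negP => /set_mem /DD' xD; move/negP : xD'; apply; exact: mem_set.
Qed.

Section cylinder_source.
Context {R : realType} {d : nat}.
Notation E := 'rV[R]_d.
Local Notation leb := (lebesgue_rV d).
Local Notation lebt := (@lebesgue_measure R).
Local Notation RR := (measurableTypeR R).
Variables (T : R) (Omega : set E).
Hypotheses (mO : measurable Omega).
Local Notation I := (`]0, T[%classic : set R).
Let mI : @measurable _ RR I. Proof. exact: measurable_itv. Qed.
Local Notation cyl := (Omega `*` I : set (E * RR)).
Local Notation lebc := (leb \x lebt)%E.
Local Notation L2cyl u := (memL2 lebc cyl (fun p => u p.1 p.2)).
Let mC : measurable cyl. Proof. exact: measurableX. Qed.
Variable rho : R -> R.
Hypothesis rhoL : memL2 lebt I rho.
Implicit Types (f : E -> R) (v : E -> R -> R).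

Lemma memL2_source f : memL2 leb Omega f -> L2cyl (fun x t => rho t * f x).
Proof.
move=> fL; apply: (@eq_memL2 _ (E * RR)%type R lebc _ mC (fun p => f p.1 * rho p.2)).
  by move=> p _; rewrite mulrC.
exact: (memL2_tensor mO mI fL rhoL).
Qed.

Lemma Rintegral_source_sqr f : memL2 leb Omega f ->
  \int[lebc]_(p in cyl) ((rho p.2 * f p.1) ^+ 2) =
  \int[lebt]_(t in I) (rho t ^+ 2) * \int[leb]_(x in Omega) (f x ^+ 2).
Proof.
move=> fL; have D2 := @memL2_sqr _ (E * RR)%type R lebc _ mC _ (memL2_source fL).
rewrite (Rintegral_fubini1 mO mI D2) -(RintegralZl _ mO (memL2_sqr mO fL)).
apply: eq_Rintegral => x _ /=; rewrite mulrC -(RintegralZl _ mI (memL2_sqr mI rhoL)).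
by apply: eq_Rintegral => t _; rewrite exprMn mulrC.
Qed.

Lemma Rintegral_source_mul f v : memL2 leb Omega f -> L2cyl v ->
  \int[lebc]_(p in cyl) (rho p.2 * f p.1 * v p.1 p.2) =
  \int[leb]_(x in Omega) (\int[lebt]_(t in I) (rho t * v x t) * f x).
Proof.
move=> fL vL; have i := @memL2_mul _ (E * RR)%type R lebc _ mC _ _ (memL2_source fL) vL.
rewrite (Rintegral_fubini1 mO mI i); apply: eq_Rintegral => x; rewrite inE => Ox /=.
have mv : measurable_fun I (v x).
  exact: (measurable_section1 mO mI (@memL2_meas _ (E * RR)%type R lebc _ mC _ vL) Ox).
have mrv : measurable_fun I (fun t => rho t * v x t) by apply: measurable_funM => //; exact: memL2_meas rhoL.
rewrite [RHS]mulrC -(@RintegralZl_measurable _ _ _ lebt _ mI _ _ mrv).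
by apply: eq_Rintegral => t _; ring.
Qed.

(** By Cauchy-Schwarz in time the square is at most the energy of [rho] times that of [v(x,.)],
    which is integrable in [x]. *)
Lemma memL2_time_average v : (leb Omega < +oo)%E -> L2cyl v ->
  memL2 leb Omega (fun x => \int[lebt]_(t in I) (rho t * v x t)).
Proof.
move=> Olty vL.
(* The constant 1, square integrable because [Omega] has finite measure, exhibits the average as an
   inner Fubini integral, hence as a measurable function. *)
have oneL : memL2 leb Omega (fun=> 1).
  apply/(memL2P _ mO); split => //; apply: (measurable_bounded_integrable mO Olty) => //.
  by exists 1; split; [exact: num_real|move=> M M1 x _; rewrite /= expr1n normr1 ltW].
have i := @memL2_mul _ (E * RR)%type R lebc _ mC _ _ (memL2_source oneL) vL.
have mH : measurable_fun Omega (fun x => \int[lebt]_(t in I) (rho t * v x t)).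
  have := integrable_real_meas (integrable_Rintegral1 mO mI i).
  by apply: eq_measurable_fun => x _ /=; apply: eq_Rintegral => t _; rewrite mulr1.
have v2 := @memL2_sqr _ (E * RR)%type R lebc _ mC _ vL.
have Yi := integrable_Rintegral1 mO mI v2.
pose P := \int[lebt]_(t in I) (rho t ^+ 2).
have Bi : leb.-integrable Omega (EFin \o (fun x => P * \int[lebt]_(t in I) (v x t ^+ 2))).
  exact: integrableZ_real.
apply/(memL2P _ mO); split => //; apply/integrableP; split.
  by apply/measurable_EFinP; exact: measurable_funX.
apply: (@le_lt_trans _ _ (\int[leb]_(x in Omega) (P * \int[lebt]_(t in I) (v x t ^+ 2))%:E)%E); last first.
  by have := integrable_fin_num mO Bi; rewrite fin_numElt => /andP[].
apply: ae_ge0_le_integral => //.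
- by apply: measurableT_comp => //; apply/measurable_EFinP; exact: measurable_funX.
- move=> x _; rewrite lee_fin; apply: mulr_ge0; apply: Rintegral_ge0 => t _; exact: sqr_ge0.
- exact: measurable_int Bi.
apply: ae_mono (ae_memL2_section mO vL) => x H Ox; have vx := H Ox.
rewrite /= ger0_norm ?sqr_ge0// lee_fin /P.
have := cauchy_schwarz mI rhoL vx.
have N0 := normL2_ge0 lebt I rho; have N1 := normL2_ge0 lebt I (v x).
rewrite -!normL2_sqr -exprMn; move: (Rintegral _ _ _) => z CS.
by rewrite -(real_normK (num_real z)) lerXn2r ?nnegrE ?mulr_ge0.
Qed.

End cylinder_source.

Section cost_expansion.
Context {R : realType} {d : nat}.
Notation E := 'rV[R]_d.
Local Notation leb := (lebesgue_rV d).
Local Notation lebt := (@lebesgue_measure R).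
Local Notation RR := (measurableTypeR R).
Variables (T beta : R) (Omega omega : set E).
Hypotheses (mO : measurable Omega) (mo : measurable omega).
Local Notation I := (`]0, T[%classic : set R).
Let mI : @measurable _ RR I. Proof. exact: measurable_itv. Qed.
Local Notation cyl := (omega `*` I : set (E * RR)).
Local Notation lebc := (leb \x lebt)%E.
Let mC : measurable cyl. Proof. exact: measurableX. Qed.

(** The cost is quadratic in the state and the control, so this expansion is exact and its remainder
    consists of the two squares. *)
Lemma cost_expansion (ud : E -> R -> R) (u : (E -> R) -> E -> R -> R) (g dg : E -> R) :
  memL2 leb Omega g -> memL2 leb Omega dg ->
  memL2 lebc cyl (fun p => u (g \+ dg) p.1 p.2 - u g p.1 p.2) ->
  memL2 lebc cyl (fun p => u g p.1 p.2 - ud p.1 p.2) ->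
  cost Omega T omega ud beta u (g \+ dg) - cost Omega T omega ud beta u g =
  \int[lebc]_(p in cyl) ((u (g \+ dg) p.1 p.2 - u g p.1 p.2) * (u g p.1 p.2 - ud p.1 p.2)) +
  2^-1 * \int[lebc]_(p in cyl) ((u (g \+ dg) p.1 p.2 - u g p.1 p.2) ^+ 2) +
  (beta * \int[leb]_(x in Omega) (g x * dg x) + beta / 2 * \int[leb]_(x in Omega) (dg x ^+ 2)).
Proof.
move=> gL dgL; set u1 := u (g \+ dg); set u0 := u g => wL eL.
have ew := @memL2_mul _ (E * RR)%type R lebc _ mC _ _ wL eL.
have w2 := @memL2_sqr _ (E * RR)%type R lebc _ mC _ wL.
have e2 := @memL2_sqr _ (E * RR)%type R lebc _ mC _ eL.
have e1 : lebc.-integrable cyl (EFin \o (fun p : E * RR => (u1 p.1 p.2 - ud p.1 p.2) ^+ 2)).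
  have := @memL2_sqr _ (E * RR)%type R lebc _ mC _ (@memL2D _ (E * RR)%type R lebc _ mC _ _ wL eL).
  by apply: (@eq_integrable_real _ (E * RR)%type R lebc _ mC) => p _; rewrite addrA subrK.
have gdg := memL2_mul mO gL dgL; have g2 := memL2_sqr mO gL; have dg2 := memL2_sqr mO dgL.
rewrite /cost -/u1 -/u0.
rewrite -(Rintegral_fubini2 mo mI e1) -(Rintegral_fubini2 mo mI e2).
have -> : \int[lebc]_(p in cyl) ((u1 p.1 p.2 - ud p.1 p.2) ^+ 2) =
   2 * \int[lebc]_(p in cyl) ((u1 p.1 p.2 - u0 p.1 p.2) * (u0 p.1 p.2 - ud p.1 p.2)) +
   (\int[lebc]_(p in cyl) ((u1 p.1 p.2 - u0 p.1 p.2) ^+ 2) + \int[lebc]_(p in cyl) ((u0 p.1 p.2 - ud p.1 p.2) ^+ 2)).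
  have ew' := @integrableZ_real _ (E * RR)%type R lebc _ mC 2 _ ew.
  have we := @integrableD_real _ (E * RR)%type R lebc _ mC _ _ w2 e2.
  rewrite -(RintegralZl _ mC ew) -(RintegralD mC w2 e2) -(RintegralD mC ew' we).
  by apply: eq_Rintegral => p _; ring.
have -> : \int[leb]_(x in Omega) ((g \+ dg) x ^+ 2) = \int[leb]_(x in Omega) (g x ^+ 2) +
    (2 * \int[leb]_(x in Omega) (g x * dg x) + \int[leb]_(x in Omega) (dg x ^+ 2)).
  have gdg' := integrableZ_real mO 2 gdg.
  rewrite -(RintegralZl _ mO gdg) -(RintegralD mO gdg' dg2) -(RintegralD mO g2 (integrableD_real mO gdg' dg2)).
  by apply: eq_Rintegral => x _ /=; ring.
move: (\int[lebc]_(p in cyl) ((u1 p.1 p.2 - u0 p.1 p.2) * (u0 p.1 p.2 - ud p.1 p.2))) => z1.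
move: (\int[lebc]_(p in cyl) ((u1 p.1 p.2 - u0 p.1 p.2) ^+ 2)) (\int[lebc]_(p in cyl) ((u0 p.1 p.2 - ud p.1 p.2) ^+ 2)) => z2 z3.
move: (Rintegral _ _ _) (Rintegral _ _ _) (Rintegral _ _ _) => z4 z5 z6.
by field.
Qed.

End cost_expansion.

Theorem theorem2 (R : realType) (d : nat) (T q alpha beta : R)
  (Omega omega : set 'rV[R]_d) (A : 'rV[R]_d -> 'M[R]_d) (c : 'rV[R]_d -> R)
  (a : 'rV[R]_d -> R) (rho : R -> R) (ud : 'rV[R]_d -> R -> R)
  (u : ('rV[R]_d -> R) -> 'rV[R]_d -> R -> R)
  (d_gt0 : (0 < d)%N) (T_gt0 : 0 < T) (q_gt0 : 0 < q)
  (alpha01 : 0 < alpha < 1) (beta_gt0 : 0 < beta)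
  (Omega_domain : domain Omega) (Omega_bounded : bounded_set Omega)
  (Omega_smooth : smooth_boundary Omega)
  (omega_domain : domain omega) (omega_sub : omega `<=` Omega)
  (coeffs : elliptic_coeffs Omega A c)
  (aH10 : memH10 Omega a)
  (rhoL2 : memL2 (@lebesgue_measure R) `]0, T[ rho)
  (udL2 : memL2 (lebesgue_rV d \x @lebesgue_measure R)%E (cylinder omega T)
            (fun p => ud p.1 p.2))
  (u_sol : forall g, memL2 (lebesgue_rV d) Omega g ->
     forward_solution Omega A c T q alpha a rho g (u g))
  (g : 'rV[R]_d -> R) (gL2 : memL2 (lebesgue_rV d) Omega g)
  (v : 'rV[R]_d -> R -> R)
  (v_sol : adjoint_solution Omega A c T q alpha
     (fun x t => \1_omega x * (u g x t - ud x t)) v) :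
  is_L2_derivative Omega (cost Omega T omega ud beta u) g
    (fun x => \int[@lebesgue_measure R]_(t in `]0, T[) (rho t * v x t)
              + beta * g x).
Proof.
have /andP[a0 a1] := alpha01; have q0 := ltW q_gt0.
have oO : open Omega by case: Omega_domain.
have oo : open omega by case: omega_domain.
have mO := measurable_open oO; have mo := measurable_open oo.
have Olty := lebesgue_Omega_lty oO Omega_bounded.
pose I : set R := `]0, T[%classic.
have mI : @measurable _ (measurableTypeR R) I by exact: measurable_itv.
pose cyl : set ('rV[R]_d * measurableTypeR R) := Omega `*` I.
pose cylo : set ('rV[R]_d * measurableTypeR R) := omega `*` I.
have mC : measurable cyl by exact: measurableX.
have mCo : measurable cylo by exact: measurableX.
have sub : cylo `<=` cyl by move=> [x t] [/= ox It]; split => //; exact: omega_sub.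
pose lebc := (lebesgue_rV d \x @lebesgue_measure R)%E.
have aL : memL2 (lebesgue_rV d) Omega a by case: aH10 => -[].
have L2sub (f : 'rV[R]_d * measurableTypeR R -> R) : memL2 lebc cyl f -> memL2 lebc cylo f.
  move=> /(@memL2P _ ('rV[R]_d * measurableTypeR R)%type R lebc _ mC)[mf fi].
  apply/(@memL2P _ ('rV[R]_d * measurableTypeR R)%type R lebc _ mCo); split.
    exact: measurable_funS mC sub mf.
  exact: (@integrableS _ ('rV[R]_d * measurableTypeR R)%type R lebc _ _ _ mC mCo sub fi).
have [_ u0H _ _] := u_sol g gL2; have [u0L _ _] := weak_dt_spec oO u0H.
pose e0 (p : 'rV[R]_d * measurableTypeR R) := u g p.1 p.2 - ud p.1 p.2.
have eL : memL2 lebc cylo e0.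
  exact: (@memL2B _ ('rV[R]_d * measurableTypeR R)%type R lebc _ mCo _ _ (L2sub _ u0L) udL2).
pose F x t := \1_omega x * (u g x t - ud x t).
have FL : memL2 lebc cyl (fun p => F p.1 p.2).
  (* Nothing is known of [ud] outside [omega]; the indicator makes the adjoint source the extension
     by zero of a function on the smaller cylinder. *)
  apply: (@eq_memL2 _ ('rV[R]_d * measurableTypeR R)%type R lebc _ mC (e0 \_ cylo)).
    move=> [x t] /set_mem[/= Ox It]; rewrite patchE /F indicE.
    have -> : ((x, t) \in cylo) = (x \in omega).
      by apply/idP/idP => [/set_mem[] /= ? _|/set_mem ?]; exact: mem_set.
    by case: (x \in omega); rewrite ?mul1r ?mul0r.
  exact: (memL2_patch sub eL).
have mF := @memL2_meas _ ('rV[R]_d * measurableTypeR R)%type R lebc _ mC _ FL.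
have [m [n [Av [[vL mL nL SL] AvE vE zE SE]]]] := adjoint_spec T_gt0 a0 a1 oO v_sol mF.
have HL := memL2_time_average mO rhoL2 Olty vL.
split; first by apply: (memL2D mO HL); exact: memL2Z.
set P := \int[@lebesgue_measure R]_(t in I) (rho t ^+ 2).
have P0 : 0 <= P by apply: Rintegral_ge0 => t _; exact: sqr_ge0.
(* Half the stability constant [4 T^2] times the energy of [rho], plus the share of the
   regularisation: the remainder is at most [C] times the squared norm of [dg]. *)
pose C := 2 * T ^+ 2 * P + beta / 2.
have C0 : 0 < C.
  apply: ltr_wpDl; last exact: divr_gt0.
  by apply: mulr_ge0 => //; apply: mulr_ge0 => //; exact: sqr_ge0.
move=> eps eps0; exists (eps / C) => [|dg dgL dgeta]; first exact: divr_gt0.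
have gdgL : memL2 (lebesgue_rV d) Omega (g \+ dg) := memL2D mO gL2 dgL.
have [h [Aw [[_ u1L hL mAw] AwE wE hE]]] := forward_difference T_gt0 a1 oO aL (u_sol g gL2) (u_sol _ gdgL).
pose D x t := rho t * dg x.
have DL : memL2 lebc cyl (fun p => D p.1 p.2) := memL2_source mO rhoL2 dgL.
have KE : {ae lebesgue_rV d, forall x, Omega x -> {ae @lebesgue_measure R, forall t, I t ->
    h x t + q * frac_int alpha (h x) t = D x t - Aw x t}}.
  apply: ae_mono hE => x H Ox; apply: ae_mono (H Ox) => t + It => /(_ It) ->.
  by rewrite /D; congr (_ * _ - _); rewrite addrAC subrr add0r.
have ident := source_identity a1 q0 oO Omega_bounded coeffs u0L u1L hL DL mAw AwE wE KE vL mL nL FL SL AvE vE zE SE.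
have stab := source_stability T_gt0 a0 a1 q0 oO Omega_bounded coeffs u0L u1L hL DL mAw AwE wE KE.
have wL : memL2 lebc cyl (fun p => u (g \+ dg) p.1 p.2 - u g p.1 p.2).
  exact: (@memL2B _ ('rV[R]_d * measurableTypeR R)%type R lebc _ mC _ _ u1L u0L).
have -> := cost_expansion beta mO mo gL2 dgL (L2sub _ wL) eL.
have identF : \int[lebc]_(p in cyl) ((u (g \+ dg) p.1 p.2 - u g p.1 p.2) * F p.1 p.2) =
    \int[lebc]_(p in cylo) ((u (g \+ dg) p.1 p.2 - u g p.1 p.2) * (u g p.1 p.2 - ud p.1 p.2)).
  rewrite (@Rintegral_eq0_outside _ _ _ lebc cylo)//; last first.
    move=> [x t] /= [_ It] nC; rewrite /F indicE memNset ?mul0r ?mulr0// => ox; exact: nC.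
  by apply: eq_Rintegral => -[x t] /set_mem[/= ox It]; rewrite /F indicE mem_set// mul1r.
(* Duality replaces the term linear in the increment of the state by one explicit in [dg], since [v]
   does not depend on the direction. *)
rewrite -identF -ident (Rintegral_source_mul mO rhoL2 dgL vL).
have gdg := memL2_mul mO gL2 dgL; have Hdg := memL2_mul mO HL dgL.
have -> : \int[lebesgue_rV d]_(x in Omega)
    ((\int[@lebesgue_measure R]_(t in `]0, T[) (rho t * v x t) + beta * g x) * dg x) =
    \int[lebesgue_rV d]_(x in Omega) (\int[@lebesgue_measure R]_(t in I) (rho t * v x t) * dg x) +
    beta * \int[lebesgue_rV d]_(x in Omega) (g x * dg x).
  rewrite -(RintegralZl _ mO gdg) -(RintegralD mO Hdg (integrableZ_real mO beta gdg)).
  by apply: eq_Rintegral => x _; rewrite mulrDl mulrA.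
have w2 := @memL2_sqr _ ('rV[R]_d * measurableTypeR R)%type R lebc _ mC _ wL.
have w2o := @memL2_sqr _ ('rV[R]_d * measurableTypeR R)%type R lebc _ mCo _ (L2sub _ wL).
have wo : \int[lebc]_(p in cylo) ((u (g \+ dg) p.1 p.2 - u g p.1 p.2) ^+ 2) <=
    \int[lebc]_(p in cyl) ((u (g \+ dg) p.1 p.2 - u g p.1 p.2) ^+ 2).
  by apply: le_Rintegral_subset => // p _; exact: sqr_ge0.
have wo0 : 0 <= \int[lebc]_(p in cylo) ((u (g \+ dg) p.1 p.2 - u g p.1 p.2) ^+ 2).
  by apply: Rintegral_ge0 => p _; exact: sqr_ge0.
rewrite (Rintegral_source_sqr mO rhoL2 dgL) -/P -(normL2_sqr (lebesgue_rV d) Omega dg) in stab.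
have N0 := normL2_ge0 (lebesgue_rV d) Omega dg.
rewrite -(normL2_sqr (lebesgue_rV d) Omega dg); move: (normL2 _ _ _) N0 dgeta stab => N N0 dgeta stab.
move: (\int[lebc]_(p in cylo) ((u (g \+ dg) p.1 p.2 - u g p.1 p.2) ^+ 2)) wo wo0 => z1 wo wo0.
have {wo} wo := le_trans wo stab.
move: (Rintegral _ _ _) (Rintegral _ _ _) => z2 z3.
(* The first-order terms have cancelled: half the square of the state increment over [omega] and the
   square of [dg] remain. *)
rewrite (_ : _ - _ = 2^-1 * z1 + beta / 2 * N ^+ 2); last by ring.
rewrite ger0_norm; last first.
  by rewrite addr_ge0// mulr_ge0// ?sqr_ge0// divr_ge0// ltW.
apply: (@le_trans _ _ (C * N ^+ 2)).
  rewrite /C mulrDl lerD2r ler_pdivrMl//.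
  by have -> : 2 * (2 * T ^+ 2 * P * N ^+ 2) = 4 * T ^+ 2 * (P * N ^+ 2) by ring.
rewrite expr2 mulrA ler_wpM2r//.
by rewrite mulrC -ler_pdivlMr// ltW.
Qed.
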